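(* Let $\mathbf{k}$ be a field with characteristic not equal to $2$. Let $\Gamma$ be a finite simple graph with vertex set $V=\{1,\dots,n\}$ and edge set $E=\{1,\dots,m\}$, in which each vertex $i$ is labeled with a positive integer weight $p_i$; for $j\in E$ let $a_j,b_j$ denote its endpoints and let $q_j=p_{a_j}+p_{b_j}$. Let $\mathbf{k}\langle x_1,\dots,x_n\rangle$ be the free associative algebra graded by $|x_i|=p_i$. Let $B(\Gamma)$ be the subalgebra of $\mathbf{k}\langle x_1,\dots,x_n\rangle$ generated by the graded commutators $[x_{a_j},x_{b_j}]$, $j\in E$, let $I(\Gamma)$ be the two-sided ideal generated by these commutators, and let $A(\Gamma)=\mathbf{k}\langle x_1,\dots,x_n\rangle/I(\Gamma)$. Then the following are equivalent: 1. The graph $\Gamma$ does not contain a triangle, i.e. a $3$-cycle. 2. $\mathbf{k}\langle x_1,\dots,x_n\rangle\cong B(\Gamma)\amalg A(\Gamma)$ as graded vector spaces. 3. The Hilbert series of $A(\Gamma)$ is $$H_{A(\Gamma)}(z)=\frac{1}{1-(z^{p_1}+\cdots+z^{p_n})+(z^{q_1}+\cdots+z^{q_m})}.$$ 4. $A(\Gamma)$ has global dimension $\le 2$.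
   Context: The graded commutator of homogeneous elements is $[a,b]=ab-(-1)^{|a||b|}ba$. For associative (unital, graded) algebras $A$ and $B$, $A\amalg B$ denotes their free product (coproduct of associative $\mathbf{k}$-algebras), with the induced grading. The Hilbert series of a non-negatively graded $\mathbf{k}$-algebra $A=\bigoplus_{n\ge0}A_n$ with finite-dimensional pieces is $H_A(z)=\sum_{n\ge0}(\dim_{\mathbf{k}}A_n)z^n$, a formal power series; the fraction in item 3 is an inverse in the ring of formal power series over $\mathbb{Z}$. *)

(* Defs.v *)
From HB Require Import structures.
From mathcomp Require Import all_boot all_order all_algebra.
From mathcomp Require Import boolp.
From mathcomp Require Import finmap monalg.

Set Implicit Arguments.
Unset Strict Implicit.
Unset Printing Implicit Defensive.

Import GRing.Theory.
Local Open Scope ring_scope.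
Set Warnings "-redundant-canonical-projection".

Fact malg_scalerAr (k : fieldType) (M : monomType) (c : k)
  (x y : {malg k[M]}) : c *: (x * y) = x * (c *: y).
Proof.
rewrite (malgMEw (fsubset_refl _) (msuppZ_le c y)) malgME scaler_sumr.
apply: eq_bigr => u _; rewrite scaler_sumr; apply: eq_bigr => v _.
apply/malgP => w.
rewrite [LHS]mcoeffZ [X in c * X]mcoeffU [RHS]mcoeffU.
by rewrite [(c *: y)@_v]mcoeffZ mulrCA mulrnAr.
Qed.

Fact malg_scaleU (k : fieldType) (M : monomType) (c : k) (w : M) :
  << c *g w >> = c *: (<< w >> : {malg k[M]}).
Proof.
apply/malgP => v; rewrite [LHS]mcoeffU [RHS]mcoeffZ [X in c * X]mcoeffU.
by rewrite mulr_natr.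
Qed.

Section FreeAlgebra.
Variables (k : fieldType) (T : choiceType).

(* k<T>: words over T are the elements of the free monoid {fmonom T}. The alias
   is needed because {malg k[M]} already carries an algType instance that
   requires M to be commutative. *)
Definition free_alg : Type := {malg k[{fmonom T}]}.

HB.instance Definition _ := GRing.Lalgebra.on free_alg.

Fact free_alg_scalerAr (c : k) (x y : free_alg) : c *: (x * y) = x * (c *: y).
Proof. exact: malg_scalerAr. Qed.

HB.instance Definition _ :=
  GRing.Lalgebra_isAlgebra.Build k free_alg free_alg_scalerAr.

Definition fvar (t : T) : free_alg := << fmu t >>.

Definition word_weight (p : T -> nat) (w : {fmonom T}) : nat :=
  (\sum_(t <- (w : seq T)) p t)%N.

(* Throughout, a grading on V is given by the predicates gr d : V -> Prop of
   membership in the homogeneous component of degree d (which contains 0). *)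
Definition free_gr (p : T -> nat) (d : nat) (x : free_alg) : Prop :=
  forall w, w \in msupp x -> word_weight p w = d.

Section Lift.
Variables (C : algType k) (phi : T -> C).

Definition word_prod (w : {fmonom T}) : C := \prod_(t <- (w : seq T)) phi t.

Fact word_prod_mmorphism : mmorphism word_prod.
Proof.
split=> [u v|]; first by rewrite /word_prod fmM big_cat.
by rewrite /word_prod fm1 big_nil.
Qed.

HB.instance Definition _ :=
  monalg.isMultiplicative.Build {fmonom T} C word_prod word_prod_mmorphism.

Definition free_lift : free_alg -> C := mmap (in_alg C) word_prod.

Fact free_lift_is_zmod_morphism : zmod_morphism free_lift.
Proof. exact: mmap_is_additive. Qed.

HB.instance Definition _ :=
  GRing.isZmodMorphism.Build free_alg C free_lift free_lift_is_zmod_morphism.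

Fact free_lift_is_monoid_morphism : monoid_morphism free_lift.
Proof.
have [] // := @commr_mmap_is_multiplicative _ _ _ (in_alg C) word_prod.
by move=> g u v; rewrite /GRing.comm /= mulr_algl mulr_algr.
Qed.

HB.instance Definition _ :=
  GRing.isMonoidMorphism.Build free_alg C free_lift
    free_lift_is_monoid_morphism.

Fact free_lift_is_scalable : scalable free_lift.
Proof. by move=> c x; rewrite /free_lift mmapZ /= mulr_algl. Qed.

HB.instance Definition _ :=
  GRing.isScalable.Build k free_alg C *:%R free_lift free_lift_is_scalable.

Lemma free_lift_var t : free_lift (fvar t) = phi t.
Proof.
by rewrite /free_lift /fvar mmapU /= scale1r mul1r /word_prod fmU big_seq1.
Qed.

Lemma free_lift_uniq (f : free_alg -> C) :
  linear f -> monoid_morphism f -> (forall t, f (fvar t) = phi t) ->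
  f =1 free_lift.
Proof.
move=> f_lin f_mon f_var x.
pose fL := GRing.isLinear.Build k free_alg C *:%R f f_lin.
pose F : {linear free_alg -> C} := HB.pack f fL.
rewrite -[f]/(F : free_alg -> C) [x]monalgE !raddf_sum /=.
apply: eq_bigr => w _; rewrite /free_lift mmapU /= mulr_algl.
rewrite malg_scaleU -[f]/(F : free_alg -> C) linearZ /=; congr (_ *: _).
case: w => s; rewrite /word_prod /=; elim: s => [|t s IHs].
  rewrite big_nil -[RHS]f_mon.1; congr f; congr (<< _ >>).
  by apply/eqP; rewrite fmP fm1.
rewrite big_cons -IHs -f_var -f_mon.2; congr f.
rewrite /fvar; apply/malgP => v.
rewrite malgME !msuppU1 !big_seq_fset1 !mcoeffUU mulr1.
congr (mcoeff _ (<< _ >>)); apply/eqP.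
by rewrite fmP fmM fmU.
Qed.

End Lift.

End FreeAlgebra.

Section GeneratedSubalgebra.
Variables (k : fieldType) (A : algType k) (S : A -> Prop).

Inductive subalg_gen : A -> Prop :=
| SubalgGen x of S x : subalg_gen x
| SubalgOne : subalg_gen 1
| SubalgLin c x y of subalg_gen x & subalg_gen y : subalg_gen (c *: x + y)
| SubalgMul x y of subalg_gen x & subalg_gen y : subalg_gen (x * y).

Definition subalg_pred : pred A := fun x => `[< subalg_gen x >].

Fact subalg_pred_closed : subalg_closed subalg_pred.
Proof.
split=> [|c x y|x y]; first exact/asboolP/SubalgOne.
- by move=> /asboolP ? /asboolP ?; apply/asboolP/SubalgLin.
- by move=> /asboolP ? /asboolP ?; apply/asboolP/SubalgMul.
Qed.

HB.instance Definition _ :=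
  GRing.isSubalgClosed.Build k A subalg_pred subalg_pred_closed.

Record subalg : Type := Subalg { subalg_val : A; _ : subalg_pred subalg_val }.

HB.instance Definition _ := [isSub for subalg_val].
HB.instance Definition _ := [Choice of subalg by <:].
HB.instance Definition _ := [SubChoice_isSubAlgebra of subalg by <:].

End GeneratedSubalgebra.

Section QuotientAlgebra.
Variables (k : fieldType) (A : algType k) (S : A -> Prop).

Inductive ideal_gen : A -> Prop :=
| IdealGen x of S x : ideal_gen x
| IdealZero : ideal_gen 0
| IdealSub x y of ideal_gen x & ideal_gen y : ideal_gen (x - y)
| IdealMull a x of ideal_gen x : ideal_gen (a * x)
| IdealMulr x a of ideal_gen x : ideal_gen (x * a).

Definition ideal_pred : pred A := fun x => `[< ideal_gen x >].

Fact ideal_pred_closed : zmod_closed ideal_pred.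
Proof.
split=> [|x y]; first exact/asboolP/IdealZero.
by move=> /asboolP ? /asboolP ?; apply/asboolP/IdealSub.
Qed.

HB.instance Definition _ :=
  GRing.isZmodClosed.Build A ideal_pred ideal_pred_closed.

Definition ideal : zmodClosed A := GRing.ZmodClosed.clone A ideal_pred _.

Definition alg_quot : Type := {ideal_quot ideal}.

(* alg_quot is only a pzRingType and an lmodType in general, since lalgType and
   algType require 1 != 0, that is, a proper ideal. *)
HB.instance Definition _ := GRing.Zmodule.on alg_quot.

Definition quot_pi (x : A) : alg_quot := (\pi_({ideal_quot ideal}) x)%qT.

Lemma quot_pi_surj (y : alg_quot) : exists x, quot_pi x = y.
Proof. by exists (repr (y : {ideal_quot ideal})); rewrite /quot_pi reprK. Qed.

Lemma quot_pi_eq x y : quot_pi x = quot_pi y <-> ideal_gen (x - y).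
Proof.
split=> [e|/asboolP xy]; first apply/asboolP; last apply/eqP.
- by change (is_true (x - y \in ideal)); rewrite Quotient.idealrBE; apply/eqP.
- by change (is_true (x - y \in ideal)) in xy; rewrite -Quotient.idealrBE.
Qed.

Fact quot_pi_is_zmod_morphism : zmod_morphism quot_pi.
Proof. exact: (raddfB (\pi_({ideal_quot ideal})%qT)). Qed.

HB.instance Definition _ :=
  GRing.isZmodMorphism.Build A alg_quot quot_pi quot_pi_is_zmod_morphism.

Let qrepr (y : alg_quot) : A := repr (y : {ideal_quot ideal}).

Let qreprK y : quot_pi (qrepr y) = y. Proof. exact: reprK. Qed.

Definition quot_one : alg_quot := quot_pi 1.
Definition quot_mul (x y : alg_quot) : alg_quot := quot_pi (qrepr x * qrepr y).
Definition quot_scale (c : k) (x : alg_quot) : alg_quot :=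
  quot_pi (c *: qrepr x).

Fact quot_piM x y : quot_pi (x * y) = quot_mul (quot_pi x) (quot_pi y).
Proof.
apply/quot_pi_eq; set x' := qrepr _; set y' := qrepr _.
have /quot_pi_eq Ix : quot_pi x = quot_pi x' by rewrite qreprK.
have /quot_pi_eq Iy : quot_pi y' = quot_pi y by rewrite qreprK.
have -> : x * y - x' * y' = (x - x') * y - x' * (y' - y).
  by rewrite mulrBl mulrBr opprB addrA subrK.
by apply: IdealSub; [apply: IdealMulr | apply: IdealMull].
Qed.

Fact quot_piZ c x : quot_pi (c *: x) = quot_scale c (quot_pi x).
Proof.
apply/quot_pi_eq; set x' := qrepr _; rewrite -scalerBr -mulr_algl.
by apply/IdealMull/quot_pi_eq; rewrite qreprK.
Qed.

Fact quot_mulA : associative quot_mul.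
Proof.
move=> x y z; rewrite -[x]qreprK -[y]qreprK -[z]qreprK.
by rewrite -!quot_piM mulrA.
Qed.

Fact quot_mul1r : left_id quot_one quot_mul.
Proof. by move=> x; rewrite -[x]qreprK -quot_piM mul1r. Qed.

Fact quot_mulr1 : right_id quot_one quot_mul.
Proof. by move=> x; rewrite -[x]qreprK -quot_piM mulr1. Qed.

Fact quot_mulrDl : left_distributive quot_mul +%R.
Proof.
move=> x y z; rewrite -[x]qreprK -[y]qreprK -[z]qreprK.
by rewrite -raddfD -!quot_piM mulrDl raddfD.
Qed.

Fact quot_mulrDr : right_distributive quot_mul +%R.
Proof.
move=> x y z; rewrite -[x]qreprK -[y]qreprK -[z]qreprK.
by rewrite -raddfD -!quot_piM mulrDr raddfD.
Qed.

HB.instance Definition _ := GRing.Zmodule_isPzRing.Build alg_quot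
  quot_mulA quot_mul1r quot_mulr1 quot_mulrDl quot_mulrDr.

Fact quot_pi_is_monoid_morphism : monoid_morphism quot_pi.
Proof. by split=> // x y; rewrite quot_piM. Qed.

HB.instance Definition _ :=
  GRing.isMonoidMorphism.Build A alg_quot quot_pi quot_pi_is_monoid_morphism.

Fact quot_scalerA a b x :
  quot_scale a (quot_scale b x) = quot_scale (a * b) x.
Proof. by rewrite -[x]qreprK -!quot_piZ scalerA. Qed.

Fact quot_scale1r : left_id 1 quot_scale.
Proof. by move=> x; rewrite -[x]qreprK -quot_piZ scale1r. Qed.

Fact quot_scalerDr : right_distributive quot_scale +%R.
Proof.
move=> a x y; rewrite -[x]qreprK -[y]qreprK.
by rewrite -raddfD -!quot_piZ scalerDr raddfD.
Qed.

Fact quot_scalerDl x : {morph quot_scale^~ x : a b / a + b}.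
Proof. by move=> a b; rewrite -[x]qreprK -!quot_piZ scalerDl raddfD. Qed.

HB.instance Definition _ := GRing.Zmodule_isLmodule.Build k alg_quot
  quot_scalerA quot_scale1r quot_scalerDr quot_scalerDl.

Fact quot_pi_is_scalable : scalable quot_pi.
Proof. by move=> c x; rewrite quot_piZ. Qed.

HB.instance Definition _ :=
  GRing.isScalable.Build k A alg_quot *:%R quot_pi quot_pi_is_scalable.

Let pi_scale (c : k) x : c *: quot_pi x = quot_pi (c *: x).
Proof. by rewrite quot_piZ. Qed.

Lemma quot_scalerAl (c : k) (x y : alg_quot) : c *: (x * y) = (c *: x) * y.
Proof.
rewrite -[x]qreprK -[y]qreprK.
by rewrite pi_scale -!rmorphM pi_scale scalerAl.
Qed.

Lemma quot_scalerAr (c : k) (x y : alg_quot) : c *: (x * y) = x * (c *: y).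
Proof.
rewrite -[x]qreprK -[y]qreprK.
by rewrite pi_scale -!rmorphM pi_scale scalerAr.
Qed.

Lemma ideal_gen_lift (C : algType k) (f : {lrmorphism A -> C}) :
  (forall x, S x -> f x = 0) -> forall x, ideal_gen x -> f x = 0.
Proof.
move=> fS x; elim=> [|||a y _ fy|y a _ fy] //; first exact: raddf0.
- by move=> y z _ fy _ fz; rewrite raddfB /= fy fz subrr.
- by rewrite rmorphM /= fy mulr0.
- by rewrite rmorphM /= fy mul0r.
Qed.

Definition quot_lift (C : algType k) (f : A -> C) (y : alg_quot) : C :=
  f (qrepr y).

Lemma quot_liftE (C : algType k) (f : {lrmorphism A -> C}) :
  (forall x, S x -> f x = 0) -> forall x, quot_lift f (quot_pi x) = f x.
Proof.
move=> fS x; apply/eqP; rewrite -subr_eq0 /quot_lift -raddfB.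
by apply/eqP/ideal_gen_lift/quot_pi_eq => //; rewrite qreprK.
Qed.

End QuotientAlgebra.

(* The coproduct of A and B, presented with all elements of A and B as
   generators; see free_prod_lift for its universal property. *)
Section FreeProduct.
Variables (k : fieldType) (A B : algType k).

Let gen : choiceType := (A + B)%type.
Let genl (a : A) : free_alg k gen := fvar k (inl a : gen).
Let genr (b : B) : free_alg k gen := fvar k (inr b : gen).

Inductive free_prod_rel : free_alg k gen -> Prop :=
| FreeProdLinl c x y :
    free_prod_rel (genl (c *: x + y) - (c *: genl x + genl y))
| FreeProdMull x y : free_prod_rel (genl (x * y) - genl x * genl y)
| FreeProdOnel : free_prod_rel (genl 1 - 1)
| FreeProdLinr c x y :
    free_prod_rel (genr (c *: x + y) - (c *: genr x + genr y))
| FreeProdMulr x y : free_prod_rel (genr (x * y) - genr x * genr y)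
| FreeProdOner : free_prod_rel (genr 1 - 1).

Definition free_prod : Type := alg_quot free_prod_rel.

HB.instance Definition _ := GRing.PzRing.on free_prod.
HB.instance Definition _ := GRing.Lmodule.on free_prod.

Definition free_prod_inl (a : A) : free_prod := quot_pi free_prod_rel (genl a).
Definition free_prod_inr (b : B) : free_prod := quot_pi free_prod_rel (genr b).

Fact free_prod_inl_is_linear : linear free_prod_inl.
Proof.
move=> c x y; rewrite -linearP; apply/quot_pi_eq/IdealGen.
exact: FreeProdLinl.
Qed.

Fact free_prod_inl_is_monoid_morphism : monoid_morphism free_prod_inl.
Proof.
split=> [|x y].
  rewrite -(rmorph1 (quot_pi free_prod_rel)).
  exact/quot_pi_eq/IdealGen/FreeProdOnel.
rewrite -(rmorphM (quot_pi free_prod_rel)).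
exact/quot_pi_eq/IdealGen/FreeProdMull.
Qed.

Fact free_prod_inr_is_linear : linear free_prod_inr.
Proof.
move=> c x y; rewrite -linearP; apply/quot_pi_eq/IdealGen.
exact: FreeProdLinr.
Qed.

Fact free_prod_inr_is_monoid_morphism : monoid_morphism free_prod_inr.
Proof.
split=> [|x y].
  rewrite -(rmorph1 (quot_pi free_prod_rel)).
  exact/quot_pi_eq/IdealGen/FreeProdOner.
rewrite -(rmorphM (quot_pi free_prod_rel)).
exact/quot_pi_eq/IdealGen/FreeProdMulr.
Qed.

HB.instance Definition _ :=
  GRing.isLinear.Build k A free_prod *:%R free_prod_inl free_prod_inl_is_linear.
HB.instance Definition _ :=
  GRing.isMonoidMorphism.Build A free_prod free_prod_inl
    free_prod_inl_is_monoid_morphism.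
HB.instance Definition _ :=
  GRing.isLinear.Build k B free_prod *:%R free_prod_inr free_prod_inr_is_linear.
HB.instance Definition _ :=
  GRing.isMonoidMorphism.Build B free_prod free_prod_inr
    free_prod_inr_is_monoid_morphism.

Section UniversalProperty.
Variables (C : algType k) (f : {lrmorphism A -> C}) (g : {lrmorphism B -> C}).

Let phi (t : gen) : C := match t with inl a => f a | inr b => g b end.

Let phi_rel x : free_prod_rel x -> free_lift phi x = 0.
Proof.
case=> [c a b|a b||c a b|a b|]; apply/eqP; rewrite raddfB subr_eq0 /=.
- by rewrite linearP /= !free_lift_var /phi /= linearP.
- by rewrite rmorphM /= !free_lift_var /phi /= rmorphM.
- by rewrite rmorph1 /= free_lift_var /phi /= rmorph1.
- by rewrite linearP /= !free_lift_var /phi /= linearP.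
- by rewrite rmorphM /= !free_lift_var /phi /= rmorphM.
- by rewrite rmorph1 /= free_lift_var /phi /= rmorph1.
Qed.

Definition free_prod_lift : free_prod -> C := quot_lift (free_lift phi).

Lemma free_prod_lift_linear : linear free_prod_lift.
Proof.
move=> c x y; have [x' <-] := quot_pi_surj x; have [y' <-] := quot_pi_surj y.
by rewrite -linearP /free_prod_lift !quot_liftE ?linearP.
Qed.

Lemma free_prod_lift_monoid_morphism : monoid_morphism free_prod_lift.
Proof.
split=> [|x y]; first by rewrite [LHS]quot_liftE ?rmorph1.
have [x' <-] := quot_pi_surj x; have [y' <-] := quot_pi_surj y.
by rewrite -rmorphM /free_prod_lift !quot_liftE ?rmorphM.
Qed.

Lemma free_prod_lift_inl a : free_prod_lift (free_prod_inl a) = f a.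
Proof. by rewrite [LHS]quot_liftE //= free_lift_var. Qed.

Lemma free_prod_lift_inr b : free_prod_lift (free_prod_inr b) = g b.
Proof. by rewrite [LHS]quot_liftE //= free_lift_var. Qed.

Lemma free_prod_lift_uniq (h : free_prod -> C) :
  linear h -> monoid_morphism h ->
  (forall a, h (free_prod_inl a) = f a) ->
  (forall b, h (free_prod_inr b) = g b) ->
  h =1 free_prod_lift.
Proof.
move=> h_lin h_mon hl hr y; have [x <-] := quot_pi_surj y.
rewrite [RHS]quot_liftE //.
apply: (free_lift_uniq (f := h \o quot_pi free_prod_rel)).
- by move=> c u v /=; rewrite linearP h_lin.
- split=> [|u v] /=; first by rewrite rmorph1 h_mon.1.
  by rewrite rmorphM h_mon.2.
- by case=> t; [exact: hl | exact: hr].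
Qed.

End UniversalProperty.

(* The induced grading: the smallest family of subspaces that contains the
   components of A and B and is compatible with products. *)
Inductive free_prod_gr (grA : nat -> A -> Prop) (grB : nat -> B -> Prop) :
    nat -> free_prod -> Prop :=
| FreeProdGrl d a of grA d a : free_prod_gr grA grB d (free_prod_inl a)
| FreeProdGrr d b of grB d b : free_prod_gr grA grB d (free_prod_inr b)
| FreeProdGrLin d c x y of free_prod_gr grA grB d x & free_prod_gr grA grB d y :
    free_prod_gr grA grB d (c *: x + y)
| FreeProdGrMul d e x y of free_prod_gr grA grB d x & free_prod_gr grA grB e y :
    free_prod_gr grA grB (d + e)%N (x * y).

End FreeProduct.

Section GradedSpaces.
Variable k : fieldType.

Definition gr_iso (U V : lmodType k)
    (grU : nat -> U -> Prop) (grV : nat -> V -> Prop) : Prop :=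
  exists2 f : {linear U -> V}, bijective f &
    forall d x, grU d x <-> grV d (f x).

Definition has_dim (V : lmodType k) (W : V -> Prop) (N : nat) : Prop :=
  exists b : 'I_N -> V,
    [/\ forall i, W (b i),
        forall c : 'I_N -> k, \sum_i c i *: b i = 0 -> forall i, c i = 0
      & forall x, W x -> exists c : 'I_N -> k, x = \sum_i c i *: b i].

(* Power series over int are coefficient functions nat -> int. *)
Definition is_hilbert_series (V : lmodType k) (gr : nat -> V -> Prop)
    (h : nat -> int) : Prop :=
  forall d, exists2 N, has_dim (gr d) N & h d = N%:Z.

End GradedSpaces.

Definition ps_one : nat -> int := fun d => (d == 0%N)%:R.

Definition ps_X (e : nat) : nat -> int := fun d => (d == e)%:R.

Definition ps_mul (f g : nat -> int) : nat -> int :=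
  fun d => \sum_(i < d.+1) f i * g (d - i)%N.

(* g = 1 / f; the product is commutative, so a one-sided condition suffices. *)
Definition ps_is_inv (f g : nat -> int) : Prop := ps_mul f g =1 ps_one.

Section GlobalDimension.
Variable R : pzRingType.

Definition projective_module (P : lmodType R) : Prop :=
  forall (M N : lmodType R) (g : {linear M -> N}) (f : {linear P -> N}),
    (forall y, exists x, g x = y) ->
    exists h : {linear P -> M}, forall x, g (h x) = f x.

(* M has a projective resolution ... -> P 1 -> P 0 -> M -> 0 with P i = 0 for
   all i > d. *)
Definition proj_dim_le (d : nat) (M : lmodType R) : Prop :=
  exists (P : nat -> lmodType R) (del : forall i, {linear P i.+1 -> P i})
      (eps : {linear P 0%N -> M}),
    [/\ forall i, projective_module (P i),
        forall i, (d < i)%N -> forall x : P i, x = 0,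
        forall y, exists x, eps x = y,
        forall x, eps x = 0 <-> exists y, del 0%N y = x
      & forall i x, del i x = 0 <-> exists y, del i.+1 y = x].

(* Modules are left modules. *)
Definition gl_dim_le (d : nat) : Prop :=
  forall M : lmodType R, proj_dim_le d M.

End GlobalDimension.

(* A simple graph with vertices 'I_n and edges 'I_m, and positive vertex
   weights. The endpoints of each edge are listed in an arbitrary order. *)
Record wgraph (n m : nat) := WGraph {
  weight : 'I_n -> nat;
  src : 'I_m -> 'I_n;
  tgt : 'I_m -> 'I_n;
  weight_gt0 : forall i, (0 < weight i)%N;
  src_neq_tgt : forall j, src j != tgt j;
  ends_inj : injective (fun j => [set src j; tgt j])
}.

Section WeightedGraph.
Variables (n m : nat) (G : wgraph n m).

Definition edge_weight (j : 'I_m) : nat :=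
  (weight G (src G j) + weight G (tgt G j))%N.

Definition adjacent (u v : 'I_n) : Prop :=
  exists j, [set src G j; tgt G j] = [set u; v].

Definition has_triangle : Prop :=
  exists u v w, [/\ adjacent u v, adjacent v w & adjacent w u].

Definition graph_series : nat -> int := fun d =>
  ps_one d - \sum_(i < n) ps_X (weight G i) d
    + \sum_(j < m) ps_X (edge_weight j) d.

End WeightedGraph.

Definition graded_comm (R : pzRingType) (da db : nat) (a b : R) : R :=
  a * b - (-1) ^+ (da * db)%N * (b * a).

Section GraphAlgebras.
Variables (k : fieldType) (n m : nat) (G : wgraph n m).

(* Swapping the two endpoints changes the commutator only by a sign. *)
Definition edge_comm (j : 'I_m) : free_alg k 'I_n :=
  graded_comm (weight G (src G j)) (weight G (tgt G j))
    (fvar k (src G j)) (fvar k (tgt G j)).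

Definition edge_comms (x : free_alg k 'I_n) : Prop := exists j, x = edge_comm j.

Definition graph_sub : Type := subalg edge_comms.

HB.instance Definition _ := GRing.Algebra.on graph_sub.

Definition graph_alg : Type := alg_quot edge_comms.

HB.instance Definition _ := GRing.PzRing.on graph_alg.
HB.instance Definition _ := GRing.Lmodule.on graph_alg.

Fact graph_alg_oner_neq0 : 1 != 0 :> graph_alg.
Proof.
apply/eqP => e.
have /quot_pi_eq : quot_pi edge_comms 1 = quot_pi edge_comms 0.
  by rewrite rmorph1 raddf0.
rewrite subr0 => I1.
pose f : {lrmorphism free_alg k 'I_n -> k^o} := free_lift (fun=> 0 : k^o).
have fS x : edge_comms x -> f x = 0.
  case=> j ->; rewrite /edge_comm /graded_comm raddfB.
  rewrite [X in X - _]rmorphM [X in _ - X]rmorphM [X in _ - _ * X]rmorphM.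
  by rewrite /f /= !free_lift_var mul0r mulr0 subrr.
have := ideal_gen_lift fS I1; rewrite rmorph1 => /eqP.
by rewrite oner_eq0.
Qed.

HB.instance Definition _ :=
  GRing.PzSemiRing_isNonZero.Build graph_alg graph_alg_oner_neq0.
HB.instance Definition _ :=
  GRing.Lmodule_isLalgebra.Build k graph_alg (@quot_scalerAl _ _ edge_comms).
HB.instance Definition _ :=
  GRing.Lalgebra_isAlgebra.Build k graph_alg (@quot_scalerAr _ _ edge_comms).

Definition free_gr_weight : nat -> free_alg k 'I_n -> Prop :=
  free_gr (weight G).

Definition graph_sub_gr (d : nat) (b : graph_sub) : Prop :=
  free_gr_weight d (val b).

Definition graph_alg_gr (d : nat) (a : graph_alg) : Prop :=
  exists2 x, free_gr_weight d x & quot_pi edge_comms x = a.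

End GraphAlgebras.

Arguments edge_comm k {n m} G j.
Arguments edge_comms k {n m} G x.
Arguments graph_sub k {n m} G.
Arguments graph_alg k {n m} G.
Arguments free_gr_weight k {n m} G d x.
Arguments graph_sub_gr k {n m} G d b.
Arguments graph_alg_gr k {n m} G d a.

(* Main.v *)
(* Up to Koszul signs, A(G) is the algebra of the trace monoid M(G) in which
   adjacent letters commute: its basis consists of the normal forms of words
   modulo these commutations. The right descents of a trace, the letters that
   can be moved to its right end, form a clique, and the product of the
   proposed denominator with the Hilbert series of A(G) counts each trace with
   weight 1 - r + 'C(r, 2), r being its number of descents. This weight is
   nonnegative, vanishes for r = 1, 2 and is positive for r > 2, while r = 0
   only for the empty trace; so the Hilbert series is the proposed one iff no
   trace has three descents, iff G has no triangle.

   B(G) is free on the edge commutators, so the free product of B(G) and A(G)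
   is the graph algebra of G with one isolated vertex of degree q_j added for
   each edge j. The proposed denominator of this larger graph is 1 minus the
   sum of the z^(p_i), the inverse of the Hilbert series of the free algebra,
   and the larger graph has the same triangles as G; so item 2 reduces to item
   3.

   For any left A(G)-module M, choose a k-basis of M; Fox derivatives give an
   exact sequence A (x) k^E (x) M -> A (x) k^V (x) M -> A (x) M -> M -> 0 of
   free modules. Without triangles its first map is injective, by looking at a
   word of maximal length. With a triangle, comparison with a resolution of
   length 2 of the trivial module would split the kernel of the first map off,
   which a degree argument excludes. *)

From HB Require Import structures.
Require Import Defs.
From mathcomp Require Import all_boot all_order all_algebra.
From mathcomp Require Import boolp finmap monalg.
From mathcomp Require classical_sets.
From mathcomp Require Import zify.

Set Implicit Arguments.
Unset Strict Implicit.
Unset Printing Implicit Defensive.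

Import Order.TTheory GRing.Theory Num.Theory.
Local Open Scope ring_scope.

(** * Traces *)

(** Koszul signs do no harm because [G] has no loops: a letter never passes a copy of itself, so the
    sign of reordering a word is the product of the sorting signs [ksign] of both words, and words
    rescaled by [ksign] commute without sign. Global dimension quantifies over all modules [M], so a
    resolution of the trivial module alone would not do. The complex used is the start of the
    bimodule resolution [A (x) k^E (x) A -> A (x) k^V (x) A -> A (x) A -> A], tensored over [A] with
    [M]. It is exact for every graph; only injectivity of its first map sees triangles. The
    resolutions in [proj_dim_le] are ungraded, so no minimality argument applies to them. They serve
    only to produce an endomorphism of [K2] that retracts it onto [ker d2]; degrees are measured
    inside [K2], by the lengths of the words in its coefficients. Right cancellation and Levi's
    lemma for traces control what happens to these words when a letter is appended. *)

Section TraceEquivalence.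
Variables (T : finType) (adj : rel T).
Hypotheses (adj_sym : symmetric adj) (adj_irr : irreflexive adj).
Implicit Types (u v : T) (w a b : seq T).

(* The letters u, v commute iff adj u v. By Mazurkiewicz' projection lemma
   (teq_swaps), two words are equal up to such commutations iff they have the
   same projections to all pairs of non-commuting letters. *)
Definition teq w1 w2 := [forall u, forall v,
  ~~ adj u v ==> (filter (pred2 u v) w1 == filter (pred2 u v) w2)].

Lemma teqP w1 w2 :
  reflect (forall u v, ~~ adj u v ->
             filter (pred2 u v) w1 = filter (pred2 u v) w2) (teq w1 w2).
Proof.
apply: (iffP forallP) => [h u v uv|h u].
  by have /forallP/(_ v)/implyP/(_ uv)/eqP := h u.
by apply/forallP => v; apply/implyP => uv; rewrite h.
Qed.

Lemma teq_refl : reflexive teq.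
Proof. by move=> w; apply/teqP. Qed.

Lemma teq_sym : symmetric teq.
Proof. by move=> w1 w2; apply/teqP/teqP => h u v uv; rewrite h. Qed.

Lemma teq_trans : transitive teq.
Proof.
move=> w2 w1 w3 /teqP h12 /teqP h23; apply/teqP => u v uv.
by rewrite h12 ?h23.
Qed.

(** Each projection keeps or drops the common last letter on both sides at once. This cancellation
    law is immediate for projections and would need an argument for chains of swaps. *)
Lemma teq_rcons w1 w2 u : teq (rcons w1 u) (rcons w2 u) = teq w1 w2.
Proof.
apply/teqP/teqP => h x y xy; move: (h x y xy); rewrite !filter_rcons.
  by case: ifP => // _ /rcons_inj[].
by move=> ->.
Qed.

(** Irreflexivity makes [(u, u)] a non-commuting pair, and its projection counts the occurrences of
    [u]. *)
Lemma teq_perm w1 w2 : teq w1 w2 -> perm_eq w1 w2.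
Proof.
move=> /teqP h; apply/allP => u _ /=; apply/eqP.
have pE w : count (pred1 u) w = size (filter (pred2 u u) w).
  by rewrite size_filter; apply: eq_count => x /=; rewrite orbb.
by rewrite !pE h ?adj_irr.
Qed.

(** No projection to a non-commuting pair retains both [u] and [v]. *)
Lemma teq_swap w1 u v w2 :
  adj u v -> teq (w1 ++ [:: u, v & w2]) (w1 ++ [:: v, u & w2]).
Proof.
move=> uv; apply/teqP => x y xy; rewrite !filter_cat; congr (_ ++ _) => /=.
have nuv : u != v by apply: contraTneq uv => ->; rewrite adj_irr.
case: ifP => // ux; case: ifP => // vx; exfalso; move: uv nuv xy.
by by case/orP: ux => /eqP ->; case/orP: vx => /eqP -> => uv; rewrite ?eqxx //;
  [rewrite uv | rewrite adj_sym uv].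
Qed.

Lemma last_occurrence u w :
  u \in w -> exists a b, w = a ++ u :: b /\ u \notin b.
Proof.
elim: w => // x w IHw; rewrite inE; have [uw _|uw] := boolP (u \in w).
  by have [a [b [-> ub]]] := IHw uw; exists (x :: a), b.
by rewrite orbF => /eqP <-; exists [::], w.
Qed.

(** Split [w'] at its last [u]. A later letter [v] not commuting with [u] would make the projection
    to [u], [v] end in [v], whereas that of [rcons w u] ends in [u]. *)
Lemma teq_rcons_split w u w' : teq (rcons w u) w' ->
  exists a b, [/\ w' = a ++ u :: b, all (adj u) b & teq w (a ++ b)].
Proof.
move=> e; have uw' : u \in w'.
  by rewrite -(perm_mem (teq_perm e)) mem_rcons inE eqxx.
have [a [b [Ew' ub]]] := last_occurrence uw'; exists a, b.
have ab : all (adj u) b.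
  apply/allP => v vb; apply: contraT => uv.
  have uNv : u != v by apply: contraNneq ub => ->.
  have /teqP/(_ u v uv) := e; rewrite Ew' filter_rcons /= eqxx filter_cat /=.
  rewrite eqxx => /(congr1 (last u)); rewrite last_rcons last_cat /= => lu.
  have : u \in filter (pred2 u v) b.
    have : v \in filter (pred2 u v) b by rewrite mem_filter /= eqxx orbT.
    by move: lu; case: (filter _ b) => //= x s {1}-> _; exact: mem_last.
  by rewrite mem_filter (negbTE ub) andbF.
split=> //; rewrite -(teq_rcons _ _ u); apply: teq_trans e _.
rewrite {uw'}Ew' -cats1 -catA; elim: b a ab {ub} => [|v b IHb] a /=.
  by rewrite teq_refl.
case/andP => uv ub; apply: teq_trans (teq_swap _ _ uv) _.
by rewrite -!(cat_rcons v a); apply: IHb.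
Qed.

(** The nontrivial half of the projection lemma, as an induction principle: the last letter of [w1]
    is located in [w2], swapped to the right end, and moved into the common right context [c]. *)
Lemma teq_swaps (P : seq T -> seq T -> Prop) :
  (forall w, P w w) -> (forall w2 w1 w3, P w1 w2 -> P w2 w3 -> P w1 w3) ->
  (forall w1 u v w2, adj u v -> P (w1 ++ [:: u, v & w2]) (w1 ++ [:: v, u & w2])) ->
  forall w1 w2, teq w1 w2 -> P w2 w1.
Proof.
move=> P_refl P_trans P_swap w1 w2 e.
suff : forall c, P (w2 ++ c) (w1 ++ c) by move/(_ [::]); rewrite !cats0.
elim/last_ind: w1 w2 e => [|w1 u IHw] w2 e c.
  by move/teq_perm: e; rewrite perm_sym => /perm_nilP ->.
have [a [b [-> ub wab]]] := teq_rcons_split e.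
apply: (P_trans ((a ++ b) ++ u :: c)); last by rewrite cat_rcons; apply: IHw.
rewrite -!catA /=; elim: b a ub {e wab} => [|v b IHb] a //= /andP[uv ub].
apply: (P_trans _ _ _ (P_swap a u v _ uv)).
by rewrite -!(cat_rcons v a); apply: IHb.
Qed.

(** Levi's lemma for traces. Locate [u] in [rcons w2 v]: what follows it commutes with [u] and ends
    in [v]; deleting both letters leaves the common [w]. *)
Lemma teq_diamond w1 u w2 v : u != v -> teq (rcons w1 u) (rcons w2 v) ->
  adj u v /\ exists w, teq w1 (rcons w v) /\ teq w2 (rcons w u).
Proof.
move=> uNv e; have [a [b [Ew2 ub wab]]] := teq_rcons_split e.
case/lastP: b => [|b v'] in Ew2 ub wab *.
  by move: Ew2; rewrite cats1 => /rcons_inj[_ vu]; rewrite vu eqxx in uNv.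
move: Ew2; rewrite -rcons_cons -rcons_cat => /rcons_inj[Ew2 Ev].
move: ub wab; rewrite -Ev all_rcons -rcons_cat => /andP[uv _] wab.
split=> //; exists (a ++ b); split=> //.
rewrite -(teq_rcons _ _ v) teq_sym; apply: teq_trans (_ : teq (rcons w1 u) _); last exact: e.
have uv' : teq (rcons (rcons (a ++ b) u) v) (rcons (rcons (a ++ b) v) u).
  by rewrite -!cats1 -!catA /=; have := teq_swap (a ++ b) [::] uv; rewrite -!catA.
by apply: teq_trans uv' _; rewrite teq_rcons teq_sym.
Qed.

End TraceEquivalence.

Lemma Posz_sum (I : Type) (r : seq I) (P : pred I) (F : I -> nat) :
  ((\sum_(i <- r | P i) F i)%N)%:Z = \sum_(i <- r | P i) (F i)%:Z.
Proof. exact: (big_morph Posz PoszD). Qed.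

(** * Normal forms, degrees and descents of traces *)

Section Traces.
Variables (n m : nat) (G : wgraph n m).
Implicit Types (u v : 'I_n) (w : seq 'I_n).

Definition adjb : rel 'I_n :=
  fun u v => [exists j, [set src G j; tgt G j] == [set u; v]].

Lemma adjP u v : reflect (adjacent G u v) (adjb u v).
Proof. exact: exists_eqP. Qed.

Lemma adjb_sym : symmetric adjb.
Proof. by move=> u v; apply: eq_existsb => j; rewrite (setUC [set u]). Qed.

Lemma adjb_irr : irreflexive adjb.
Proof.
move=> u; apply/existsP => -[j /eqP e].
have := cards2 (src G j) (tgt G j); rewrite e setUid cards1.
by rewrite (negbTE (src_neq_tgt _ _)).
Qed.

Lemma adj_edge j : adjb (src G j) (tgt G j).
Proof. by apply/existsP; exists j. Qed.

Notation teq := (teq adjb).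

Lemma teq_rev2 w u v : adjb u v -> teq (rcons (rcons w u) v) (rcons (rcons w v) u).
Proof.
by move=> uv; have := teq_swap adjb_sym adjb_irr w [::] uv; rewrite -!cat_rcons !cats0.
Qed.

(** [choose] returns the same element for equivalent predicates, so it gives a canonical
    representative without an order on words. *)
Definition nf w := choose (teq w) w.

Lemma teq_nf w : teq w (nf w).
Proof. by apply: chooseP; apply: teq_refl. Qed.

Lemma nfP w1 w2 : reflect (nf w1 = nf w2) (teq w1 w2).
Proof.
apply: (iffP idP) => [e|e]; last first.
  by apply: teq_trans (teq_nf w1) _; rewrite e teq_sym teq_nf.
rewrite /nf (eq_choose (Q := teq w2)); last first.
  by move=> w; apply/idP/idP; apply: teq_trans; rewrite // teq_sym.
by apply: choose_id; rewrite ?teq_refl // teq_sym.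
Qed.

Lemma nf_id w : nf (nf w) = nf w.
Proof. by apply/esym/nfP/teq_nf. Qed.

Definition wt w := (\sum_(t <- w) weight G t)%N.

Lemma wt_cat w1 w2 : wt (w1 ++ w2) = (wt w1 + wt w2)%N.
Proof. exact: big_cat. Qed.

Lemma wt_rcons w u : wt (rcons w u) = (wt w + weight G u)%N.
Proof. by rewrite -cats1 wt_cat /wt big_seq1. Qed.

Lemma wt_teq w1 w2 : teq w1 w2 -> wt w1 = wt w2.
Proof. by move/(teq_perm adjb_irr) => e; apply: perm_big. Qed.

Lemma size_teq w1 w2 : teq w1 w2 -> size w1 = size w2.
Proof. by move/(teq_perm adjb_irr)/perm_size. Qed.

Lemma size_wt w : (size w <= wt w)%N.
Proof.
elim: w => // u w IHw; rewrite /wt big_cons /=.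
by have := weight_gt0 G u; rewrite /wt in IHw; lia.
Qed.

(* The inversions are weighted so that (-1)^(inv w) is the Koszul sign of
   sorting the letters of w. *)
Fixpoint inv w : nat :=
  if w is u :: w' then
    (\sum_(t <- w' | (t < u)%N) weight G u * weight G t + inv w')%N
  else 0.

Definition ksign (k : fieldType) w : k := (-1) ^+ inv w.

Lemma ksign2 (k : fieldType) w : ksign k w * ksign k w = 1.
Proof. by rewrite /ksign -expr2 sqrr_sign. Qed.

Lemma ksign_swap (k : fieldType) w1 u v w2 : u != v ->
  ksign k (w1 ++ [:: u, v & w2]) =
    (-1) ^+ (weight G u * weight G v) * ksign k (w1 ++ [:: v, u & w2]).
Proof.
move=> uv; rewrite /ksign; elim: w1 => [|x w1 IHw] /=; last first.
  rewrite !exprD IHw mulrCA; congr (_ * (_ ^+ _ * _)).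
  by apply: perm_big; rewrite perm_cat2l; apply: (permEl (perm_catCA [:: u] [:: v] w2)).
rewrite !big_cons; set a := (\sum_(_ <- _ | _) _)%N; set b := (\sum_(_ <- _ | _) _)%N.
(* The two words differ in a single inversion, [u] against [v], which exactly one of them counts. *)
have [lt|lt|e] := ltngtP u v; last by rewrite (ord_inj e) eqxx in uv.
  rewrite -exprD -signr_odd -[RHS]signr_odd; congr (_ ^+ (nat_of_bool _)); lia.
rewrite -exprD -signr_odd -[RHS]signr_odd; congr (_ ^+ (nat_of_bool _)); lia.
Qed.

(** Positive weights bound the length of a word by its degree, so bounded sequences suffice. *)
Definition words d : seq (seq 'I_n) :=
  [seq val b | b <- enum {: d.-bseq 'I_n} & wt (val b) == d].

Lemma mem_words d w : (w \in words d) = (wt w == d).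
Proof.
apply/mapP/eqP => [[b]|e]; first by rewrite mem_filter => /andP[/eqP ? _] ->.
have sw : (size w <= d)%N by rewrite -e size_wt.
by exists (Bseq sw); rewrite // mem_filter /= e eqxx mem_enum.
Qed.

Lemma words_uniq d : uniq (words d).
Proof.
rewrite map_inj_uniq; first by rewrite filter_uniq // enum_uniq.
by move=> b1 b2 /= /val_inj.
Qed.

Definition traces d := [seq w <- words d | nf w == w].

Lemma mem_traces d w : (w \in traces d) = (wt w == d) && (nf w == w).
Proof. by rewrite mem_filter mem_words andbC. Qed.

Lemma traces_uniq d : uniq (traces d).
Proof. exact/filter_uniq/words_uniq. Qed.

Lemma nf_traces w : nf w \in traces (wt w).
Proof. by rewrite mem_traces nf_id eqxx (wt_teq (teq_nf w)) eqxx. Qed.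

Definition ntraces d : int := (size (traces d))%:Z.

Definition descents w : {set 'I_n} :=
  [set u | `[< exists w', teq (rcons w' u) w >]].

Lemma descP w u : reflect (exists w', teq (rcons w' u) w) (u \in descents w).
Proof. by rewrite inE; apply: asboolP. Qed.

Lemma descents_adj w u v :
  u \in descents w -> v \in descents w -> u != v ->
  adjb u v /\ exists w', teq (rcons (rcons w' u) v) w.
Proof.
move=> /descP[w1 e1] /descP[w2 e2] uv; rewrite teq_sym in e2.
have [auv [w' [e1' e2']]] := teq_diamond adjb_sym adjb_irr uv (teq_trans e1 e2).
split=> //; exists w'; rewrite teq_sym; apply: teq_trans e2 _.
by rewrite teq_rcons.
Qed.

Lemma descents_nil : descents [::] = set0.
Proof.
apply/setP => u; rewrite in_set0; apply/descP => -[w /(teq_perm adjb_irr)].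
by move/perm_nilP/(congr1 size); rewrite size_rcons.
Qed.

Lemma descents_gt0 w : w != [::] -> (0 < #|descents w|)%N.
Proof.
case/lastP: w => // w u _; apply/card_gt0P; exists u.
by apply/descP; exists w; apply: teq_refl.
Qed.

(** [ends_inj] embeds these edges into the 2-subsets of the descents, and the clique property makes
    this map onto. *)
Lemma card_edges_in w :
  #|[set j | (src G j \in descents w) && (tgt G j \in descents w)]|
    = 'C(#|descents w|, 2).
Proof.
rewrite -cards_draws -(card_imset _ (@ends_inj _ _ G)); apply: eq_card => A.
rewrite inE; apply/imsetP/andP => [[j]|[sA /cards2P[u [v [uv eA]]]]].
  rewrite inE => /andP[sj tj] ->; rewrite cards2 src_neq_tgt.
  by rewrite subUset !sub1set sj tj.
move: sA; rewrite eA subUset !sub1set => /andP[du dv].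
have [/existsP[j /eqP e] _] := descents_adj du dv uv.
exists j => //; rewrite inE; have : [set src G j; tgt G j] \subset descents w.
  by rewrite e subUset !sub1set du.
by rewrite subUset !sub1set.
Qed.

(** Appending [u] is a bijection onto the traces with descent [u], injective by right
    cancellation. *)
Lemma traces_rcons d u : (weight G u <= d)%N ->
  size (traces (d - weight G u)%N) = count (fun w => u \in descents w) (traces d).
Proof.
move=> le_d; rewrite -size_filter -(size_map (fun w => nf (rcons w u))).
apply/perm_size/uniq_perm; rewrite ?(filter_uniq _ (traces_uniq _)) //.
  rewrite map_inj_in_uniq ?traces_uniq // => w1 w2.
  rewrite !mem_traces => /andP[_ /eqP <-] /andP[_ /eqP <-] /nfP.
  by rewrite teq_rcons => /nfP; rewrite !nf_id.
move=> w; rewrite mem_filter mem_traces; apply/mapP/and3P.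
  case=> w'; rewrite mem_traces => /andP[/eqP e _] ->; split.
  - by apply/descP; exists w'; apply: teq_nf.
  - by rewrite -(wt_teq (teq_nf _)) wt_rcons e subnK.
  - by rewrite nf_id.
case=> /descP[w' e] /eqP ed /eqP <-; exists (nf w').
  rewrite mem_traces nf_id eqxx andbT -ed -(wt_teq e) wt_rcons addnK.
  by rewrite (wt_teq (teq_nf w')).
by apply/nfP; rewrite teq_sym; apply: teq_trans e; rewrite teq_rcons teq_sym teq_nf.
Qed.

(** The same bijection with both ends appended; they commute, so each of them becomes a descent. *)
Lemma traces_edge d j : (edge_weight G j <= d)%N ->
  size (traces (d - edge_weight G j)%N) =
    count (fun w => (src G j \in descents w) && (tgt G j \in descents w)) (traces d).
Proof.
move=> le_d; rewrite -size_filter.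
rewrite -(size_map (fun w => nf (rcons (rcons w (src G j)) (tgt G j)))).
apply/perm_size/uniq_perm; rewrite ?(filter_uniq _ (traces_uniq _)) //.
  rewrite map_inj_in_uniq ?traces_uniq // => w1 w2.
  rewrite !mem_traces => /andP[_ /eqP <-] /andP[_ /eqP <-] /nfP.
  by rewrite !teq_rcons => /nfP; rewrite !nf_id.
move=> w; rewrite mem_filter mem_traces; apply/mapP/and3P.
  case=> w'; rewrite mem_traces => /andP[/eqP e _] ->; split.
  - apply/andP; split; apply/descP; last first.
      by exists (rcons w' (src G j)); apply: teq_nf.
    exists (rcons w' (tgt G j)); apply: teq_trans (teq_nf _).
    by rewrite teq_sym teq_rev2 // adj_edge.
  - by rewrite -(wt_teq (teq_nf _)) !wt_rcons e -addnA subnK.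
  - by rewrite nf_id.
case=> /andP[ds dt] /eqP ed /eqP <-.
have [_ [w' e]] := descents_adj ds dt (src_neq_tgt _ _); exists (nf w').
  rewrite mem_traces nf_id eqxx andbT -ed -(wt_teq e) !wt_rcons -addnA addnK.
  by rewrite (wt_teq (teq_nf w')).
by apply/nfP; rewrite teq_sym; apply: teq_trans e; rewrite !teq_rcons teq_sym teq_nf.
Qed.

Lemma wt_descent w u : u \in descents w -> (weight G u <= wt w)%N.
Proof. by case/descP => w' /wt_teq <-; rewrite wt_rcons leq_addl. Qed.

Lemma ps_mul_X (h : nat -> int) e d :
  \sum_(i < d.+1) ps_X e i * h (d - i)%N = if (e <= d)%N then h (d - e)%N else 0.
Proof.
rewrite /ps_X; case: leqP => [le_ed|lt_de]; last first.
  by rewrite big1 // => i _; case: eqVneq => [ie|]; rewrite ?mul0r //; have := ltn_ord i; lia.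
have lt_ed : (e < d.+1)%N by [].
rewrite (bigD1 (Ordinal lt_ed)) //= eqxx mul1r big1 ?addr0 // => i /negbTE ie.
by rewrite -val_eqE /= in ie; rewrite ie mul0r.
Qed.

(* Removing one letter, or the two ends of an edge, from the right end of a
   trace: the right descents of a trace are pairwise adjacent, so a trace with
   r descents is counted 1 - r + 'C(r, 2) times. *)
Lemma graph_series_traces d : ps_mul (graph_series G) ntraces d =
  \sum_(w <- traces d) (1 - #|descents w|%:Z + 'C(#|descents w|, 2)%:Z).
Proof.
have count_sum (P : pred (seq 'I_n)) :
    (count P (traces d))%:Z = \sum_(w <- traces d) (P w : nat)%:Z.
  by rewrite -sumn_count /= sumnE big_map; apply: Posz_sum.
have sum_vertex : \sum_u \sum_(i < d.+1) ps_X (weight G u) i * ntraces (d - i)%N =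
    \sum_(w <- traces d) #|descents w|%:Z.
  under eq_bigr => u _.
    rewrite ps_mul_X.
    have -> : (if (weight G u <= d)%N then ntraces (d - weight G u)%N else 0) =
        \sum_(w <- traces d) (u \in descents w : nat)%:Z.
      rewrite -count_sum; case: leqP => [le_d|lt_d]; first by rewrite -traces_rcons.
      (* A descent weighs at most as much as its trace, so no trace of degree [d] has the descent
         [u]. *)
      rewrite (_ : count _ _ = 0%N) //; apply/eqP; rewrite -leqn0 leqNgt -has_count.
      apply/hasP => -[w]; rewrite mem_traces => /andP[/eqP wd _] /wt_descent.
      by rewrite wd leqNgt lt_d.
    over.
  rewrite exchange_big /=; apply: eq_bigr => w _.
  by rewrite -sum1_card Posz_sum [RHS]big_mkcond; apply: eq_bigr => u _; case: (u \in _).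
have sum_edge : \sum_j \sum_(i < d.+1) ps_X (edge_weight G j) i * ntraces (d - i)%N =
    \sum_(w <- traces d) 'C(#|descents w|, 2)%:Z.
  under eq_bigr => j _.
    rewrite ps_mul_X.
    have -> : (if (edge_weight G j <= d)%N then ntraces (d - edge_weight G j)%N else 0) =
        \sum_(w <- traces d) ((src G j \in descents w) && (tgt G j \in descents w) : nat)%:Z.
      rewrite -count_sum; case: leqP => [le_d|lt_d]; first by rewrite -traces_edge.
      rewrite (_ : count _ _ = 0%N) //; apply/eqP; rewrite -leqn0 leqNgt -has_count.
      apply/hasP => -[w]; rewrite mem_traces => /andP[/eqP wd _] /andP[ds dt].
      have [_ [w' /wt_teq]] := descents_adj ds dt (src_neq_tgt _ _).
      by rewrite !wt_rcons wd -addnA -/(edge_weight G j); lia.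
    over.
  rewrite exchange_big /=; apply: eq_bigr => w _.
  rewrite -card_edges_in -sum1_card Posz_sum [RHS]big_mkcond; apply: eq_bigr => j _.
  by rewrite inE; case: (_ && _).
(* [ps_one] is convertible to [ps_X 0], so all three parts of the series act as shifts. *)
have -> : ps_mul (graph_series G) ntraces d =
    \sum_(i < d.+1) ps_X 0 i * ntraces (d - i)%N
    - \sum_u \sum_(i < d.+1) ps_X (weight G u) i * ntraces (d - i)%N
    + \sum_j \sum_(i < d.+1) ps_X (edge_weight G j) i * ntraces (d - i)%N.
  rewrite exchange_big [X in _ + X]exchange_big -sumrB -big_split.
  by apply: eq_bigr => i _; rewrite /= -!mulr_suml -mulrBl -mulrDl.
rewrite sum_vertex sum_edge ps_mul_X subn0 /ntraces -sum1_size Posz_sum.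
by rewrite big_split /= sumrB.
Qed.

(** By Pascal's rule the excess is ['C(k - 1, 2)] for positive [k]; it is 1 for [k = 0]. *)
Lemma bin2_excess_ge0 k : 0 <= 1 - k%:Z + 'C(k, 2)%:Z.
Proof.
by case: k => // k; rewrite binS bin1; move: ('C(k, 2)) => c; lia.
Qed.

Lemma bin2_excess_gt0 k : (2 < k)%N -> 0 < 1 - k%:Z + 'C(k, 2)%:Z.
Proof.
case: k => // k k2; rewrite binS bin1; have : (0 < 'C(k, 2))%N by rewrite bin_gt0.
by move: ('C(k, 2)) => c; lia.
Qed.

Lemma graph_series_inv :
  ps_is_inv (graph_series G) ntraces <-> ~ has_triangle G.
Proof.
split=> [inv_tr [u [v [w [/adjP uv /adjP vw /adjP wu]]]]|noT d].
  (* All three letters are descents of this trace. Its positive contribution lies in a positive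
     degree, where [ps_one] vanishes, and no other term is negative. *)
  pose x := nf [:: u; v; w].
  have uD : u \in descents x.
    apply/descP; exists [:: v; w]; apply: teq_trans (teq_nf _).
    have vu : adjb v u by rewrite adjb_sym.
    apply: teq_trans (teq_swap adjb_sym adjb_irr [:: v] [::] wu) _.
    exact: (teq_swap adjb_sym adjb_irr [::] [:: w] vu).
  have vD : v \in descents x.
    apply/descP; exists [:: u; w]; apply: teq_trans (teq_nf _).
    rewrite adjb_sym in vw.
    exact: (teq_swap adjb_sym adjb_irr [:: u] [::] vw).
  have wD : w \in descents x by apply/descP; exists [:: u; v]; apply: teq_nf.
  have irr a b : adjb a b -> a != b by apply: contraTneq => ->; rewrite adjb_irr.
  have D3 : (2 < #|descents x|)%N.
    by apply/card_gt2P; exists u, v, w; split; split=> //; apply: irr.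
  have x_tr : x \in traces (wt [:: u; v; w]) by apply: nf_traces.
  have := inv_tr (wt [:: u; v; w]); rewrite graph_series_traces.
  rewrite (big_rem x) //=; set a := (X in X + _); set b := (X in _ + X).
  have a0 : 0 < a by apply: bin2_excess_gt0.
  have b0 : 0 <= b.
    by apply: sumr_ge0 => y _; apply: bin2_excess_ge0.
  have := ltr_wpDr b0 a0 => /[swap] ->; rewrite /ps_one.
  by rewrite /wt big_cons addn_eq0 eqn0Ngt weight_gt0 ltxx.
(* Degree 0 contains only the empty trace, of excess 1. A nonempty trace has one or two descents,
   hence excess 0. *)
rewrite graph_series_traces /ps_one; case: d => [|d] /=.
  have -> : traces 0 = [:: [::]].
    apply: perm_small_eq => //; apply: uniq_perm (traces_uniq _) _ _ => // w.
    rewrite mem_traces inE; apply/andP/eqP => [[/eqP w0 _]|->].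
      by have := size_wt w; rewrite w0 leqn0 => /nilP.
    rewrite /wt big_nil; split=> //; apply/eqP.
    by have := size_teq (teq_nf [::]) => /esym/eqP/nilP.
  by rewrite big_seq1 descents_nil cards0.
rewrite big_seq big1 // => w; rewrite mem_traces => /andP[/eqP wd _].
have w0 : w != [::] by apply: contra_eq_neq wd => ->; rewrite /wt big_nil.
have D0 := descents_gt0 w0.
have D2 : (#|descents w| <= 2)%N.
  rewrite leqNgt; apply/negP => /card_gt2P[a [b [c [[aD bD cD] [ab bc ca]]]]].
  apply: noT; exists a, b, c.
  have Dadj x y xD yD xy : adjacent G x y := elimT (adjP x y) (descents_adj xD yD xy).1.
  by split; apply: (Dadj w).
by case: #|_| D0 D2 => [|[|[]]].
Qed.

End Traces.

(** * Words and normal forms *)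

Lemma mulr_sub3 (R : pzRingType) (a x y b : R) :
  a * (x - y) * b = a * x * b - a * y * b.
Proof. by rewrite mulrBr mulrBl. Qed.

Lemma mulr_linr (k : fieldType) (A : algType k) (a x y : A) c :
  a * (c *: x + y) = c *: (a * x) + a * y.
Proof. by rewrite mulrDr -scalerAr. Qed.

Lemma mulr_linr3 (k : fieldType) (A : algType k) (a x y b : A) c :
  a * (x - c *: y) * b = a * x * b - c *: (a * y * b).
Proof. by rewrite mulrBr mulrBl -scalerAr -scalerAl. Qed.

Lemma mulr_scale3 (k : fieldType) (A : algType k) (a x b : A) c :
  a * (c *: x) * b = c *: (a * x * b).
Proof. by rewrite -scalerAr -scalerAl. Qed.

Lemma mulr_linl4 (k : fieldType) (A : algType k) (a s x y b : A) c :
  a * ((c *: s + x) * y) * b = c *: (a * s * y * b) + a * (x * y) * b.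
Proof. by rewrite mulrDl mulrDr mulrDl -!(scalerAr, scalerAl) !mulrA. Qed.

Lemma mulr_linr4 (k : fieldType) (A : algType k) (a s x y b : A) c :
  a * (y * (c *: s + x)) * b = c *: (a * y * (s * b)) + a * (y * x) * b.
Proof. by rewrite !mulrDr mulrDl -!(scalerAr, scalerAl) !mulrA. Qed.

(** * Linear extension and coefficients of words *)

Section MalgLinear.
Variables (R : nzRingType) (K : choiceType) (N : lmodType R) (h : K -> N).

Definition lext (x : {malg R[K]}) : N := \sum_(w <- msupp x) x@_w *: h w.

Lemma lextEw (d : {fset K}) x :
  fsubset (msupp x) d -> lext x = \sum_(w <- d) x@_w *: h w.
Proof.
move=> le; rewrite [LHS](big_fset_incl _ le) => //= w wd /mcoeff_outdom ->.
by rewrite scale0r.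
Qed.

Fact lext_is_linear : linear lext.
Proof.
move=> c x y; pose d := (msupp x `|` msupp y `|` msupp (c *: x + y))%fset.
have [xd yd zd] : [/\ fsubset (msupp x) d, fsubset (msupp y) d & fsubset (msupp (c *: x + y)) d].
  split; first by apply: (fsubset_trans (fsubsetUl _ (msupp y))); apply: fsubsetUl.
    by apply: (fsubset_trans (fsubsetUr (msupp x) _)); apply: fsubsetUl.
  exact: fsubsetUr.
rewrite (lextEw xd) (lextEw yd) (lextEw zd) scaler_sumr -big_split.
by apply: eq_bigr => w _; rewrite /= mcoeffD mcoeffZ scalerDl scalerA.
Qed.

HB.instance Definition _ :=
  GRing.isLinear.Build R {malg R[K]} N *:%R lext lext_is_linear.

Lemma lextU w : lext << w >> = h w.
Proof. by rewrite (lextEw msuppU_le) big_seq_fset1 mcoeffUU scale1r. Qed.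

End MalgLinear.

Lemma malgU_scale (R : nzRingType) (K : choiceType) (c : R) (w : K) :
  << c *g w >> = c *: (<< w >> : {malg R[K]}).
Proof. by apply/malgP => v; rewrite mcoeffZ !mcoeffU mulr_natr. Qed.

Lemma malg_ind (R : nzRingType) (K : choiceType) (P : {malg R[K]} -> Prop) :
  P 0 -> (forall c w x, P x -> P (c *: << w >> + x)) -> forall x, P x.
Proof.
move=> P0 PD x; rewrite (monalgE x); elim: (enum_fset _) => [|w r IHr].
  by rewrite big_nil.
by rewrite big_cons malgU_scale; apply: PD.
Qed.

(* Stated for an abstract algebra spanned by words: rewriting in the concrete
   free algebra makes unification unfold the ring structure. *)
Lemma ideal_gen_spanning (k : fieldType) (A : algType k) (T : Type)
    (wd : seq T -> A) (S : A -> Prop) (N : lmodType k) (f : {linear A -> N}) :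
  wd [::] = 1 -> (forall s t, wd (s ++ t) = wd s * wd t) ->
  (forall P : A -> Prop,
     P 0 -> (forall c s x, P x -> P (c *: wd s + x)) -> forall x, P x) ->
  (forall x s t, S x -> f (wd s * x * wd t) = 0) ->
  forall x, ideal_gen S x -> f x = 0.
Proof.
move=> wd_nil wd_cat wd_ind fS x Ix.
suff : forall s t, f (wd s * x * wd t) = 0.
  by move/(_ [::] [::]); rewrite wd_nil mul1r mulr1.
elim: Ix => {x} [x Sx s t||x y _ IHx _ IHy s t|a x _ IHx s t|x a _ IHx s t].
- exact: fS.
- by move=> s t; rewrite mulr0 mul0r linear0.
- by rewrite mulr_sub3 linearB /= IHx IHy subrr.
- elim/wd_ind: a => [|c r a IHa]; first by rewrite mul0r mulr0 mul0r linear0.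
  rewrite mulr_linl4 linearP /= IHa addr0.
  by have := IHx (s ++ r) t; rewrite wd_cat => ->; rewrite scaler0.
- elim/wd_ind: a => [|c r a IHa]; first by rewrite !mulr0 mul0r linear0.
  rewrite mulr_linr4 linearP /= IHa addr0.
  by have := IHx s (r ++ t); rewrite wd_cat => ->; rewrite scaler0.
Qed.

HB.lock Definition wd (k : fieldType) (T : choiceType) (s : seq T) : free_alg k T :=
  << FMonom s >>.
Arguments wd {k T} s.

HB.lock Definition fcoef (k : fieldType) (T : choiceType) (s : seq T)
    (x : free_alg k T) : k := x@_(FMonom s).

Section FreeAlgebraWords.
Variables (k : fieldType) (T : choiceType).
Implicit Types (s t : seq T) (x y : free_alg k T).
Local Notation wd := (@wd k T).
Local Notation fcoef := (@fcoef k T).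

Fact fcoef_is_linear s : linear_for *%R (fcoef s).
Proof. by move=> c x y; rewrite fcoef.unlock mcoeffD mcoeffZ. Qed.

HB.instance Definition _ s :=
  GRing.isLinear.Build k (free_alg k T) k *%R (fcoef s) (fcoef_is_linear s).

Lemma fcoefZ s c x : fcoef s (c *: x) = c * fcoef s x.
Proof. by rewrite fcoef.unlock; apply: mcoeffZ. Qed.

Lemma fcoef_sum s (I : Type) (r : seq I) P (F : I -> free_alg k T) :
  fcoef s (\sum_(i <- r | P i) F i) = \sum_(i <- r | P i) fcoef s (F i).
Proof. exact: (raddf_sum (fcoef s)). Qed.

Lemma fcoef_wd s t : fcoef s (wd t) = (t == s)%:R.
Proof. by rewrite fcoef.unlock wd.unlock mcoeffU fmP. Qed.

Lemma free_algP x y : (forall s, fcoef s x = fcoef s y) -> x = y.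
Proof. by rewrite fcoef.unlock => e; apply/malgP => -[s]; apply: e. Qed.

Lemma wd_cat s t : wd (s ++ t) = wd s * wd t.
Proof.
rewrite wd.unlock; apply/malgP => v; rewrite [(<< FMonom s >> : free_alg k T) * _]malgME.
rewrite !msuppU1 !big_seq_fset1 !mcoeffUU mulr1.
by congr (mcoeff _ (<< _ >>)); apply/eqP; rewrite fmP fmM.
Qed.

Lemma wd_nil : wd [::] = 1.
Proof.
by rewrite wd.unlock [RHS]/(<< _ >>); congr (<< _ >>); apply/eqP; rewrite fmP fm1.
Qed.

Lemma wd_var (a : T) : wd [:: a] = fvar k a.
Proof. by rewrite wd.unlock /fvar; congr (<< _ >>); apply/eqP; rewrite fmP fmU. Qed.

Lemma wd_cat3 r s t : wd r * wd s * wd t = wd (r ++ s ++ t).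
Proof. by rewrite -(wd_cat r s) -(wd_cat (r ++ s)) catA. Qed.

Lemma wd_cons (a : T) s : wd (a :: s) = fvar k a * wd s.
Proof. by rewrite -wd_var -wd_cat. Qed.

Lemma wd_cons2 (a b : T) : wd [:: a; b] = fvar k a * fvar k b.
Proof. by rewrite !wd_cons wd_nil mulr1. Qed.

Lemma free_alg_ind (P : free_alg k T -> Prop) :
  P 0 -> (forall c s x, P x -> P (c *: wd s + x)) -> forall x, P x.
Proof.
move=> P0 PD; apply: malg_ind => // c [s] x Px.
by have := PD c s x Px; rewrite wd.unlock.
Qed.

Lemma ideal_gen_words (S : free_alg k T -> Prop) (N : lmodType k)
    (f : {linear free_alg k T -> N}) :
  (forall x s t, S x -> f (wd s * x * wd t) = 0) ->
  forall x, ideal_gen S x -> f x = 0.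
Proof. exact: ideal_gen_spanning wd_nil wd_cat free_alg_ind. Qed.

Section WordExtension.
Variables (N : lmodType k) (h : seq T -> N).

Definition wext x : N := lext (fun v : {fmonom T} => h v) x.

Fact wext_is_linear : linear wext. Proof. exact: lext_is_linear. Qed.

HB.instance Definition _ :=
  GRing.isLinear.Build k (free_alg k T) N *:%R wext wext_is_linear.

Lemma wext_wd s : wext (wd s) = h s.
Proof. by rewrite wd.unlock; apply: lextU. Qed.

End WordExtension.

Lemma free_alg_lin_ext (N : lmodType k) (f g : {linear free_alg k T -> N}) :
  (forall s, f (wd s) = g (wd s)) -> f =1 g.
Proof.
move=> e; apply: free_alg_ind => [|c s x IHx]; first by rewrite !linear0.
by rewrite !linearP e IHx.
Qed.

Lemma wext_comp (N N' : lmodType k) (f : {linear N -> N'}) (h : seq T -> N) x :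
  f (wext h x) = wext (fun s => f (h s)) x.
Proof.
rewrite -[LHS]/((f \o wext h) x); apply: free_alg_lin_ext x => s.
by rewrite /= !wext_wd.
Qed.

Lemma free_alg_support (r : seq (seq T)) x : uniq r ->
  (forall s, fcoef s x != 0 -> s \in r) -> x = \sum_(s <- r) fcoef s x *: wd s.
Proof.
move=> r_uniq supp; apply: free_algP => s; rewrite fcoef_sum.
have [sr|sr] := boolP (s \in r).
  rewrite (bigD1_seq s sr r_uniq) /= [X in _ = X + _]fcoefZ fcoef_wd eqxx mulr1.
  rewrite big1 ?addr0 // => t ts.
  by rewrite fcoefZ fcoef_wd (negbTE ts) mulr0.
rewrite big_seq big1 => [|t tr]; first by apply/eqP; apply: contraNT sr; apply: supp.
by rewrite fcoefZ fcoef_wd; case: (t =P s) sr => [<-|]; rewrite ?tr ?mulr0.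
Qed.

Lemma free_grP p d x :
  free_gr p d x <-> forall s, fcoef s x != 0 -> (\sum_(t <- s) p t)%N = d.
Proof.
rewrite fcoef.unlock; split=> [h s|h [s]]; first by rewrite [_ != 0]mcoeff_neq0 => /h.
by rewrite -mcoeff_neq0 => /h.
Qed.

Lemma free_gr_wd p d s : (\sum_(t <- s) p t)%N = d -> free_gr p d (wd s).
Proof.
move=> e; apply/free_grP => t; rewrite fcoef_wd; case: (s =P t) => [<- //|_].
by rewrite eqxx.
Qed.

End FreeAlgebraWords.

Lemma fcoef_wext (k : fieldType) (T T' : choiceType) (h : seq T -> free_alg k T') (s : seq T') x :
  fcoef s (wext h x) = \sum_(t <- msupp x : seq {fmonom T}) fcoef t x * fcoef s (h t).
Proof.
rewrite /wext /lext fcoef_sum; apply: eq_bigr => -[t] _.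
by rewrite [LHS]fcoefZ {2}fcoef.unlock.
Qed.

Lemma fcoef_wext_neq0 (k : fieldType) (T T' : choiceType)
    (h : seq T -> free_alg k T') (s : seq T') x :
  fcoef s (wext h x) != 0 -> exists t, fcoef t x != 0 /\ fcoef s (h t) != 0.
Proof.
rewrite fcoef_wext => /eqP nz; apply/not_existsP => H; apply: nz.
rewrite big1 // => -[t] _ /=.
have [->|tx] := eqVneq (fcoef t x) 0; first by rewrite mul0r.
by have [->|ts] := eqVneq (fcoef s (h t)) 0; [rewrite mulr0 | case: (H t)].
Qed.

Lemma fcoefP (k : fieldType) (T : choiceType) s c (x y : free_alg k T) :
  fcoef s (c *: x + y) = c * fcoef s x + fcoef s y.
Proof. exact: fcoef_is_linear. Qed.

Lemma fcoefB (k : fieldType) (T : choiceType) s (x y : free_alg k T) :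
  fcoef s (x - y) = fcoef s x - fcoef s y.
Proof. exact: (raddfB (fcoef s)). Qed.

Lemma fcoefBZ (k : fieldType) (T : choiceType) s c (x y : free_alg k T) :
  fcoef s (x - c *: y) = fcoef s x - c * fcoef s y.
Proof. by rewrite fcoefB [X in _ - X]fcoefZ. Qed.

Lemma fcoef0 (k : fieldType) (T : choiceType) (s : seq T) :
  fcoef s (0 : free_alg k T) = 0.
Proof. exact: (raddf0 (fcoef s)). Qed.

Lemma graded_commE (k : fieldType) (A : algType k) da db (a b : A) :
  graded_comm da db a b = a * b - (-1) ^+ (da * db)%N *: (b * a).
Proof.
rewrite /graded_comm -signr_odd -[X in X *: _]signr_odd.
by case: odd; rewrite ?mulN1r ?scaleN1r ?mul1r ?scale1r.
Qed.

HB.lock Definition gpi (k : fieldType) (n m : nat) (G : wgraph n m)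
    (x : free_alg k 'I_n) : graph_alg k G := quot_pi (edge_comms k G) x.
Arguments gpi {k n m G} x.

(** The scalar is the Koszul sign of reordering [w] into [nf G w], computed by sorting both words,
    so that no chain of swaps has to be chosen. *)
HB.lock Definition nform (k : fieldType) (n m : nat) (G : wgraph n m) :
    free_alg k 'I_n -> free_alg k 'I_n :=
  wext (fun w => (ksign G k w * ksign G k (nf G w)) *: wd (nf G w)).

Section NormalForm.
Variables (k : fieldType) (n m : nat) (G : wgraph n m).
Notation F := (free_alg k 'I_n).
Local Notation gpi := (@gpi k n m G).
Implicit Types (x y : F) (w s : seq 'I_n).

Fact gpi_is_linear : linear gpi.
Proof. by rewrite gpi.unlock => c x y; rewrite linearP. Qed.

Fact gpi_is_monoid_morphism : monoid_morphism gpi.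
Proof. by rewrite gpi.unlock; apply: quot_pi_is_monoid_morphism. Qed.

HB.instance Definition _ :=
  GRing.isLinear.Build k F (graph_alg k G) *:%R gpi gpi_is_linear.
HB.instance Definition _ :=
  GRing.isMonoidMorphism.Build F (graph_alg k G) gpi
    gpi_is_monoid_morphism.

Lemma gpi_surj (a : graph_alg k G) : exists x, gpi x = a.
Proof. by rewrite gpi.unlock; apply: quot_pi_surj. Qed.

Lemma gpi_eq x y : gpi x = gpi y <-> ideal_gen (edge_comms k G) (x - y).
Proof. by rewrite gpi.unlock; apply: quot_pi_eq. Qed.

Local Notation nform := (@nform k n m G).

Fact nform_is_linear : linear nform.
Proof. by rewrite nform.unlock; apply: wext_is_linear. Qed.

HB.instance Definition _ :=
  GRing.isLinear.Build k F F *:%R nform nform_is_linear.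

Lemma nform_wd w :
  nform (wd w) = (ksign G k w * ksign G k (nf G w)) *: wd (nf G w).
Proof. by rewrite nform.unlock wext_wd. Qed.

Lemma nform_nf w : nf G w = w -> nform (wd w) = wd w.
Proof. by move=> e; rewrite nform_wd e ksign2 scale1r. Qed.

Lemma edge_commE j : edge_comm k G j =
  wd [:: src G j; tgt G j]
    - (-1) ^+ (weight G (src G j) * weight G (tgt G j)) *: wd [:: tgt G j; src G j].
Proof.
by rewrite /edge_comm graded_commE !wd_cons2.
Qed.

(** The two words of the commutator have the same normal form, and [ksign_swap] supplies exactly the
    sign between them. *)
Lemma nform_edge_comm w1 j w2 : nform (wd w1 * edge_comm k G j * wd w2) = 0.
Proof.
have uv := src_neq_tgt G j.
rewrite edge_commE mulr_linr3 [X in nform (X - _)]wd_cat3 [X in _ *: X]wd_cat3.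
rewrite linearB linearZ /= !nform_wd /= (ksign_swap G k w1 w2 uv).
have /nfP -> := teq_swap (adjb_sym G) (adjb_irr G) w1 w2 (adj_edge G j).
by rewrite scalerA mulrA subrr.
Qed.

Lemma nform_ideal x : ideal_gen (edge_comms k G) x -> nform x = 0.
Proof.
by apply: ideal_gen_words => _ w1 w2 [j ->]; apply: nform_edge_comm.
Qed.

Lemma gpi_edge_comm j : gpi (edge_comm k G j) = 0.
Proof.
rewrite -(raddf0 gpi); apply/gpi_eq; rewrite subr0.
by apply: IdealGen; exists j.
Qed.

Lemma set2_eq (T : finType) (s t u v : T) : s != t ->
  [set s; t] = [set u; v] -> (s = u /\ t = v) \/ (s = v /\ t = u).
Proof.
move=> st e; have := set21 s t; have := set22 s t; rewrite e !inE.
by case/pred2P => es /pred2P[] et; move: st;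
  rewrite es et ?eqxx // => _; [right | left].
Qed.

Lemma gpi_adj u v : adjb G u v ->
  gpi (wd [:: u; v]) = (-1) ^+ (weight G u * weight G v) *: gpi (wd [:: v; u]).
Proof.
case/existsP => j /eqP e; have := gpi_edge_comm j.
rewrite edge_commE linearB linearZ /= => /eqP; rewrite subr_eq0.
case: (set2_eq (src_neq_tgt G j) e) => -[-> ->] /eqP h; first exact: h.
by rewrite [X in _ *: X]h mulnC scalerA -expr2 sqrr_sign scale1r.
Qed.

(** Rescaled by [ksign], words that differ by a swap have equal classes, so [teq_swaps] applies to
    equality of rescaled classes. *)
Lemma gpi_normal w :
  ksign G k w *: gpi (wd w) = ksign G k (nf G w) *: gpi (wd (nf G w)).
Proof.
have := teq_nf G w; rewrite teq_sym; move: w (nf G w) => w2 w1.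
apply: (@teq_swaps _ _ (adjb_sym G) (adjb_irr G)
  (fun w1 w2 => ksign G k w1 *: gpi (wd w1) = ksign G k w2 *: gpi (wd w2))).
- by [].
- by move=> w3 w4 w5 -> ->.
move=> {w1 w2} w1 u v w2 uv.
have uNv : u != v by apply: contraTneq uv => ->; rewrite adjb_irr.
have gpi3 a : gpi (wd (w1 ++ a ++ w2)) = gpi (wd w1) * gpi (wd a) * gpi (wd w2).
  by rewrite -wd_cat3 !(rmorphM gpi).
have e : gpi (wd (w1 ++ [:: u, v & w2])) =
    (-1) ^+ (weight G u * weight G v) *: gpi (wd (w1 ++ [:: v, u & w2])).
  apply: etrans (gpi3 [:: u; v]) _; rewrite (gpi_adj uv) mulr_scale3.
  by congr (_ *: _); apply/esym/(gpi3 [:: v; u]).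
rewrite (ksign_swap G k w1 w2 uNv).
move: (gpi (wd (w1 ++ [:: u, v & w2]))) (gpi (wd (w1 ++ [:: v, u & w2]))) e.
by move=> X Y ->; rewrite scalerA mulrC signrMK.
Qed.

Lemma gpi_nform x : gpi (nform x) = gpi x.
Proof.
rewrite -[LHS]/((gpi \o nform) x).
apply: free_alg_lin_ext x => w; rewrite [LHS]/= nform_wd linearZ /=.
have := gpi_normal w; move: (gpi (wd w)) (gpi (wd (nf G w))) => X Y e.
by rewrite -scalerA -e scalerA ksign2 scale1r.
Qed.

Lemma nform_idem x : nform (nform x) = nform x.
Proof.
rewrite -[LHS]/((nform \o nform) x).
apply: free_alg_lin_ext x => w; rewrite [LHS]/= [RHS]/= nform_wd linearZ /=.
by congr (_ *: _); apply: nform_nf; apply: nf_id.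
Qed.

Lemma nform_coef s x : fcoef s (nform x) != 0 ->
  nf G s = s /\ exists t, fcoef t x != 0 /\ nf G t = s.
Proof.
rewrite nform.unlock => /fcoef_wext_neq0[t [tx]]; set d := _ *: _ => ts.
rewrite /d fcoefZ fcoef_wd in ts; have [e|e] := eqVneq (nf G t) s.
  by rewrite -e nf_id; split=> //; exists t.
by rewrite (negbTE e) mulr0 eqxx in ts.
Qed.

Lemma nform_gr d x : free_gr_weight k G d x -> free_gr_weight k G d (nform x).
Proof.
move/free_grP => hx; apply/free_grP => s /nform_coef[_ [t [/hx <- <-]]].
exact/esym/(wt_teq (teq_nf G t)).
Qed.

(** The preimage is arbitrary, but [nform] kills the ideal. Hence the resulting section is
    independent of it and linear, and identifies the graph algebra with the span of the normal
    forms. *)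
Lemma asec_exists : {f : graph_alg k G -> F | forall a, gpi (f a) = a /\ nform (f a) = f a}.
Proof.
exists (fun a => nform (sval (cid (gpi_surj a)))) => a.
by rewrite gpi_nform nform_idem; case: cid.
Qed.

Definition asec := sval asec_exists.

Lemma gpi_asec a : gpi (asec a) = a.
Proof. by case: (svalP asec_exists a). Qed.

Lemma nform_asec a : nform (asec a) = asec a.
Proof. by case: (svalP asec_exists a). Qed.

Lemma asec_gpi x : asec (gpi x) = nform x.
Proof.
apply/eqP; rewrite -nform_asec -subr_eq0 -(linearB nform); apply/eqP/nform_ideal.
by apply/gpi_eq; rewrite gpi_asec.
Qed.

Fact asec_is_linear : linear asec.
Proof.
move=> c a b; have e : c *: a + b = gpi (c *: asec a + asec b).
  by rewrite (linearP gpi) /= (gpi_asec a) (gpi_asec b).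
by rewrite e (asec_gpi (_ *: _ + _)) (linearP nform) /= (nform_asec a) (nform_asec b).
Qed.

HB.instance Definition _ :=
  GRing.isLinear.Build k (graph_alg k G) F *:%R asec asec_is_linear.

End NormalForm.

Arguments asec {k n m G} a.

(** * Hilbert series *)

Section GradedDimensions.
Variable k : fieldType.

(** A matrix with more rows than columns has a nonzero vector in its left kernel, which is a
    relation among the [b i]. *)
Lemma free_in_span (V : lmodType k) (M N : nat) (b : 'I_M -> V) (b' : 'I_N -> V) :
  (forall c : 'I_M -> k, \sum_i c i *: b i = 0 -> forall i, c i = 0) ->
  (forall i, exists c : 'I_N -> k, b i = \sum_j c j *: b' j) -> (M <= N)%N.
Proof.
move=> b_free /choice[C bE]; rewrite leqNgt; apply/negP => ltNM.
pose A : 'M[k]_(M, N) := \matrix_(i, j) C i j.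
have /rowV0Pn[u uA u0] : kermx A != 0.
  rewrite -mxrank_eq0 mxrank_ker subn_eq0 -ltnNge.
  exact: leq_ltn_trans (rank_leq_col A) ltNM.
suff uz : forall i, u 0 i = 0.
  by move/eqP: u0; apply; apply/rowP => i; rewrite uz mxE.
apply: b_free; under eq_bigr do rewrite bE scaler_sumr.
rewrite exchange_big big1 //= => j _; under eq_bigr do rewrite scalerA.
rewrite -scaler_suml.
have /sub_kermxP/rowP/(_ j) := uA; rewrite !mxE => e.
suff -> : \sum_i u 0 i * C i j = 0 by rewrite scale0r.
by rewrite -[RHS]e; apply: eq_bigr => i _; rewrite mxE.
Qed.

Lemma has_dim_uniq (V : lmodType k) (W : V -> Prop) M N :
  has_dim W M -> has_dim W N -> M = N.
Proof.
move=> [b [bW b_free b_span]] [b' [bW' b_free' b_span']]; apply/eqP.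
by rewrite eqn_leq (free_in_span b_free (b' := b')) ?(free_in_span b_free' (b' := b)) // => i; auto.
Qed.

Lemma gr_iso_sym (U V : lmodType k) grU grV :
  @gr_iso k U V grU grV -> @gr_iso k V U grV grU.
Proof.
case=> f [g fK gK] grf; have g_lin : linear g.
  by move=> c x y; rewrite -{1}[x]gK -{1}[y]gK -linearP fK.
pose gL := GRing.isLinear.Build k V U *:%R g g_lin.
pose g' : {linear V -> U} := HB.pack g gL.
exists g'; first by exists f.
by move=> d x; rewrite -{1}[x]gK; apply: iff_sym; apply: grf.
Qed.

Lemma gr_iso_trans (U V W : lmodType k) grU grV grW :
  @gr_iso k U V grU grV -> @gr_iso k V W grV grW -> @gr_iso k U W grU grW.
Proof.
case=> f f_bij grf [g g_bij grg]; exists (g \o f); first exact: bij_comp.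
by move=> d x; rewrite grf grg.
Qed.

Lemma gr_iso_has_dim (U V : lmodType k) grU grV d N :
  @gr_iso k U V grU grV -> has_dim (grU d) N -> has_dim (grV d) N.
Proof.
case=> f [g fK gK] grf [b [bW b_free b_span]]; exists (fun i => f (b i)); split.
- by move=> i; apply/grf.
- move=> c e; apply: b_free; apply: (can_inj fK); rewrite linear0 -[RHS]e.
  by rewrite linear_sum; apply: eq_bigr => i _; rewrite linearZ.
- move=> y; rewrite -[y]gK => /grf/b_span[c ->]; exists c.
  by rewrite linear_sum; apply: eq_bigr => i _; rewrite linearZ.
Qed.

End GradedDimensions.

Section HilbertSeries.
Variables (k : fieldType) (n m : nat) (G : wgraph n m).
Local Notation asec := (@asec k n m G).
Local Notation gpi := (@gpi k n m G).

Lemma traces_homog d s : s \in traces G d -> graph_alg_gr k G d (gpi (wd s)).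
Proof.
rewrite mem_traces => /andP[/eqP ws _]; exists (wd s); first exact: free_gr_wd.
by rewrite gpi.unlock.
Qed.

Lemma graph_alg_grP d (a : graph_alg k G) :
  graph_alg_gr k G d a <-> free_gr_weight k G d (asec a).
Proof.
split=> [[x hx <-]|ha]; last by exists (asec a); rewrite // -[RHS]gpi_asec gpi.unlock.
have -> : quot_pi (edge_comms k G) x = gpi x by rewrite gpi.unlock.
by rewrite asec_gpi; apply: nform_gr.
Qed.

Lemma asec_traces d (a : graph_alg k G) s :
  graph_alg_gr k G d a -> fcoef s (asec a) != 0 -> s \in traces G d.
Proof.
move=> /graph_alg_grP/free_grP ha sa; rewrite mem_traces /wt (ha s sa) eqxx /=.
by rewrite -nform_asec in sa; have [-> _] := nform_coef sa.
Qed.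

(** Under [asec] the classes of the traces become distinct words, so independence and spanning are
    read off from coefficients. *)
Lemma graph_alg_has_dim d : has_dim (graph_alg_gr k G d) (size (traces G d)).
Proof.
pose t (i : 'I_(size (traces G d))) := nth [::] (traces G d) i.
have tP i : t i \in traces G d by apply: mem_nth.
have t_inj : injective t.
  by move=> i j /eqP; rewrite nth_uniq ?traces_uniq // => /eqP/val_inj.
exists (fun i => gpi (wd (t i))); split=> [i|c e i|a ha]; first exact: traces_homog.
  have /(congr1 asec) := e; rewrite linear0 linear_sum.
  have asec_t j : fcoef (t i) (asec (c j *: gpi (wd (t j)))) = c j * (t j == t i)%:R.
    have nft : nf G (t j) = t j by have := tP j; rewrite mem_traces => /andP[_ /eqP].
    by rewrite (linearZ_LR asec) /= asec_gpi (nform_nf k nft) fcoefZ fcoef_wd.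
  move/(congr1 (fcoef (t i))); rewrite fcoef_sum (eq_bigr _ (fun j _ => asec_t j)).
  rewrite (bigD1 i) //= eqxx mulr1 big1 ?addr0 => [->|j ji]; first exact: (raddf0 (fcoef (t i))).
  by rewrite (inj_eq t_inj) (negbTE ji) mulr0.
exists (fun i => fcoef (t i) (asec a)); rewrite -[LHS]gpi_asec.
have /(free_alg_support (traces_uniq G d)) {1}-> s : fcoef s (asec a) != 0 -> s \in traces G d.
  exact: asec_traces.
rewrite (big_nth [::]) big_mkord (linear_sum gpi).
by apply: eq_bigr => i _; rewrite (linearZ_LR gpi).
Qed.

Lemma graph_alg_hilbert : is_hilbert_series (graph_alg_gr k G) (ntraces G).
Proof. by move=> d; exists (size (traces G d)); first exact: graph_alg_has_dim. Qed.

Lemma graph_alg_hilbert_uniq h :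
  is_hilbert_series (graph_alg_gr k G) h -> h =1 ntraces G.
Proof.
move=> hh d; have [N dimN ->] := hh d.
by rewrite (has_dim_uniq dimN (graph_alg_has_dim d)).
Qed.

Lemma hilbert_triangle_free :
  (exists H, is_hilbert_series (graph_alg_gr k G) H /\ ps_is_inv (graph_series G) H)
    <-> ~ has_triangle G.
Proof.
rewrite -graph_series_inv; split=> [[h [/graph_alg_hilbert_uniq hE h_inv]]|inv_tr].
  move=> d; rewrite -h_inv; apply: eq_bigr => i _; by rewrite hE.
by exists (ntraces G); split=> //; apply: graph_alg_hilbert.
Qed.

End HilbertSeries.

(** * Graded isomorphisms from equal trace counts *)

Section SameSeries.
Variables (k : fieldType) (n1 m1 n2 m2 : nat) (G1 : wgraph n1 m1) (G2 : wgraph n2 m2).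

(** Traces of equal degree are matched by their positions in the two lists. When the counts agree,
    the default [[::]] is never reached on a normal form. *)
Definition trace_match (s : seq 'I_n1) : seq 'I_n2 :=
  nth [::] (traces G2 (wt G1 s)) (index s (traces G1 (wt G1 s))).

Definition alg_match : graph_alg k G1 -> graph_alg k G2 :=
  wext (fun s => gpi (wd (trace_match s))) \o asec.

HB.instance Definition _ := GRing.Linear.on alg_match.

Hypothesis same : ntraces G1 =1 ntraces G2.

Lemma trace_matchP s : nf G1 s = s -> trace_match s \in traces G2 (wt G1 s).
Proof.
move=> e; apply: mem_nth; have [<-] := same (wt G1 s).
by rewrite index_mem mem_traces e !eqxx.
Qed.

Lemma alg_match_wd s : nf G1 s = s -> alg_match (gpi (wd s)) = gpi (wd (trace_match s)).
Proof. by move=> e; rewrite /alg_match /= asec_gpi nform_nf // wext_wd. Qed.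

Lemma alg_match_gr d a : graph_alg_gr k G1 d a -> graph_alg_gr k G2 d (alg_match a).
Proof.
move=> ha; exists (wext (fun s => wd (trace_match s)) (asec a)).
  apply/free_grP => s /fcoef_wext_neq0[t [ta ts]].
  have := asec_traces ha ta; rewrite mem_traces => /andP[/eqP wtt /eqP nft].
  have := trace_matchP nft; rewrite mem_traces wtt => /andP[/eqP wtm _].
  by move: ts; rewrite fcoef_wd; case: (_ =P s) => [<- //|]; rewrite eqxx.
have gpiE x : quot_pi (edge_comms k G2) x = gpi x by rewrite gpi.unlock.
by rewrite gpiE (wext_comp gpi).
Qed.

End SameSeries.

Arguments trace_match {n1 m1 n2 m2} G1 G2 s.
Arguments alg_match {k n1 m1 n2 m2} G1 G2 a.

Section SameSeriesIso.
Variables (k : fieldType) (n1 m1 n2 m2 : nat) (G1 : wgraph n1 m1) (G2 : wgraph n2 m2).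
Hypothesis same : ntraces G1 =1 ntraces G2.

Lemma trace_matchK s : nf G1 s = s -> trace_match G2 G1 (trace_match G1 G2 s) = s.
Proof.
move=> e; have s1 : s \in traces G1 (wt G1 s) by rewrite mem_traces e !eqxx.
have := trace_matchP same e; rewrite mem_traces => /andP[/eqP wt2 _].
rewrite {1}/trace_match wt2 {1}/trace_match index_uniq ?traces_uniq ?nth_index //.
by have [<-] := same (wt G1 s); rewrite index_mem.
Qed.

Lemma alg_matchK : cancel (@alg_match k _ _ _ _ G1 G2) (alg_match G2 G1).
Proof.
move=> a; rewrite -[a]gpi_asec; move: (asec a) => x.
rewrite -[LHS]/((alg_match G2 G1 \o (alg_match G1 G2 \o gpi)) x).
apply: free_alg_lin_ext x => s; rewrite [LHS]/= [RHS]/=.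
have [c ->] : exists c, gpi (wd s) = c *: gpi (wd (nf G1 s)) :> graph_alg k G1.
  exists (ksign G1 k s * ksign G1 k (nf G1 s)).
  by rewrite -[LHS]gpi_nform nform_wd (linearZ_LR gpi).
have nfs := nf_id G1 s; have := trace_matchP same nfs.
rewrite mem_traces => /andP[_ /eqP nft].
have e1 : alg_match G1 G2 (gpi (wd (nf G1 s))) =
    gpi (wd (trace_match G1 G2 (nf G1 s))) :> graph_alg k G2.
  exact: alg_match_wd.
have e2 : alg_match G2 G1 (gpi (wd (trace_match G1 G2 (nf G1 s)))) =
    gpi (wd (nf G1 s)) :> graph_alg k G1.
  by rewrite (alg_match_wd k G1 nft) trace_matchK.
by rewrite (linearZ_LR (alg_match G1 G2)) (linearZ_LR (alg_match G2 G1)) /= e1 e2.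
Qed.

End SameSeriesIso.


Lemma gr_iso_graph (k : fieldType) n1 m1 n2 m2 (G1 : wgraph n1 m1) (G2 : wgraph n2 m2) :
  ntraces G1 =1 ntraces G2 -> gr_iso (graph_alg_gr k G1) (graph_alg_gr k G2).
Proof.
move=> same; have same' : ntraces G2 =1 ntraces G1 by move=> d; rewrite same.
exists (alg_match G1 G2).
  exact: Bijective (alg_matchK same) (alg_matchK same').
move=> d a; split; first exact: alg_match_gr.
by rewrite -{2}(alg_matchK same a); apply: alg_match_gr.
Qed.

(** Since [g 0 = 1], degree [d] of the product determines the [d]-th coefficient of the inverse from
    the lower ones. *)
Lemma ps_inv_uniq (g h1 h2 : nat -> int) :
  g 0 = 1 -> ps_is_inv g h1 -> ps_is_inv g h2 -> h1 =1 h2.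
Proof.
move=> g0 inv1 inv2 d; elim/ltn_ind: d => d IHd.
have := inv1 d; rewrite -inv2 /ps_mul !big_ord_recl !g0 !mul1r !subn0.
have -> : \sum_(i < d) g (bump 0 i) * h1 (d - bump 0 i)%N =
          \sum_(i < d) g (bump 0 i) * h2 (d - bump 0 i)%N.
  by apply: eq_bigr => i _; rewrite IHd // /bump /=; have := ltn_ord i; lia.
exact: addIr.
Qed.

Lemma graph_series0 n m (G : wgraph n m) : graph_series G 0 = 1.
Proof.
rewrite /graph_series !big1 ?subr0 ?addr0 // => i _; rewrite /ps_X ltn_eqF //.
  by rewrite /edge_weight addn_gt0 weight_gt0.
exact: weight_gt0.
Qed.

Lemma ord0_absurd (j : 'I_0) : False.
Proof. by case: j. Qed.

(** * The free product *)

Section DerivedGraphs.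
Variables (n m : nat) (G : wgraph n m).

Definition edgeless_end (j : 'I_0) : 'I_n := False_rect _ (ord0_absurd j).

Fact edgeless_neq j : edgeless_end j != edgeless_end j.
Proof. by case: (ord0_absurd j). Qed.

Fact edgeless_inj : injective (fun j => [set edgeless_end j; edgeless_end j]).
Proof. by move=> j; case: (ord0_absurd j). Qed.

(** Its graph algebra has no relations and is the free algebra, whose dimensions thus also come from
    counting traces. *)
Definition edgeless : wgraph n 0 := WGraph (weight_gt0 G) edgeless_neq edgeless_inj.

Lemma edgeless_triangle_free : ~ has_triangle edgeless.
Proof. by case=> u [v [w [[j _] _ _]]]; case: (ord0_absurd j). Qed.

Definition ext_weight (i : 'I_(n + m)) : nat :=
  match split i with inl u => weight G u | inr j => edge_weight G j end.

Fact ext_weight_gt0 i : (0 < ext_weight i)%N.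
Proof.
rewrite /ext_weight; case: split => [u|j]; first exact: weight_gt0.
by rewrite addn_gt0 weight_gt0.
Qed.

Fact ext_neq j : lshift m (src G j) != lshift m (tgt G j).
Proof. by rewrite eq_lshift src_neq_tgt. Qed.

Fact ext_inj : injective (fun j => [set lshift m (src G j); lshift m (tgt G j)]).
Proof.
move=> i j /= e; apply: (@ends_inj _ _ G); apply: (imset_inj (@lshift_inj n m)).
by rewrite !imsetU1 !imset_set1.
Qed.

(* Its graph algebra is the free product of A(G) with the free algebra on one
   letter of degree q_j for each edge j, that is, with B(G). *)
Definition extended : wgraph (n + m) m := WGraph ext_weight_gt0 ext_neq ext_inj.

Lemma ext_weightl u : ext_weight (lshift m u) = weight G u.
Proof. by rewrite /ext_weight (unsplitK (inl u)). Qed.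

Lemma ext_weightr j : ext_weight (rshift n j) = edge_weight G j.
Proof. by rewrite /ext_weight (unsplitK (inr j)). Qed.

Lemma ext_edge_weight j : edge_weight extended j = edge_weight G j.
Proof. by rewrite /edge_weight /= !ext_weightl. Qed.

Lemma ext_series : graph_series extended =1 graph_series edgeless.
Proof.
move=> d; rewrite /graph_series big_split_ord /= [in RHS]big_ord0 addr0.
under eq_bigr do rewrite ext_weightl.
under [X in - (_ + X)]eq_bigr do rewrite ext_weightr.
under [X in _ + X]eq_bigr do rewrite ext_edge_weight.
by rewrite opprD addrA subrK.
Qed.

Lemma ext_adjacent x y : adjacent extended x y ->
  exists u v, [/\ x = lshift m u, y = lshift m v & adjacent G u v].
Proof.
case=> j /= /(set2_eq (ext_neq j))[[<- <-]|[<- <-]].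
  by exists (src G j), (tgt G j); split=> //; exists j.
by exists (tgt G j), (src G j); split=> //; exists j; rewrite setUC.
Qed.

Lemma ext_triangle : has_triangle extended <-> has_triangle G.
Proof.
have extI u v : adjacent G u v -> adjacent extended (lshift m u) (lshift m v).
  have imE s t : [set lshift m s; lshift m t] = [set lshift m x | x in [set s; t]].
    by rewrite imsetU1 imset_set1.
  by case=> j e; exists j; rewrite /= !imE e.
split=> [[x [y [z [/ext_adjacent[u [v [-> -> uv]]]]]]]|[u [v [w [uv vw wu]]]]].
  case/ext_adjacent=> v' [w [/lshift_inj <- -> vw]].
  case/ext_adjacent=> w' [u' [/lshift_inj <- /lshift_inj <- wu]].
  by exists u, v, w.
by exists (lshift m u), (lshift m v), (lshift m w); split; apply: extI.
Qed.

End DerivedGraphs.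

Section EdgelessIso.
Variables (k : fieldType) (n m : nat) (G : wgraph n m).

Lemma edgeless_nform x : nform (edgeless G) x = x :> free_alg k 'I_n.
Proof.
suff I0 y : ideal_gen (edge_comms k (edgeless G)) y -> y = 0.
  apply/eqP; rewrite -subr_eq0; apply/eqP/I0.
  by apply/gpi_eq; apply: gpi_nform.
elim=> // {y} [z [j _]|y z _ -> _ ->|a y _ ->|y a _ ->].
- by case: (ord0_absurd j).
- by rewrite subr0.
- by rewrite mulr0.
- by rewrite mul0r.
Qed.

Lemma gr_iso_edgeless : gr_iso (free_gr_weight k G) (graph_alg_gr k (edgeless G)).
Proof.
exists (@gpi k n 0 (edgeless G)).
  exists asec => [x|a]; last exact: gpi_asec.
  by rewrite asec_gpi edgeless_nform.
by move=> d x; rewrite graph_alg_grP asec_gpi edgeless_nform.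
Qed.

(** Both graphs have the same proposed denominator, and the traces of [edgeless G] always invert it.
    By uniqueness of inverses the counts agree iff those of [extended G] invert it too. *)
Lemma extended_series_triangle_free :
  ntraces (edgeless G) =1 ntraces (extended G) <-> ~ has_triangle G.
Proof.
have inv0 : ps_is_inv (graph_series (edgeless G)) (ntraces (edgeless G)).
  by apply/graph_series_inv; apply: edgeless_triangle_free.
have gs_ext : ps_is_inv (graph_series (extended G)) (ntraces (extended G)) <->
    ps_is_inv (graph_series (edgeless G)) (ntraces (extended G)).
  by split=> inv d; rewrite -inv; apply: eq_bigr => i _; rewrite ext_series.
rewrite -ext_triangle -graph_series_inv gs_ext; split=> [e d|inv].
  by rewrite -inv0; apply: eq_bigr => i _; rewrite e.
exact: ps_inv_uniq (graph_series0 _) inv0 inv.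
Qed.

Lemma gr_iso_extended :
  gr_iso (free_gr_weight k G) (graph_alg_gr k (extended G)) <-> ~ has_triangle G.
Proof.
rewrite -extended_series_triangle_free; split=> [iso d|/(gr_iso_graph k) iso].
  have iso' := gr_iso_trans (gr_iso_sym gr_iso_edgeless) iso.
  have dimE := gr_iso_has_dim iso' (graph_alg_has_dim k (edgeless G) d).
  by rewrite /ntraces (has_dim_uniq dimE (graph_alg_has_dim k (extended G) d)).
exact: gr_iso_trans gr_iso_edgeless iso.
Qed.

End EdgelessIso.

Lemma free_hom_ext (k : fieldType) (T : choiceType) (C : algType k)
    (f g : {lrmorphism free_alg k T -> C}) :
  (forall t, f (fvar k t) = g (fvar k t)) -> f =1 g.
Proof.
move=> e x; have mon (h : {lrmorphism free_alg k T -> C}) : monoid_morphism h.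
  by split; [apply: rmorph1 | apply: rmorphM].
have fE := free_lift_uniq (phi := fun t => g (fvar k t)) (linearP f) (mon f) e.
have gE := free_lift_uniq (phi := fun t => g (fvar k t)) (linearP g) (mon g) (fun=> erefl).
by rewrite (fE x) (gE x).
Qed.

Lemma rmorph_graded_comm (k : fieldType) (A C : algType k) (f : {lrmorphism A -> C}) da db a b :
  f (graded_comm da db a b) = graded_comm da db (f a) (f b).
Proof. by rewrite !graded_commE linearB linearZ /= !rmorphM. Qed.

Lemma free_lift_wd (k : fieldType) (T : choiceType) (C : algType k) (phi : T -> C) s :
  free_lift phi (wd s) = \prod_(t <- s) phi t.
Proof.
elim: s => [|t s IHs]; first by rewrite wd_nil rmorph1 big_nil.
by rewrite wd_cons rmorphM big_cons -IHs /= free_lift_var.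
Qed.

Section GraphLift.
Variables (k : fieldType) (n m : nat) (G : wgraph n m) (C : algType k).
Variable phi : 'I_n -> C.
Hypothesis phi_rel : forall j, graded_comm (weight G (src G j)) (weight G (tgt G j))
  (phi (src G j)) (phi (tgt G j)) = 0.

Definition graph_lift (a : graph_alg k G) : C := free_lift phi (asec a).

Lemma free_lift_edge j : free_lift phi (edge_comm k G j) = 0.
Proof. by rewrite rmorph_graded_comm /= !free_lift_var. Qed.

Lemma graph_lift_gpi x : graph_lift (gpi x) = free_lift phi x.
Proof.
apply/eqP; rewrite -subr_eq0 /graph_lift -raddfB; apply/eqP.
have kill y : edge_comms k G y -> free_lift phi y = 0.
  by case=> j ->; apply: free_lift_edge.
apply: (ideal_gen_lift kill); apply/gpi_eq; exact: gpi_asec.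
Qed.

Fact graph_lift_is_linear : linear graph_lift.
Proof. by move=> c a b; rewrite /graph_lift !linearP. Qed.

Fact graph_lift_is_monoid_morphism : monoid_morphism graph_lift.
Proof.
split=> [|a b]; first by rewrite -(rmorph1 gpi) graph_lift_gpi rmorph1.
rewrite -[a]gpi_asec -[b]gpi_asec; move: (asec a) (asec b) => x y.
by rewrite -(rmorphM gpi) !graph_lift_gpi rmorphM.
Qed.

Definition graph_lift_hom : {lrmorphism graph_alg k G -> C} :=
  HB.pack graph_lift
    (GRing.isLinear.Build k (graph_alg k G) C *:%R graph_lift graph_lift_is_linear)
    (GRing.isMonoidMorphism.Build (graph_alg k G) C graph_lift
       graph_lift_is_monoid_morphism).

Lemma graph_lift_hom_gpi x : graph_lift_hom (gpi x) = free_lift phi x.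
Proof. exact: graph_lift_gpi. Qed.

Lemma graph_lift_hom_var i : graph_lift_hom (gpi (fvar k i)) = phi i.
Proof. by rewrite graph_lift_hom_gpi free_lift_var. Qed.

End GraphLift.

Lemma graph_hom_ext (k : fieldType) n m (G : wgraph n m) (C : algType k)
    (f g : {lrmorphism graph_alg k G -> C}) :
  (forall i, f (gpi (fvar k i)) = g (gpi (fvar k i))) -> f =1 g.
Proof.
move=> e a; rewrite -[a]gpi_asec.
exact: (free_hom_ext (f := f \o gpi) (g := g \o gpi)).
Qed.

(** * Freeness of the edge subalgebra *)

Section EdgeSubalgebra.
Variables (k : fieldType) (n m : nat) (G : wgraph n m).
Local Notation B := (graph_sub k G).

Definition sub_val (b : B) : free_alg k 'I_n := subalg_val b.

Fact sub_val_is_linear : linear sub_val.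
Proof. exact: (linearP (\val : {linear subalg (edge_comms k G) -> free_alg k 'I_n})). Qed.

Fact sub_val_is_monoid_morphism : monoid_morphism sub_val.
Proof.
split; first exact: (rmorph1 (\val : {rmorphism subalg (edge_comms k G) -> free_alg k 'I_n})).
exact: (rmorphM (\val : {rmorphism subalg (edge_comms k G) -> free_alg k 'I_n})).
Qed.

HB.instance Definition _ :=
  GRing.isLinear.Build k B (free_alg k 'I_n) *:%R sub_val sub_val_is_linear.
HB.instance Definition _ :=
  GRing.isMonoidMorphism.Build B (free_alg k 'I_n) sub_val sub_val_is_monoid_morphism.

Lemma sub_val_inj : injective sub_val.
Proof. exact: (@val_inj _ _ (subalg (edge_comms k G))). Qed.

Definition edge_gen (j : 'I_m) : B :=
  Subalg (asboolT (SubalgGen (ex_intro _ j erefl : edge_comms k G (edge_comm k G j)))).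

Definition edge_lift : free_alg k 'I_m -> B := free_lift edge_gen.

HB.instance Definition _ := GRing.LRMorphism.on edge_lift.

Lemma val_edge_lift x : sub_val (edge_lift x) = free_lift (edge_comm k G) x.
Proof.
apply: (free_hom_ext (f := sub_val \o edge_lift) (g := free_lift (edge_comm k G))) => j.
by rewrite /= /edge_lift !free_lift_var.
Qed.

Lemma edge_lift_surj b : exists x, edge_lift x = b.
Proof.
suff [x /sub_val_inj ex] : exists x, sub_val (edge_lift x) = sub_val b by exists x.
case: b => b Pb; rewrite [sub_val (Subalg _)]/sub_val /=.
elim: (asboolW Pb) => [_ [j ->]||c x y _ [x' <-] _ [y' <-]|x y _ [x' <-] _ [y' <-]].
- by exists (fvar k j); rewrite /edge_lift free_lift_var.
- by exists 1; rewrite !rmorph1.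
- by exists (c *: x' + y'); rewrite !linearP.
- by exists (x' * y'); rewrite !rmorphM.
Qed.

End EdgeSubalgebra.
Lemma graded_comm_mul (k : fieldType) (A : algType k) da db (a b y : A) :
  graded_comm da db a b * y = a * (b * y) - (-1) ^+ (da * db)%N *: (b * (a * y)).
Proof. by rewrite graded_commE mulrBl -scalerAl -!mulrA. Qed.

Lemma fcoef_cons_mul (k : fieldType) (T : choiceType) (a : T) s t (y : free_alg k T) :
  fcoef (s :: t) (fvar k a * y) = (a == s)%:R * fcoef t y.
Proof.
elim/free_alg_ind: y => [|c r y IHy]; first by rewrite mulr0 !fcoef0 mulr0.
have e : fvar k a * wd r = wd (a :: r) by rewrite wd_cons.
rewrite mulr_linr e !fcoefP IHy !fcoef_wd eqseq_cons.
by rewrite mulrDr mulrCA; case: (a == s); rewrite /= ?mul1r ?mul0r.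
Qed.

Lemma fcoef_nil_mul (k : fieldType) (T : choiceType) (a : T) (y : free_alg k T) :
  fcoef [::] (fvar k a * y) = 0.
Proof.
elim/free_alg_ind: y => [|c r y IHy]; first by rewrite mulr0 fcoef0.
have e : fvar k a * wd r = wd (a :: r) by rewrite wd_cons.
by rewrite mulr_linr e fcoefP IHy fcoef_wd mulr0 addr0.
Qed.

Section EdgeFreeness.
Variables (k : fieldType) (n m : nat) (G : wgraph n m).
Local Notation B := (graph_sub k G).
Local Notation edge_lift := (@edge_lift k n m G).

(** Distinct edges have distinct end sets, so neither term of another commutator starts with
    [src G i], [tgt G i]. For [j = i] the reversed term starts with [tgt G i] and drops out. *)
Lemma fcoef_edge_mul i j r (y : free_alg k 'I_n) :
  fcoef [:: src G i, tgt G i & r] (edge_comm k G j * y) = (j == i)%:R * fcoef r y.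
Proof.
rewrite /edge_comm graded_comm_mul fcoefBZ.
rewrite [X in X - _ = _]fcoef_cons_mul [X in _ * X - _ = _]fcoef_cons_mul.
rewrite [X in _ - _ * X = _]fcoef_cons_mul [X in _ - _ * (_ * X) = _]fcoef_cons_mul.
have [->|ji] := eqVneq j i.
  have st := src_neq_tgt G i; rewrite !eqxx !mul1r eq_sym (negbTE st).
  by rewrite mul0r mulr0 subr0.
have e1 : (src G j == src G i) && (tgt G j == tgt G i) = false.
  apply: contraNF ji => /andP[/eqP e1 /eqP e2].
  by apply/eqP/(@ends_inj _ _ G); rewrite e1 e2.
have e2 : (tgt G j == src G i) && (src G j == tgt G i) = false.
  apply: contraNF ji => /andP[/eqP e3 /eqP e4].
  by apply/eqP/(@ends_inj _ _ G); rewrite e3 e4 setUC.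
have andE (b1 b2 : bool) (c : k) : b1%:R * (b2%:R * c) = (b1 && b2)%:R * c.
  by case: b1; rewrite /= ?mul1r ?mul0r.
by rewrite 2!andE e1 e2 !mul0r mulr0 subr0.
Qed.

Lemma fcoef_edge_nil j (y : free_alg k 'I_n) : fcoef [::] (edge_comm k G j * y) = 0.
Proof.
rewrite /edge_comm graded_comm_mul fcoefBZ.
by rewrite [X in X - _ = _]fcoef_nil_mul [X in _ - _ * X = _]fcoef_nil_mul mulr0 subr0.
Qed.

Definition edge_word (w : seq 'I_m) : seq 'I_n :=
  flatten [seq [:: src G j; tgt G j] | j <- w].

(* In a product of edge commutators, the word src tgt src tgt ... comes from
   one choice of edges only. *)
Lemma fcoef_edge_lift w x :
  fcoef (edge_word w) (free_lift (edge_comm k G) x) = fcoef w x.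
Proof.
elim/free_alg_ind: x => [|c s x IHx]; first by rewrite raddf0 !fcoef0.
rewrite (linearP (free_lift (edge_comm k G))) /= [LHS]fcoefP [RHS]fcoefP.
congr (_ + _); last exact: IHx.
congr (_ * _).
elim: s w {x IHx} => [|j s IHs] w.
  have -> : free_lift (edge_comm k G) (wd [::]) = wd [::] by rewrite !wd_nil rmorph1.
  by rewrite !fcoef_wd; case: w.
have -> : free_lift (edge_comm k G) (wd (j :: s)) =
    edge_comm k G j * free_lift (edge_comm k G) (wd s).
  by rewrite wd_cons rmorphM /= free_lift_var.
case: w => [|i w]; first by rewrite [LHS]fcoef_edge_nil fcoef_wd.
rewrite [LHS]fcoef_edge_mul IHs !fcoef_wd eqseq_cons.
by case: (j == i); rewrite ?mul1r ?mul0r.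
Qed.

Lemma edge_lift_inj : injective edge_lift.
Proof.
move=> x y /(congr1 (@sub_val k n m G)); rewrite !val_edge_lift => e.
by apply: free_algP => s; rewrite -!fcoef_edge_lift e.
Qed.

Lemma edge_inv_exists : {f : B -> free_alg k 'I_m | cancel f edge_lift}.
Proof.
by exists (fun b => sval (cid (edge_lift_surj b))) => b; case: cid.
Qed.

Definition edge_inv : B -> free_alg k 'I_m := sval edge_inv_exists.

Lemma edge_invK : cancel edge_inv edge_lift.
Proof. exact: (svalP edge_inv_exists). Qed.

Lemma edge_liftK : cancel edge_lift edge_inv.
Proof. by move=> x; apply: edge_lift_inj; rewrite edge_invK. Qed.

Fact edge_inv_is_linear : linear edge_inv.
Proof.
move=> c x y; apply: edge_lift_inj; rewrite edge_invK (linearP edge_lift).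
by rewrite /= (edge_invK x) (edge_invK y).
Qed.

Fact edge_inv_is_monoid_morphism : monoid_morphism edge_inv.
Proof.
split=> [|x y]; apply: edge_lift_inj; rewrite edge_invK.
  by rewrite (rmorph1 edge_lift).
by rewrite (rmorphM edge_lift) /= (edge_invK x) (edge_invK y).
Qed.

HB.instance Definition _ :=
  GRing.isLinear.Build k B (free_alg k 'I_m) *:%R edge_inv edge_inv_is_linear.
HB.instance Definition _ :=
  GRing.isMonoidMorphism.Build B (free_alg k 'I_m) edge_inv
    edge_inv_is_monoid_morphism.

(** The coefficient of [w] in [edge_inv b] is that of [edge_word w] in [b], and both words have the
    same weight. *)
Lemma edge_inv_gr d b :
  graph_sub_gr k G d b -> free_gr (edge_weight G) d (edge_inv b).
Proof.
move=> /free_grP hb; apply/free_grP => w.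
rewrite -fcoef_edge_lift -val_edge_lift edge_invK => /hb <-.
rewrite /edge_word; elim: w => [|j w IHw]; first by rewrite !big_nil.
by rewrite /= !big_cons IHw addnA.
Qed.

End EdgeFreeness.

(** * The free product as a graph algebra *)

Section ToExtended.
Variables (k : fieldType) (n m : nat) (G : wgraph n m).
Local Notation B := (graph_sub k G).
Local Notation A := (graph_alg k G).
Local Notation A' := (graph_alg k (extended G)).
Local Notation FP := (free_prod B A).

Definition ext_vertex (u : 'I_n) : A' := gpi (fvar k (lshift m u)).
Definition ext_edge (j : 'I_m) : A' := gpi (fvar k (rshift n j)).

Lemma ext_rel j : graded_comm (weight G (src G j)) (weight G (tgt G j))
  (ext_vertex (src G j)) (ext_vertex (tgt G j)) = 0.
Proof.
have := gpi_edge_comm k (extended G) j; rewrite rmorph_graded_comm /=.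
by rewrite !ext_weightl.
Qed.

Definition alg_to_ext : {lrmorphism A -> A'} := graph_lift_hom ext_rel.
(** Freeness of the edge subalgebra enters here: the images of the edge commutators may be
    prescribed at will. *)
Definition sub_to_ext : {lrmorphism B -> A'} := free_lift ext_edge \o @edge_inv k n m G.

Definition graph_free_prod : Type := FP.

HB.instance Definition _ := GRing.PzRing.on graph_free_prod.
HB.instance Definition _ := GRing.Lmodule.on graph_free_prod.

Definition to_ext : graph_free_prod -> A' := free_prod_lift sub_to_ext alg_to_ext.

Fact to_ext_is_linear : linear to_ext.
Proof. exact: free_prod_lift_linear. Qed.

Fact to_ext_is_monoid_morphism : monoid_morphism to_ext.
Proof. exact: free_prod_lift_monoid_morphism. Qed.

(** A quotient could collapse; the multiplicative map [to_ext] into a nonzero algebra shows that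
    this one does not. *)
Fact graph_free_prod_oner_neq0 : 1 != 0 :> graph_free_prod.
Proof.
apply/eqP => /(congr1 to_ext) e1.
have e0 : to_ext 0 = 0.
  by have := to_ext_is_linear (-1) 0 0; rewrite scaler0 addr0 scaleN1r addNr.
have := to_ext_is_monoid_morphism.1; rewrite e1 e0 => /eqP.
by rewrite eq_sym oner_eq0.
Qed.

HB.instance Definition _ :=
  GRing.PzSemiRing_isNonZero.Build graph_free_prod graph_free_prod_oner_neq0.
HB.instance Definition _ :=
  GRing.Lmodule_isLalgebra.Build k graph_free_prod
    (@quot_scalerAl _ _ (@free_prod_rel k B A)).
HB.instance Definition _ :=
  GRing.Lalgebra_isAlgebra.Build k graph_free_prod
    (@quot_scalerAr _ _ (@free_prod_rel k B A)).

HB.instance Definition _ :=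
  GRing.isLinear.Build k graph_free_prod A' *:%R to_ext to_ext_is_linear.
HB.instance Definition _ :=
  GRing.isMonoidMorphism.Build graph_free_prod A' to_ext
    to_ext_is_monoid_morphism.

Definition gfp_inl : B -> graph_free_prod := @free_prod_inl k B A.
Definition gfp_inr : A -> graph_free_prod := @free_prod_inr k B A.

HB.instance Definition _ :=
  GRing.isLinear.Build k B graph_free_prod *:%R gfp_inl
    (@free_prod_inl_is_linear k B A).
HB.instance Definition _ :=
  GRing.isMonoidMorphism.Build B graph_free_prod gfp_inl
    (@free_prod_inl_is_monoid_morphism k B A).
HB.instance Definition _ :=
  GRing.isLinear.Build k A graph_free_prod *:%R gfp_inr
    (@free_prod_inr_is_linear k B A).
HB.instance Definition _ :=
  GRing.isMonoidMorphism.Build A graph_free_prod gfp_inr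
    (@free_prod_inr_is_monoid_morphism k B A).

Lemma to_ext_inl b : to_ext (gfp_inl b) = sub_to_ext b.
Proof. exact: free_prod_lift_inl. Qed.

Lemma to_ext_inr a : to_ext (gfp_inr a) = alg_to_ext a.
Proof. exact: free_prod_lift_inr. Qed.

Definition of_ext_gen (i : 'I_(n + m)) : graph_free_prod :=
  match split i with
  | inl u => gfp_inr (gpi (fvar k u))
  | inr j => gfp_inl (edge_gen k G j)
  end.

Lemma of_ext_genl u : of_ext_gen (lshift m u) = gfp_inr (gpi (fvar k u)).
Proof. by rewrite /of_ext_gen (unsplitK (inl u)). Qed.

Lemma of_ext_genr j : of_ext_gen (rshift n j) = gfp_inl (edge_gen k G j).
Proof. by rewrite /of_ext_gen (unsplitK (inr j)). Qed.

Lemma of_ext_rel j :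
  graded_comm (weight (extended G) (src (extended G) j))
    (weight (extended G) (tgt (extended G) j))
    (of_ext_gen (src (extended G) j)) (of_ext_gen (tgt (extended G) j)) = 0.
Proof.
have e := gpi_edge_comm k G j; rewrite /edge_comm rmorph_graded_comm /= in e.
rewrite /= !ext_weightl !of_ext_genl -(rmorph_graded_comm gfp_inr) /=.
by rewrite [X in gfp_inr X]e (raddf0 gfp_inr).
Qed.

Definition of_ext : {lrmorphism A' -> graph_free_prod} := graph_lift_hom of_ext_rel.

Lemma of_ext_var i : of_ext (gpi (fvar k i)) = of_ext_gen i.
Proof. exact: graph_lift_hom_var. Qed.

Lemma alg_to_ext_var u : alg_to_ext (gpi (fvar k u)) = ext_vertex u.
Proof. exact: graph_lift_hom_var. Qed.

Lemma of_extK : cancel of_ext to_ext.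
Proof.
pose f : {lrmorphism A' -> A'} := to_ext \o of_ext.
pose g : {lrmorphism A' -> A'} := idfun.
move=> a; rewrite -[LHS]/(f a) -[RHS]/(g a); apply: graph_hom_ext a => i.
rewrite -[LHS]/(to_ext (of_ext (gpi (fvar k i)))) of_ext_var [RHS]/=.
case: (splitP i) => [u|j] e.
  have -> : i = lshift m u by apply: val_inj.
  by rewrite of_ext_genl to_ext_inr alg_to_ext_var.
have -> : i = rshift n j by apply: val_inj.
rewrite of_ext_genr to_ext_inl /=.
have -> : edge_gen k G j = edge_lift G (fvar k j) by rewrite /edge_lift free_lift_var.
by rewrite edge_liftK free_lift_var.
Qed.

(** By the universal property of the free product it suffices to compare with the identity on the
    two factors, where generators decide. *)
Lemma to_extK : cancel to_ext of_ext.
Proof.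
pose h : {lrmorphism graph_free_prod -> graph_free_prod} := of_ext \o to_ext.
have h_inl b : h (gfp_inl b) = gfp_inl b.
  rewrite /= to_ext_inl /= -[in RHS](edge_invK b); move: (edge_inv b) => x.
  apply: (free_hom_ext (f := of_ext \o free_lift ext_edge)
    (g := gfp_inl \o edge_lift G)) => j.
  have e1 : free_lift ext_edge (fvar k j) = ext_edge j by rewrite free_lift_var.
  have e2 : edge_lift G (fvar k j) = edge_gen k G j by rewrite /edge_lift free_lift_var.
  rewrite -[LHS]/(of_ext (free_lift ext_edge (fvar k j))) e1 of_ext_var of_ext_genr.
  by rewrite [RHS]/= e2.
have h_inr a : h (gfp_inr a) = gfp_inr a.
  rewrite /= to_ext_inr.
  apply: (graph_hom_ext (f := of_ext \o alg_to_ext) (g := gfp_inr)) => u.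
  rewrite -[LHS]/(of_ext (alg_to_ext (gpi (fvar k u)))) alg_to_ext_var.
  by rewrite of_ext_var of_ext_genl.
move=> x.
have hE := @free_prod_lift_uniq k B A graph_free_prod gfp_inl gfp_inr h.
have idE := @free_prod_lift_uniq k B A graph_free_prod gfp_inl gfp_inr idfun.
rewrite -[LHS]/(h x) -[RHS]/(idfun x) hE ?idE //.
- by move=> c u v; rewrite linearP.
- by split; [apply: rmorph1 | apply: rmorphM].
Qed.

End ToExtended.

Section FreeGrading.
Variables (k : fieldType) (T : choiceType) (p : T -> nat).
Implicit Types x y : free_alg k T.

Lemma free_gr0 d : free_gr p d (0 : free_alg k T).
Proof. by apply/free_grP => s; rewrite fcoef0 eqxx. Qed.

Lemma free_grLin d c x y : free_gr p d x -> free_gr p d y -> free_gr p d (c *: x + y).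
Proof.
move=> /free_grP hx /free_grP hy; apply/free_grP => s; rewrite fcoefP => nz.
have [x0|/hx //] := eqVneq (fcoef s x) 0; apply: hy.
by apply: contraNneq nz => ->; rewrite x0 mulr0 addr0.
Qed.

Lemma free_gr1 : free_gr p 0 (1 : free_alg k T).
Proof. by rewrite -wd_nil; apply: free_gr_wd; rewrite big_nil. Qed.

Lemma free_grM d e x y : free_gr p d x -> free_gr p e y -> free_gr p (d + e) (x * y).
Proof.
move=> hx hy w /msuppM_le[u [v [/hx ud /hy ve ->]]].
by rewrite /word_weight fmM big_cat /= -/(word_weight p u) ud -/(word_weight p v) ve.
Qed.

End FreeGrading.

Section AlgGrading.
Variables (k : fieldType) (n m : nat) (G : wgraph n m).
Implicit Types a b : graph_alg k G.

Lemma alg_gr_gpi d (x : free_alg k 'I_n) :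
  free_gr_weight k G d x -> graph_alg_gr k G d (gpi x).
Proof. by move=> hx; rewrite graph_alg_grP asec_gpi; apply: nform_gr. Qed.

Lemma alg_grLin d c a b :
  graph_alg_gr k G d a -> graph_alg_gr k G d b -> graph_alg_gr k G d (c *: a + b).
Proof.
by rewrite !graph_alg_grP (linearP asec) => ha hb; apply: free_grLin.
Qed.

Lemma alg_grM d e a b :
  graph_alg_gr k G d a -> graph_alg_gr k G e b -> graph_alg_gr k G (d + e) (a * b).
Proof.
move=> /graph_alg_grP ha /graph_alg_grP hb.
rewrite -[a]gpi_asec -[b]gpi_asec -(rmorphM gpi).
by apply: alg_gr_gpi; apply: free_grM.
Qed.

Lemma free_lift_var_gr (T : choiceType) (h : T -> 'I_n) d (x : free_alg k T) :
  free_gr (fun t => weight G (h t)) d x ->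
  graph_alg_gr k G d (free_lift (fun t => gpi (fvar k (h t)) : graph_alg k G) x).
Proof.
move=> /free_grP hx.
have -> : free_lift (fun t => gpi (fvar k (h t)) : graph_alg k G) x =
    gpi (wext (fun s => wd (map h s)) x).
  rewrite -[RHS]/((gpi \o wext (fun s => wd (map h s))) x).
  clear hx; move: x; apply: free_alg_lin_ext => s.
  rewrite [RHS]/= wext_wd; apply: etrans (free_lift_wd _ _) _.
  elim: s => [|t s IHs]; first by rewrite big_nil wd_nil rmorph1.
  by rewrite big_cons /= wd_cons rmorphM IHs.
apply: alg_gr_gpi; apply/free_grP => s /fcoef_wext_neq0[t [tx ts]].
rewrite -(hx t tx); move: ts; rewrite fcoef_wd.
by case: (_ =P s) => [<-|]; rewrite ?eqxx // big_map.
Qed.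

Lemma alg_gr_words d a : graph_alg_gr k G d a ->
  a = \sum_(s <- words G d) fcoef s (asec a) *: gpi (wd s).
Proof.
move=> /graph_alg_grP/free_grP ha; rewrite -[LHS]gpi_asec.
have sup s : fcoef s (asec a) != 0 -> s \in words G d.
  by move=> /ha e; rewrite mem_words /wt e.
rewrite {1}(free_alg_support (words_uniq G d) sup) (linear_sum gpi).
by apply: eq_bigr => s _; rewrite (linearZ_LR gpi).
Qed.

End AlgGrading.

Section FreeProductGrading.
Variables (k : fieldType) (n m : nat) (G : wgraph n m).
Local Notation grFP := (free_prod_gr (graph_sub_gr k G) (graph_alg_gr k G)).
Local Notation to_ext := (@to_ext k n m G).
Local Notation of_ext := (@of_ext k n m G).

Lemma to_ext_gr d x : grFP d x -> graph_alg_gr k (extended G) d (to_ext x).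
Proof.
elim=> {d x} [d b hb|d a ha|d c x y _ hx _ hy|d e x y _ hx _ hy].
- rewrite (to_ext_inl b); apply: free_lift_var_gr.
  have /free_grP h := edge_inv_gr hb; apply/free_grP => s /h <-.
  by apply: eq_bigr => j _; apply: ext_weightr.
- rewrite (to_ext_inr a); apply: free_lift_var_gr.
  have /graph_alg_grP/free_grP h := ha; apply/free_grP => s /h <-.
  by apply: eq_bigr => u _; apply: ext_weightl.
- by rewrite (to_ext_is_linear c x y); apply: alg_grLin.
- by rewrite ((to_ext_is_monoid_morphism _ _).2 x y); apply: alg_grM.
Qed.

Lemma free_prod_gr_sum d (I : eqType) (r : seq I) (c : I -> k) (x : I -> graph_free_prod k G) :
  (forall i, i \in r -> grFP d (x i)) -> grFP d (\sum_(i <- r) c i *: x i).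
Proof.
elim: r => [|i r IHr] hx.
  (* The inductive grading has no constructor for 0, which is homogeneous of degree [d] as the image
     of [0] from the second factor. *)
  rewrite big_nil -(raddf0 (@gfp_inr k n m G)); apply: FreeProdGrr.
  by rewrite -(raddf0 gpi); apply: alg_gr_gpi; apply: free_gr0.
rewrite big_cons; apply: FreeProdGrLin; first by apply: hx; rewrite mem_head.
by apply: IHr => j jr; apply: hx; rewrite inE jr orbT.
Qed.

Lemma of_ext_wd_gr s : grFP (wt (extended G) s) (of_ext (gpi (wd s))).
Proof.
elim: s => [|i s IHs].
  rewrite wd_nil (rmorph1 gpi) (rmorph1 of_ext) /wt big_nil.
  rewrite -(rmorph1 (@gfp_inr k n m G)); apply: FreeProdGrr.
  by rewrite -(rmorph1 gpi); apply: alg_gr_gpi; apply: free_gr1.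
have -> : of_ext (gpi (wd (i :: s))) = of_ext_gen k G i * of_ext (gpi (wd s)).
  rewrite wd_cons (rmorphM gpi); apply: etrans (rmorphM of_ext _ _) _.
  by congr (_ * _); apply: of_ext_var.
rewrite /wt big_cons.
apply: FreeProdGrMul; last exact: IHs.
rewrite /=; case: (splitP i) => [u|j] e.
  have -> : i = lshift m u by apply: val_inj.
  rewrite of_ext_genl ext_weightl; apply: FreeProdGrr.
  by rewrite -wd_var; apply: alg_gr_gpi; apply: free_gr_wd; rewrite big_seq1.
have -> : i = rshift n j by apply: val_inj.
rewrite of_ext_genr ext_weightr; apply: FreeProdGrl.
rewrite /graph_sub_gr /= edge_commE addrC -scaleNr.
apply: free_grLin; apply: free_gr_wd; rewrite big_cons big_seq1 //.
by rewrite addnC.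
Qed.

Lemma of_ext_gr d a : graph_alg_gr k (extended G) d a -> grFP d (of_ext a).
Proof.
move=> /alg_gr_words ->; rewrite (linear_sum of_ext).
under eq_bigr do rewrite (linearZ_LR of_ext).
apply: free_prod_gr_sum => s; rewrite mem_words => /eqP <-.
exact: of_ext_wd_gr.
Qed.

Lemma gr_iso_free_prod : gr_iso grFP (graph_alg_gr k (extended G)).
Proof.
exists (to_ext : {linear graph_free_prod k G -> graph_alg k (extended G)}).
  exact: Bijective (@to_extK k n m G) (@of_extK k n m G).
move=> d x; split=> [|hx]; first exact: to_ext_gr.
by rewrite -[x](@to_extK k n m G); apply: of_ext_gr.
Qed.

Lemma free_prod_triangle_free :
  gr_iso (free_gr_weight k G) grFP <-> ~ has_triangle G.
Proof.
rewrite -(gr_iso_extended k G); split=> iso.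
  exact: gr_iso_trans iso gr_iso_free_prod.
exact: gr_iso_trans iso (gr_iso_sym gr_iso_free_prod).
Qed.

End FreeProductGrading.

(** * The Fox resolution *)

(** Used over [k] for a Hamel basis of the module and over the graph algebra for the terms of the
    resolution. Scalars act on the left, so coefficients are left linear. *)
Record basis (A : nzRingType) (V : lmodType A) (I : choiceType) := Basis {
  bvec : I -> V;
  bcoef : I -> V -> A;
  bcoefP : forall i a x y, bcoef i (a *: x + y) = a * bcoef i x + bcoef i y;
  bcoef_vec : forall i j, bcoef i (bvec j) = (j == i)%:R;
  bexp : forall x, exists2 r : seq I, uniq r & x = \sum_(i <- r) bcoef i x *: bvec i;
  blift : forall N : lmodType A, (I -> N) -> {linear V -> N};
  blift_vec : forall (N : lmodType A) (h : I -> N) i, blift h (bvec i) = h i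
}.

Section BasisTheory.
Variables (A : nzRingType) (V : lmodType A) (I : choiceType) (b : basis V I).

Lemma bcoef0 i : bcoef b i 0 = 0.
Proof. by have := bcoefP b i (-1) 0 0; rewrite scaler0 addr0 mulN1r addNr. Qed.

Lemma bcoefD i x y : bcoef b i (x + y) = bcoef b i x + bcoef b i y.
Proof. by have := bcoefP b i 1 x y; rewrite scale1r mul1r. Qed.

Lemma bcoefZ i a x : bcoef b i (a *: x) = a * bcoef b i x.
Proof. by have := bcoefP b i a x 0; rewrite !addr0 bcoef0 addr0. Qed.

Lemma bcoef_sum i (J : Type) (r : seq J) (x : J -> V) :
  bcoef b i (\sum_(j <- r) x j) = \sum_(j <- r) bcoef b i (x j).
Proof. exact: (big_morph _ (bcoefD i) (bcoef0 i)). Qed.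

Lemma bcoef_eq0 x : (forall i, bcoef b i x = 0) -> x = 0.
Proof.
by move=> x0; have [r _ ->] := bexp b x; rewrite big1 // => i _; rewrite x0 scale0r.
Qed.

Lemma basis_ind (P : V -> Prop) :
  P 0 -> (forall x y, P x -> P y -> P (x + y)) ->
  (forall a i, P (a *: bvec b i)) -> forall x, P x.
Proof.
by move=> P0 PD Pb x; have [r _ ->] := bexp b x; elim/big_ind: _ => // i _.
Qed.

Definition bsupp x : seq I := s2val (cid2 (bexp b x)).

Lemma bsupp_uniq x : uniq (bsupp x).
Proof. exact: (s2valP (cid2 (bexp b x))). Qed.

Lemma bsuppE x : x = \sum_(i <- bsupp x) bcoef b i x *: bvec b i.
Proof. exact: (s2valP' (cid2 (bexp b x))). Qed.

Lemma bsupp_out x i : i \notin bsupp x -> bcoef b i x = 0.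
Proof.
move=> ix; rewrite {1}(bsuppE x) bcoef_sum big_seq big1 // => j jx.
by rewrite bcoefZ bcoef_vec; case: eqP ix => [<-|]; rewrite ?jx ?mulr0.
Qed.

Section AdditiveExtension.
Variables (N : zmodType) (h : I -> A -> N).
Hypothesis hD : forall i, {morph h i : a c / a + c}.

(** The extension of coordinate maps [h i] that are merely additive. The homotopy [Delta] of the Fox
    complex is of this kind and is not linear over the algebra. *)
Definition bsum x := \sum_(i <- bsupp x) h i (bcoef b i x).

Lemma additive_ext0 i : h i 0 = 0.
Proof. by apply: (addIr (h i 0)); rewrite -hD !addr0 add0r. Qed.

Lemma bsumE r x : uniq r -> (forall i, i \notin r -> bcoef b i x = 0) ->
  bsum x = \sum_(i <- r) h i (bcoef b i x).
Proof.
move=> r_uniq r_out; pose nz i := bcoef b i x != 0.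
have trim r' : \sum_(i <- r') h i (bcoef b i x) = \sum_(i <- filter nz r') h i (bcoef b i x).
  rewrite big_filter [RHS]big_mkcond; apply: eq_bigr => i _.
  by case: ifPn => // /negPn/eqP ->; apply: additive_ext0.
rewrite /bsum (trim r) (trim (bsupp x)); apply: perm_big; apply: uniq_perm.
- by rewrite filter_uniq ?bsupp_uniq.
- by rewrite filter_uniq.
move=> i; rewrite !mem_filter; have [nzi|//] := boolP (nz i).
have -> : i \in bsupp x by apply: contraNT nzi => /bsupp_out ->.
by apply/esym; apply: contraNT nzi => /r_out ->.
Qed.

Lemma bsumD : {morph bsum : x y / x + y}.
Proof.
move=> x y; pose r := undup (bsupp x ++ bsupp y).
have r_uniq : uniq r by apply: undup_uniq.
have [rx ry] : (forall i, i \notin r -> bcoef b i x = 0) /\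
    (forall i, i \notin r -> bcoef b i y = 0).
  by split=> i; rewrite mem_undup mem_cat negb_or => /andP[? ?]; apply: bsupp_out.
rewrite !(bsumE r_uniq) // => [|i ir]; last by rewrite bcoefD rx ?ry ?addr0.
by rewrite -big_split; apply: eq_bigr => i _; rewrite bcoefD hD.
Qed.

Lemma bsumZ a i : bsum (a *: bvec b i) = h i a.
Proof.
rewrite (@bsumE [:: i]) // => [|j]; first by rewrite big_seq1 bcoefZ bcoef_vec eqxx mulr1.
by rewrite mem_seq1 bcoefZ bcoef_vec eq_sym => /negbTE ->; rewrite mulr0.
Qed.

End AdditiveExtension.

Lemma basis_lin_ext (N : lmodType A) (f g : {linear V -> N}) :
  (forall i, f (bvec b i) = g (bvec b i)) -> f =1 g.
Proof.
move=> e x; have [r _ ->] := bexp b x; rewrite !linear_sum.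
by apply: eq_bigr => i _; rewrite !linearZ /= e.
Qed.

Lemma basis_projective : projective_module V.
Proof.
move=> M N g f g_surj.
have [h hE] := choice (fun i => g_surj (f (bvec b i))).
exists (blift b h) => x.
apply: (basis_lin_ext (f := g \o blift b h)) => i.
by rewrite /= blift_vec hE.
Qed.

End BasisTheory.

Section MalgBasis.
Variables (A : nzRingType) (I : choiceType).

Lemma malg_exp (x : {malg A[I]}) :
  exists2 r : seq I, uniq r & x = \sum_(i <- r) x@_i *: << i >>.
Proof.
exists (enum_fset (msupp x)); first exact: fset_uniq.
by rewrite {1}(monalgE x); apply: eq_bigr => i _; apply: malgU_scale.
Qed.

Lemma malg_coefP i a (x y : {malg A[I]}) : (a *: x + y)@_i = a * x@_i + y@_i.
Proof. by rewrite mcoeffD mcoeffZ. Qed.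

Lemma malg_coef_vec i j : (<< j >> : {malg A[I]})@_i = (j == i)%:R.
Proof. by rewrite mcoeffU. Qed.

Definition malg_basis : basis ({malg A[I]} : lmodType A) I :=
  @Basis A {malg A[I]} I (fun i => << i >>) (fun i x => x@_i)
    malg_coefP malg_coef_vec malg_exp
    (fun N h => lext h) (fun N h i => lextU h i).

End MalgBasis.

Section Transport.
Variables (A : nzRingType) (U V : lmodType A) (I : choiceType) (b : basis U I).
Variables (f : {linear U -> V}) (g : V -> U).
Hypotheses (fK : cancel f g) (gK : cancel g f).

Fact can_is_linear : linear g.
Proof. by move=> a x y; rewrite -{1}[x]gK -{1}[y]gK -linearP fK. Qed.

Let gL : {linear V -> U} :=
  HB.pack g (GRing.isLinear.Build A V U *:%R g can_is_linear).

Definition transport_basis : basis V I.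
Proof.
apply: (@Basis A V I (fun i => f (bvec b i)) (fun i x => bcoef b i (g x)) _ _ _
  (fun N h => blift b h \o gL)).
- by move=> i a x y; rewrite can_is_linear bcoefP.
- by move=> i j; rewrite fK bcoef_vec.
- move=> x; have [r r_uniq e] := bexp b (g x); exists r => //.
  rewrite -[LHS]gK {1}e linear_sum; apply: eq_bigr => i _.
  by rewrite linearZ.
- by move=> N h i; rewrite /= fK blift_vec.
Defined.

End Transport.

(** * Hamel bases and restriction of scalars *)

Section HamelBasis.
Variables (k : fieldType) (V : lmodType k).
Implicit Types (r : seq V) (c : V -> k) (B : V -> Prop).

Definition lin_indep B := forall r c, uniq r -> {in r, forall v, B v} ->
  \sum_(v <- r) c v *: v = 0 -> {in r, forall v, c v = 0}.

Lemma maximal_indep : exists B, lin_indep B /\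
  forall B', (forall v, B v -> B' v) /\ ~ (forall v, B' v -> B v) -> ~ lin_indep B'.
Proof.
apply: classical_sets.Zorn_bigcup => F F_indep F_tot r c r_uniq rF.
(* A finite family in the union of a chain lies in one member; the alternative [r = [::]] takes care
   of the empty chain. *)
suff [B FB rB] : exists2 B, r = [::] \/ F B & {in r, forall v, B v}.
  case: FB => [->|/F_indep]; last exact.
  by move=> _ v; rewrite in_nil.
elim: r r_uniq rF => [|v r IHr] /=; first by exists (fun=> False); [left|].
case/andP=> vr r_uniq rF.
have [B FB Bv] := rF v (mem_head v r).
have [||B' FB' B'r] := IHr => //; first by move=> w wr; apply: rF; rewrite inE wr orbT.
case: FB' => [r0|FB'].
  by exists B; [right | move=> w; rewrite r0 mem_seq1 => /eqP ->].
case: (F_tot _ _ FB FB') => sBB.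
  exists B'; [by right | move=> w; rewrite inE => /predU1P[->|]; last exact: B'r].
  exact: sBB.
exists B; [by right | move=> w; rewrite inE => /predU1P[-> //|wr]].
exact/sBB/B'r.
Qed.

Lemma maximal_span B : lin_indep B ->
  (forall B', (forall v, B v -> B' v) /\ ~ (forall v, B' v -> B v) -> ~ lin_indep B') ->
  forall v, exists r c, [/\ uniq r, {in r, forall w, B w} & v = \sum_(w <- r) c w *: w].
Proof.
move=> B_indep B_max v; have [Bv|nBv] := pselect (B v).
  exists [:: v], (fun=> 1); split=> //; last by rewrite big_seq1 scale1r.
  by move=> w; rewrite mem_seq1 => /eqP ->.
have /existsNP[r /existsNP[c /not_implyP[r_uniq /not_implyP[rB /not_implyP[e]]]]] :
    ~ lin_indep (fun w => B w \/ w = v).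
  apply: B_max; split; first by move=> w Bw; left.
  by move=> /(_ v); case/(_ (or_intror erefl)) /nBv.
move=> /existsNP[w /not_implyP[wr cw]].
have B_rem : {in rem v r, forall x, B x}.
  move=> x; rewrite mem_rem_uniq // inE => /andP[xv /rB[//|]].
  by move=> ex; move/eqP: xv; rewrite ex.
have vr : v \in r.
  apply: contra_notT cw => vr; apply: (B_indep r c) => // x xr.
  by case: (rB x xr) => // ex; move: vr; rewrite -[v]ex xr.
move: e; rewrite (big_rem v) //= => e.
have cv : c v != 0.
  apply: contra_notN cw => /eqP cv; rewrite cv scale0r add0r in e.
  have [->//|wv] := eqVneq w v.
  by apply: (B_indep _ _ (rem_uniq v r_uniq) B_rem e); rewrite mem_rem_uniq // inE wv.
exists (rem v r), (fun w => - (c v)^-1 * c w); split; rewrite ?rem_uniq //.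
under eq_bigr do rewrite -scalerA.
rewrite -scaler_sumr; move/eqP: e; rewrite addrC addr_eq0 => /eqP ->.
by rewrite scalerN scaleNr opprK scalerA mulVf ?scale1r.
Qed.

Lemma hamel_basis : exists I : choiceType, inhabited (basis V I).
Proof.
have [B [B_indep /(maximal_span B_indep) B_span]] := maximal_indep.
pose I : choiceType := {v : V | `[< B v >]}.
exists I.
pose f : {linear {malg k[I]} -> V} := lext (fun i : I => val i).
have f_inj : injective f.
  move=> x y e; apply/eqP; rewrite -subr_eq0; apply/eqP.
  have {e} : f (x - y) = 0 by rewrite linearB e subrr.
  move: (x - y) => z fz; apply/malgP => i; rewrite mcoeff0.
  have [iz|/mcoeff_outdom //] := boolP (i \in msupp z).
  pose c v := if insub v is Some j then z@_(j : I) else 0.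
  have cE (j : I) : c (val j) = z@_j by rewrite /c valK.
  rewrite -cE; pose r := map val (enum_fset (msupp z)).
  suff : {in r, forall v, c v = 0} by apply; apply: map_f.
  apply: B_indep.
  - by rewrite map_inj_uniq ?fset_uniq //; apply: val_inj.
  - by move=> _ /mapP[j _ ->]; apply/asboolP; exact: (valP j).
  - rewrite big_map; apply: etrans fz.
    rewrite -[f z]/(\sum_(j <- msupp z) z@_j *: val j).
    by apply: eq_bigr => j _; rewrite cE.
have f_surj v : exists x, f x = v.
  have [r [c [r_uniq rB ->]]] := B_span v.
  elim: r {r_uniq} rB => [|w r IHr] rB.
    by exists 0; rewrite linear0 big_nil.
  have [|x xE] := IHr; first by move=> u ur; apply: rB; rewrite inE ur orbT.
  have Bw : `[< B w >] by apply/asboolP/rB; rewrite mem_head.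
  exists (c w *: << (exist _ w Bw : I) >> + x).
  by rewrite linearP xE big_cons /f /= lextU.
have [g gK] := choice f_surj.
have fK : cancel f g by move=> x; apply: f_inj; rewrite gK.
by split; apply: (transport_basis (malg_basis k I) fK gK).
Qed.

End HamelBasis.

Section Restriction.
Variables (k : fieldType) (A : algType k).

Definition restrict (M : lmodType A) : Type := M.

Section Module.
Variable M : lmodType A.

HB.instance Definition _ := GRing.Zmodule.on (restrict M).

Definition restrict_scale (c : k) (x : restrict M) : restrict M := c%:A *: (x : M).

Fact restrict_scaleA a b x : restrict_scale a (restrict_scale b x) = restrict_scale (a * b) x.
Proof. by rewrite /restrict_scale scalerA -scalerAl mul1r scalerA. Qed.

Fact restrict_scale1 : left_id 1 restrict_scale.
Proof. by move=> x; rewrite /restrict_scale !scale1r. Qed.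

Fact restrict_scaleDr : right_distributive restrict_scale +%R.
Proof. by move=> c x y; apply: scalerDr. Qed.

Fact restrict_scaleDl x : {morph restrict_scale^~ x : a b / a + b}.
Proof. by move=> a b; rewrite /restrict_scale !scalerDl. Qed.

HB.instance Definition _ := GRing.Zmodule_isLmodule.Build k (restrict M)
  restrict_scaleA restrict_scale1 restrict_scaleDr restrict_scaleDl.

Lemma restrictZ (c : k) (x : restrict M) : c *: x = c%:A *: (x : M) :> M.
Proof. by []. Qed.

Lemma scaler_algC (a : A) (c : k) (x : M) : a *: (c%:A *: x) = c%:A *: (a *: x).
Proof. by rewrite !scalerA mulr_algl mulr_algr. Qed.

End Module.

Variables (M N : lmodType A) (f : {linear M -> N}).

Definition restrict_fun (x : restrict M) : restrict N := f x.

Fact restrict_fun_is_linear : linear restrict_fun.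
Proof. by move=> c x y; rewrite /restrict_fun -[RHS]/(c%:A *: f x + f y) -linearP. Qed.

HB.instance Definition _ :=
  GRing.isLinear.Build k (restrict M) (restrict N) *:%R restrict_fun
    restrict_fun_is_linear.

End Restriction.

(** * Fox calculus and exactness *)

Section FoxResolution.
Variables (k : fieldType) (n m : nat) (G : wgraph n m) (A : algType k).
Variables (pi : {lrmorphism free_alg k 'I_n -> A}) (sec : {linear A -> free_alg k 'I_n}).
Hypothesis secK : cancel sec pi.
Hypothesis pi_ker : forall x, pi x = 0 <-> ideal_gen (edge_comms k G) x.

Variables (M : lmodType A) (S : choiceType) (bM : basis (restrict M) S).
Variables (K0 K1 K2 : lmodType A).
Variables (b0 : basis K0 S) (b1 : basis K1 ('I_n * S)%type)
  (b2 : basis K2 ('I_m * S)%type).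
Local Notation F := (free_alg k 'I_n).

Definition gen (v : 'I_n) : A := pi (fvar k v).

(** [K0], [K1], [K2] model [A (x) M], [A (x) k^V (x) M] and [A (x) k^E (x) M], free on a [k]-basis
    of [M]. This is the [k]-linear map sending [x] to [1 (x) x], placed in the copy of [M] selected
    by [i]. *)
Definition free_ext (I : choiceType) (K : lmodType A) (b : basis K I) (i : S -> I) :
    {linear restrict M -> restrict K} :=
  blift bM (fun s => bvec b (i s) : restrict K).

Lemma free_ext_vec (I : choiceType) (K : lmodType A) (b : basis K I) (i : S -> I) s :
  free_ext b i (bvec bM s) = bvec b (i s).
Proof. exact: blift_vec. Qed.

Lemma free_extP (I : choiceType) (K : lmodType A) (b : basis K I) (i : S -> I)
    (c : k) (x y : M) :
  free_ext b i (c%:A *: x + y) = c%:A *: (free_ext b i x : K) + free_ext b i y :> K.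
Proof. exact: (linearP (free_ext b i)). Qed.

Lemma free_ext_comp (I : choiceType) (K N : lmodType A) (b : basis K I) (i : S -> I)
    (f : {linear K -> N}) (g : {linear restrict M -> restrict N}) :
  (forall s, f (bvec b (i s)) = g (bvec bM s)) ->
  forall x, f (free_ext b i x) = g x.
Proof.
move=> e; apply: (basis_lin_ext (b := bM) (f := restrict_fun f \o free_ext b i)) => s.
by rewrite /= free_ext_vec; apply: e.
Qed.

Definition iota0 : {linear restrict M -> restrict K0} := free_ext b0 id.
Definition iota1 v : {linear restrict M -> restrict K1} := free_ext b1 (pair v).
Definition iota2 j : {linear restrict M -> restrict K2} := free_ext b2 (pair j).

Lemma iota0_vec s : iota0 (bvec bM s) = bvec b0 s.
Proof. exact: free_ext_vec. Qed.

Lemma iota1_vec v s : iota1 v (bvec bM s) = bvec b1 (v, s).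
Proof. exact: free_ext_vec. Qed.

(* Fox derivative of a word, with coefficients in M. *)
Fixpoint fox_word (s : seq 'I_n) (x : M) : K1 :=
  if s is v :: s' then iota1 v (pi (wd s') *: x) + gen v *: fox_word s' x else 0.

Fact fox_word_is_linear s : linear (fox_word s : restrict M -> restrict K1).
Proof.
move=> c x y; rewrite !restrictZ; elim: s => [|v s IHs] /=.
  by rewrite scaler0 addr0.
rewrite IHs 2!scalerDr !scaler_algC free_extP [X in _ = X + _]scalerDr.
by rewrite addrACA.
Qed.

Definition fox (f : F) (x : restrict M) : restrict K1 :=
  wext (fun s => fox_word s x : restrict K1) f.

Fact fox_is_linear f : linear (fox f).
Proof.
move=> c x y; rewrite /fox; elim/free_alg_ind: f => [|d s f IHf].
  by rewrite !linear0 addr0.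
by rewrite !linearP /= !wext_wd IHf fox_word_is_linear scalerDr addrACA.
Qed.

HB.instance Definition _ f :=
  GRing.isLinear.Build k (restrict M) (restrict K1) *:%R (fox f) (fox_is_linear f).

Lemma foxP c f g x : fox (c *: f + g) x = c%:A *: (fox f x : K1) + fox g x.
Proof. exact: linearP. Qed.

Lemma fox0 x : fox 0 x = 0.
Proof. exact: linear0. Qed.

Lemma foxZ c f x : fox (c *: f) x = c%:A *: (fox f x : K1).
Proof. by rewrite -[c *: f]addr0 foxP fox0 addr0. Qed.

Lemma foxB f g x : fox (f - g) x = fox f x - fox g x.
Proof. exact: linearB. Qed.

Lemma fox_wd s x : fox (wd s) x = fox_word s x.
Proof. exact: wext_wd. Qed.

Lemma fox_var_mul v f x :
  fox (fvar k v * f) x = iota1 v (pi f *: (x : M)) + gen v *: (fox f x : K1).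
Proof.
elim/free_alg_ind: f => [|c s f IHf].
  by rewrite mulr0 fox0 rmorph0 scale0r linear0 scaler0 addr0.
have e : fvar k v * wd s = wd (v :: s) by rewrite wd_cons.
rewrite mulr_linr e !foxP IHf !fox_wd /= linearP /= scalerDl.
have -> : (c *: pi (wd s)) *: (x : M) = c%:A *: (pi (wd s) *: (x : M)).
  by rewrite scalerA mulr_algl.
rewrite free_extP [in RHS]scalerDr scaler_algC scalerDr.
by rewrite addrACA.
Qed.

(** The Leibniz rule: the left factor acts on the complex and the right factor on [M]. *)
Lemma foxM f g x : fox (f * g) x = (fox f (pi g *: (x : M)) : K1) + pi f *: (fox g x : K1).
Proof.
elim/free_alg_ind: f => [|c s f IHf].
  by rewrite mul0r !fox0 rmorph0 scale0r addr0.
suff e : fox (wd s * g) x = (fox_word s (pi g *: (x : M)) : K1) + pi (wd s) *: (fox g x : K1).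
  have -> : (c *: wd s + f) * g = c *: (wd s * g) + f * g by rewrite mulrDl -scalerAl.
  rewrite [LHS]foxP [X in _ = X + _]foxP [X in _ + X = _]IHf [X in _ *: X + _ = _]e.
  rewrite [X in _ = _ *: X + _ + _]fox_wd.
  rewrite linearP /= [in RHS]scalerDl scalerDr.
  have -> : (c *: pi (wd s)) *: (fox g x : K1) = c%:A *: (pi (wd s) *: (fox g x : K1)).
    by rewrite scalerA mulr_algl.
  by rewrite addrACA.
elim: s {IHf} => [|v s IHs] /=.
  by rewrite wd_nil mul1r rmorph1 scale1r add0r.
have -> : wd (v :: s) * g = fvar k v * (wd s * g) by rewrite wd_cons mulrA.
rewrite fox_var_mul IHs !rmorphM scalerDr !scalerA addrA.
have -> : pi (wd (v :: s)) = gen v * pi (wd s) by rewrite wd_cons rmorphM.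
by [].
Qed.

Lemma fox_var v x : fox (fvar k v) x = iota1 v x.
Proof. by rewrite -wd_var fox_wd /= wd_nil rmorph1 scale1r scaler0 addr0. Qed.

Definition d0 : {linear K0 -> M} := blift b0 (fun s => bvec bM s : M).

(** In tensor notation, [a (x) v (x) x] goes to [a v (x) x - a (x) v x]. *)
Definition d1 : {linear K1 -> K0} :=
  blift b1 (fun vs => gen vs.1 *: bvec b0 vs.2 - (iota0 (gen vs.1 *: (bvec bM vs.2 : M)) : K0)).

Definition fox_d2 : {linear K2 -> K1} :=
  blift b2 (fun js => fox (edge_comm k G js.1) (bvec bM js.2) : K1).

Lemma d0_iota x : d0 (iota0 x) = x.
Proof.
apply: (free_ext_comp (N := M) (f := d0) (g := idfun)) => s.
by rewrite /d0 blift_vec.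
Qed.

Lemma d2_iota j x : fox_d2 (iota2 j x) = fox (edge_comm k G j) x.
Proof.
apply: (free_ext_comp (f := fox_d2) (g := fox (edge_comm k G j))) => s.
by rewrite /fox_d2 blift_vec.
Qed.

Fact koszul_diff_is_linear (a : A) :
  linear (fun x : restrict M => a *: (iota0 x : K0) - iota0 (a *: (x : M)) : restrict K0).
Proof.
move=> c x y; rewrite !restrictZ scalerDr scaler_algC !free_extP scalerDr scaler_algC.
by rewrite scalerBr opprD addrACA.
Qed.

Definition koszul_diff (a : A) : {linear restrict M -> restrict K0} :=
  HB.pack (fun x : restrict M => a *: (iota0 x : K0) - iota0 (a *: (x : M)) : restrict K0)
    (GRing.isLinear.Build k (restrict M) (restrict K0) *:%R _ (koszul_diff_is_linear a)).

Lemma d1_iota v x :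
  d1 (iota1 v x) = gen v *: (iota0 x : K0) - iota0 (gen v *: (x : M)).
Proof.
apply: (free_ext_comp (f := d1) (g := koszul_diff (gen v))) => s.
by rewrite /d1 blift_vec /= /iota0 free_ext_vec.
Qed.

(** The fundamental formula of Fox calculus: along a word the differences given by [d1]
    telescope. *)
Lemma d1_fox f x : d1 (fox f x) = pi f *: (iota0 x : K0) - iota0 (pi f *: (x : M)).
Proof.
elim/free_alg_ind: f => [|c s f IHf].
  by rewrite fox0 linear0 rmorph0 !scale0r linear0 subr0.
suff e : d1 (fox_word s x) = pi (wd s) *: (iota0 x : K0) - iota0 (pi (wd s) *: (x : M)).
  rewrite foxP fox_wd linearP IHf /= e (linearP pi) /= !scalerDl.
  have sE (N : lmodType A) (z : N) : (c *: pi (wd s)) *: z = c%:A *: (pi (wd s) *: z).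
    by rewrite scalerA mulr_algl.
  by rewrite !sE free_extP scalerBr opprD addrACA.
elim: s {IHf} => [|v s IHs] /=.
  by rewrite linear0 wd_nil rmorph1 !scale1r subrr.
rewrite linearD linearZ /= d1_iota IHs wd_cons rmorphM -!scalerA scalerBr.
by rewrite addrC addrA subrK.
Qed.

Lemma d0_surj x : exists y, d0 y = x.
Proof. by exists (iota0 x); apply: d0_iota. Qed.

Lemma d0_d1 y : d0 (d1 y) = 0.
Proof.
elim/(basis_ind (b := b1)): y => [|x y|a [v s]]; first by rewrite !linear0.
  by move=> ex ey; rewrite !linearD ex ey addr0.
rewrite !linearZ /= /d1 blift_vec linearB linearZ /= d0_iota.
by rewrite /d0 blift_vec subrr scaler0.
Qed.

Lemma d1_d2 y : d1 (fox_d2 y) = 0.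
Proof.
elim/(basis_ind (b := b2)): y => [|x y|a [j s]]; first by rewrite !linear0.
  by move=> ex ey; rewrite !linearD ex ey addr0.
rewrite !linearZ /= /fox_d2 blift_vec d1_fox.
have -> : pi (edge_comm k G j) = 0 by apply/pi_ker/IdealGen; exists j.
by rewrite !scale0r linear0 subrr scaler0.
Qed.

Lemma exact0 y : d0 y = 0 <-> exists z, d1 z = y.
Proof.
split=> [y0|[z <-]]; last exact: d0_d1.
(* [iota0] splits [d0] over [k]. On [a *: bvec b0 s] the element [z] is the Fox derivative of a lift
   of [a]. *)
suff [z ->] : exists z, y = d1 z + iota0 (d0 y) by exists z; rewrite y0 linear0 addr0.
elim/(basis_ind (b := b0)): {y0} y => [|x y [z1 e1] [z2 e2]|a s].
- by exists 0; rewrite !linear0 addr0.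
- exists (z1 + z2); rewrite {1}e1 {1}e2 !linearD /=.
  by rewrite addrACA.
- exists (fox (sec a) (bvec bM s)); rewrite d1_fox secK.
  have -> : d0 (a *: bvec b0 s) = a *: (bvec bM s : M) by rewrite linearZ /= /d0 blift_vec.
  by rewrite subrK iota0_vec.
Qed.

(** For a product with a factor in the ideal one term of the Leibniz rule vanishes, so the
    derivatives of the edge commutators generate all the others. *)
Lemma fox_ideal f x : ideal_gen (edge_comms k G) f -> exists z, fox_d2 z = fox f x.
Proof.
move=> If; elim: If x => {f} [f [j ->]|x|f g _ IHf _ IHg x|a f If IHf x|f a If IHf x].
- by move=> x; exists (iota2 j x); apply: d2_iota.
- by exists 0; rewrite linear0 fox0.
- have [[z1 e1] [z2 e2]] := (IHf x, IHg x).
  by exists (z1 - z2); rewrite linearB e1 e2 foxB.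
- have [z e] := IHf x; exists (pi a *: z).
  have /pi_ker f0 := If.
  by rewrite linearZ /= e foxM f0 scale0r linear0 add0r.
- have [z e] := IHf (pi a *: (x : M)); exists z.
  have /pi_ker f0 := If.
  by rewrite e foxM f0 scale0r addr0.
Qed.

(** Assembled over the basis of [K0], these maps form [Delta], a contracting homotopy modulo the
    image of [fox_d2]. It is only additive in [a], because [sec] does not respect multiplication. *)
Definition fox_sec s (a : A) : K1 := fox (sec a) (bvec bM s).

Lemma fox_secD s : {morph fox_sec s : a b / a + b}.
Proof. by move=> a b; rewrite /fox_sec linearD /fox linearD. Qed.

Local Notation Delta := (bsum b0 fox_sec).

(** Any lift [f] may replace the one chosen by [sec]: two lifts differ by an element of the ideal,
    to which [fox_ideal] applies. *)
Lemma Delta_iota f x : exists z, fox_d2 z = Delta (pi f *: (iota0 x : K0)) - fox f x.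
Proof.
have D0 : Delta 0 = 0 by apply: (addIr (Delta 0)); rewrite -bsumD ?addr0 ?add0r //; apply: fox_secD.
elim/(basis_ind (b := bM)): x => [|x y [z1 e1] [z2 e2]|c s].
- by exists 0; rewrite !linear0 scaler0 D0 addr0.
- exists (z1 + z2); rewrite linearD e1 e2 (linearD iota0) scalerDr bsumD; last exact: fox_secD.
  by rewrite (linearD (fox f)) opprD addrACA.
- have cE : pi f *: (iota0 (c *: bvec bM s) : K0) = pi (c *: f) *: bvec b0 s.
    rewrite (linearZ_LR iota0) /iota0 free_ext_vec restrictZ scaler_algC scalerA.
    by rewrite linearZ /= mulr_algl.
  have [z ez] : exists z, fox_d2 z = fox (sec (pi (c *: f)) - c *: f) (bvec bM s).
    by apply: fox_ideal; apply/pi_ker; rewrite linearB /= secK subrr.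
  exists z; rewrite ez cE bsumZ; last exact: fox_secD.
  rewrite foxB; congr (_ - _).
  by rewrite (linearZ_LR (fox f)) foxZ.
Qed.

Lemma exact1 y : d1 y = 0 <-> exists z, fox_d2 z = y.
Proof.
split=> [y0|[z <-]]; last exact: d1_d2.
have D0 : Delta 0 = 0 by apply: (addIr (Delta 0)); rewrite -bsumD ?addr0 ?add0r //; apply: fox_secD.
(* The homotopy identity, for all [y]; on a cycle the term [Delta (d1 y)] vanishes. *)
suff [z e] : exists z, fox_d2 z = Delta (d1 y) - y.
  by exists (- z); rewrite linearN e y0 D0 sub0r opprK.
elim/(basis_ind (b := b1)): {y0} y => [|x y [z1 e1] [z2 e2]|a [v s]].
- by exists 0; rewrite !linear0 D0 ?oppr0 addr0.
- exists (z1 + z2); rewrite linearD e1 e2 (linearD d1) bsumD; last exact: fox_secD.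
  by rewrite opprD addrACA.
(* These lift the coefficients of the two terms of [d1]. By the Leibniz rule their Fox derivatives
   differ by [a *: bvec b1 (v, s)]. *)
have [z1 e1] := Delta_iota (sec a * fvar k v) (bvec bM s).
have [z2 e2] := Delta_iota (sec a) (gen v *: (bvec bM s : M)).
exists (z1 - z2); rewrite linearB e1 e2.
have -> : d1 (a *: bvec b1 (v, s)) =
    pi (sec a * fvar k v) *: (iota0 (bvec bM s) : K0)
    - pi (sec a) *: (iota0 (gen v *: (bvec bM s : M)) : K0).
  rewrite linearZ /= /d1 blift_vec /= scalerBr rmorphM /= !secK -/(gen v) iota0_vec scalerA.
  by [].
have DB x1 x2 : Delta (x1 - x2) = Delta x1 - Delta x2.
  apply: (addIr (Delta x2)); rewrite -bsumD ?subrK //; exact: fox_secD.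
rewrite DB opprB.
have -> : a *: bvec b1 (v, s) = fox (sec a * fvar k v) (bvec bM s)
    - fox (sec a) (gen v *: (bvec bM s : M)) :> K1.
  by rewrite foxM fox_var addrC addKr secK /iota1 free_ext_vec.
by rewrite opprB addrACA [RHS]addrACA [- _ - _]addrC.
Qed.

End FoxResolution.

(** * Leading words and injectivity *)

Section LeadingTerms.
Variables (k : fieldType) (n m : nat) (G : wgraph n m) (A : algType k).
Variables (pi : {lrmorphism free_alg k 'I_n -> A}) (cA : seq 'I_n -> A -> k).
Local Notation gen := (gen pi).
(** [cA w a] stands for the coefficient of the trace of [w] in [a]; [acoef] will satisfy these
    axioms. *)
Hypothesis cAP : forall w c a b, cA w (c *: a + b) = c * cA w a + cA w b.
Hypothesis cA_eq0 : forall a, (forall w, cA w a = 0) -> a = 0.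
Hypothesis cA_fin : forall a, exists L, forall w, cA w a != 0 -> (size w <= L)%N.
Hypothesis cA_mul : forall w a b, cA w (a * b) != 0 ->
  exists s t, [/\ cA s a != 0, cA t b != 0 & teq (adjb G) (s ++ t) w].
Hypothesis cA_gen : forall w v, cA w (gen v) != 0 -> w = [:: v].
Hypothesis cA_top : forall w u a, cA w a != 0 -> cA (rcons w u) (a * gen u) != 0.

Variables (M : lmodType A) (S : choiceType) (bM : basis (restrict M) S).
Variables (K1 K2 : lmodType A).
Variables (b1 : basis K1 ('I_n * S)%type) (b2 : basis K2 ('I_m * S)%type).
Local Notation d2 := (fox_d2 G pi bM b1 b2).
Local Notation iota1 := (iota1 bM b1).

Lemma cA0 w : cA w 0 = 0.
Proof. by have := cAP w (-1) 0 0; rewrite scaler0 addr0 mulN1r addNr. Qed.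

Lemma cAD w a b : cA w (a + b) = cA w a + cA w b.
Proof. by have := cAP w 1 a b; rewrite scale1r mul1r. Qed.

Lemma cAZ w c a : cA w (c *: a) = c * cA w a.
Proof. by have := cAP w c a 0; rewrite cA0 !addr0. Qed.

Lemma cAN w a : cA w (- a) = - cA w a.
Proof. by rewrite -scaleN1r cAZ mulN1r. Qed.

Lemma bcoef_iota1 v p s (x : M) :
  bcoef b1 (v, s) (iota1 p x : K1) = (p == v)%:R * (bcoef bM s x)%:A.
Proof.
elim/(basis_ind (b := bM)): x => [|x y ex ey|c s'].
- by rewrite linear0 !bcoef0 scale0r mulr0.
- by rewrite linearD !bcoefD ex ey scalerDl mulrDr.
- rewrite (linearZ_LR (iota1 p)) restrictZ !bcoefZ /iota1 free_ext_vec !bcoef_vec.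
  rewrite xpair_eqE; case: (p == v) => /=; last by rewrite mulr0 mul0r.
  by case: (s' == s); rewrite !mul1r ?mulr1 ?mulr0 ?scale0r.
Qed.

Lemma d2_vec j s : d2 (bvec b2 (j, s)) =
  (iota1 (src G j) (gen (tgt G j) *: (bvec bM s : M)) : K1)
    + gen (src G j) *: bvec b1 (tgt G j, s)
  - ((-1) ^+ (weight G (src G j) * weight G (tgt G j)))%:A *:
     ((iota1 (tgt G j) (gen (src G j) *: (bvec bM s : M)) : K1)
    + gen (tgt G j) *: bvec b1 (src G j, s)).
Proof.
have fox2 p q (x : restrict M) : fox pi bM b1 (wd [:: p; q]) x =
    (iota1 p (gen q *: (x : M)) : K1) + gen p *: (iota1 q x : K1) :> K1.
  rewrite fox_wd /= wd_nil rmorph1 scale1r scaler0 addr0.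
  by rewrite wd_var.
rewrite /fox_d2 blift_vec /= edge_commE foxB foxZ !fox2 !iota1_vec.
by [].
Qed.

(** The terms where a generator acts on [M] contribute only scalar multiples of [a]. They disappear
    if generators act as 0, or if [w] does not occur in [a] because it is too long. *)
Lemma d2_coef_term (a : A) j s v s0 w :
  (forall u (x : M), gen u *: x = 0) \/ cA w a = 0 ->
  cA w (a * bcoef b1 (v, s0) (d2 (bvec b2 (j, s)))) =
    (tgt G j == v)%:R * (s == s0)%:R * cA w (a * gen (src G j))
    - (-1) ^+ (weight G (src G j) * weight G (tgt G j)) *
      ((src G j == v)%:R * (s == s0)%:R * cA w (a * gen (tgt G j))).
Proof.
move=> triv.
have low p (x : M) u : cA w (a * bcoef b1 (v, s0) (iota1 p (gen u *: x) : K1)) = 0.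
  rewrite bcoef_iota1; case: triv => [-> | a0].
    by rewrite bcoef0 scale0r !mulr0 cA0.
  by case: (p == v); rewrite ?mul0r ?mulr0 ?cA0 // mul1r mulr_algr cAZ a0 mulr0.
have top p q : cA w (a * (gen p * ((q, s) == (v, s0))%:R)) =
    (q == v)%:R * (s == s0)%:R * cA w (a * gen p).
  rewrite xpair_eqE; case: (q == v); case: (s == s0);
    by rewrite /= ?mulr1 ?mulr0 ?mul1r ?mul0r ?cA0.
rewrite d2_vec -scaleN1r !(bcoefD, bcoefZ) mulN1r mulr_algl !mulrDr mulrN -scalerAr mulrDr.
rewrite !cAD cAN cAZ cAD !low !bcoef_vec !top.
by rewrite !add0r.
Qed.

(** At the vertex [tgt G j0] only edges containing it contribute, each through its other end [p];
    [other] removes all of them except [j0]. *)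
Lemma d2_coef_top z j0 s0 w (W := rcons w (src G j0)) :
  (forall u (x : M), gen u *: x = 0) \/ (forall i, cA W (bcoef b2 i z) = 0) ->
  (forall j p, j != j0 ->
     [set src G j; tgt G j] = [set p; tgt G j0] ->
     cA W (bcoef b2 (j, s0) z * gen p) = 0) ->
  cA W (bcoef b1 (tgt G j0, s0) (d2 z)) = cA W (bcoef b2 (j0, s0) z * gen (src G j0)).
Proof.
move=> triv other; set v := tgt G j0.
pose T i := cA W (bcoef b2 i z * bcoef b1 (v, s0) (d2 (bvec b2 i))).
have T0 i : i != (j0, s0) -> T i = 0.
  case: i => j s ij; rewrite /T d2_coef_term; last by case: triv => [|tz]; [left|right].
  have [es|_] := eqVneq s s0; last by rewrite !mulr0 !mul0r mulr0 subr0.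
  have jj : j != j0 by move: ij; rewrite xpair_eqE es eqxx andbT.
  rewrite es; have [ev|_] := eqVneq (tgt G j) v.
    rewrite other // ?ev // mulr0 sub0r.
    have /negbTE -> : src G j != v by rewrite -ev src_neq_tgt.
    by rewrite !mul0r mulr0 oppr0.
  rewrite !mul0r sub0r; have [ev|_] := eqVneq (src G j) v; last by rewrite !mul0r mulr0 oppr0.
  by rewrite other ?mulr0 ?oppr0 // ev setUC.
have TE : T (j0, s0) = cA W (bcoef b2 (j0, s0) z * gen (src G j0)).
  rewrite /T d2_coef_term; last by case: triv => [|tz]; [left|right].
  by rewrite !eqxx (negbTE (src_neq_tgt G j0)) !mul0r mulr0 subr0 !mul1r.
have -> : cA W (bcoef b1 (v, s0) (d2 z)) = \sum_(i <- bsupp b2 z) T i.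
  rewrite {1}(bsuppE b2 z) linear_sum bcoef_sum (big_morph _ (cAD W) (cA0 W)).
  by apply: eq_bigr => i _; rewrite linearZ /= bcoefZ.
have [ir|ir] := boolP ((j0, s0) \in bsupp b2 z).
  by rewrite (bigD1_seq (j0, s0)) ?bsupp_uniq //= TE big1 ?addr0.
rewrite (bsupp_out ir) mul0r cA0 big_seq big1 // => i ii.
by apply: T0; apply: contraNneq ir => <-.
Qed.

Lemma edge_determined j j' p v :
  [set src G j; tgt G j] = [set p; v] -> [set src G j'; tgt G j'] = [set p; v] -> j = j'.
Proof. by move=> e e'; apply: (@ends_inj _ _ G); rewrite e e'. Qed.

(** Look at the one-letter word [src G j0] over the vertex [tgt G j0]: a contributing edge must have
    precisely these two ends. *)
Lemma d2_ker_const z : (forall u (x : M), gen u *: x = 0) -> d2 z = 0 ->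
  forall i, cA [::] (bcoef b2 i z) = 0.
Proof.
move=> triv z0 [j0 s0]; apply: contrapT => /eqP/(cA_top (src G j0)).
rewrite -d2_coef_top ?z0 ?bcoef0 ?cA0 ?eqxx //; first by left.
move=> j p jj0 e; apply: contra_neq_eq jj0 => /cA_mul[s [t [_ /cA_gen -> e']]].
have /size_teq := e'; rewrite size_cat /= addn1 => -[/size0nil s_nil].
have : p \in [:: src G j0].
  by rewrite -(perm_mem (teq_perm (adjb_irr G) e')) mem_cat mem_head orbT.
by rewrite mem_seq1 => /eqP ep; apply: edge_determined e _; rewrite ep.
Qed.

(** Append [src G j0] to a longest word in a coefficient of [z]. Another edge from [p] to [tgt G j0]
    can reach the same trace only if [p] and [src G j0] are both descents. By Levi's lemma they are
    adjacent, which closes a triangle. *)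
Lemma d2_inj z : ~ has_triangle G -> d2 z = 0 -> z = 0.
Proof.
move=> noT z0; apply: (bcoef_eq0 (b := b2)) => i1; apply: cA_eq0 => w1.
apply: contrapT => /eqP nz1.
pose P l := `[< exists i w, size w = l /\ cA w (bcoef b2 i z) != 0 >].
have exP : exists l, P l by exists (size w1); apply/asboolP; exists i1, w1.
have [L PL] : exists L, forall l, P l -> (l <= L)%N.
  have [L hL] : exists L, forall i, i \in bsupp b2 z ->
      forall w, cA w (bcoef b2 i z) != 0 -> (size w <= L)%N.
    elim: (bsupp b2 z) => [|i r [L hL]]; first by exists 0.
    have [L' hL'] := cA_fin (bcoef b2 i z); exists (maxn L L') => i'.
    rewrite inE => /predU1P[-> w /hL'|/hL h w /h]; rewrite leq_max => ->; by rewrite ?orbT.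
  exists L => l /asboolP[i [w [<- nz]]]; apply: (hL i) => //.
  by apply: contraNT nz => /bsupp_out ->; rewrite cA0.
case: (ex_maxnP exP PL) => l /asboolP[[j0 s0] [w [sw nz]]] l_max.
have /eqP := cA_top (src G j0) nz; apply.
rewrite -d2_coef_top ?z0 ?bcoef0 ?cA0 //.
  (* The word tested is one letter longer than any word occurring in [z]. *)
  right=> i; apply: contrapT => /eqP nzi.
  have : (l.+1 <= l)%N.
    apply: l_max; apply/asboolP; exists i, (rcons w (src G j0)).
    by rewrite size_rcons sw.
  by rewrite ltnn.
move=> j p jj0 e; apply: contra_neq_eq jj0 => /cA_mul[s [t [_ /cA_gen -> e']]].
have [ep|pu] := eqVneq p (src G j0); first by apply: edge_determined e _; rewrite ep.
case: noT; rewrite cats1 in e'.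
have [pu_adj _] := teq_diamond (adjb_sym G) (adjb_irr G) pu e'.
exists p, (src G j0), (tgt G j0); split; first exact/adjP.
  by apply/adjP/adj_edge.
by exists j; rewrite e setUC.
Qed.

End LeadingTerms.

(** * Global dimension *)

Section Pullback.
Variables (A : nzRingType) (P L N : lmodType A).
Variables (f : {linear P -> N}) (g : {linear L -> N}).

Definition pullback_pred : pred (P * L)%type := fun x => f x.1 == g x.2.

Fact pullback_closed : submod_closed pullback_pred.
Proof.
split=> [|a x y]; first by rewrite unfold_in /= !linear0.
by rewrite !unfold_in /= !linearP => /eqP -> /eqP ->.
Qed.

HB.instance Definition _ :=
  GRing.isSubmodClosed.Build A (P * L)%type pullback_pred pullback_closed.

Record pullback : Type := Pullback { pullback_val : P * L; _ : pullback_pred pullback_val }.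

HB.instance Definition _ := [isSub for pullback_val].
HB.instance Definition _ := [Choice of pullback by <:].
HB.instance Definition _ := [SubChoice_isSubLmodule of pullback by <:].

Definition pullback_fst (x : pullback) : P := (pullback_val x).1.
Definition pullback_snd (x : pullback) : L := (pullback_val x).2.

Fact pullback_fst_is_linear : linear pullback_fst.
Proof. by []. Qed.
Fact pullback_snd_is_linear : linear pullback_snd.
Proof. by []. Qed.

HB.instance Definition _ :=
  GRing.isLinear.Build A pullback P *:%R pullback_fst pullback_fst_is_linear.
HB.instance Definition _ :=
  GRing.isLinear.Build A pullback L *:%R pullback_snd pullback_snd_is_linear.

(** Projectivity only lifts through surjections. When [f] lands in the image of [g], the pullback
    surjects onto [P], and a section of it gives the lift. *)
Lemma projective_lift : projective_module P ->
  (forall x, exists y, g y = f x) ->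
  exists h : {linear P -> L}, forall x, g (h x) = f x.
Proof.
move=> P_proj im; pose idP : {linear P -> P} := idfun.
have [|h hE] := P_proj pullback P pullback_fst idP.
  move=> x; have [y e] := im x.
  have pxy : pullback_pred (x, y) by rewrite /pullback_pred /= e.
  by exists (Pullback pxy).
exists (pullback_snd \o h) => x /=.
have /eqP <- : f (pullback_fst (h x)) == g (pullback_snd (h x)) by case: (h x).
by rewrite hE.
Qed.

End Pullback.

Section Comparison.
Variables (A : nzRingType) (M K0 K1 K2 : lmodType A).
Variables (d0 : {linear K0 -> M}) (d1 : {linear K1 -> K0}) (d2 : {linear K2 -> K1}).
Hypotheses (K0_proj : projective_module K0) (K1_proj : projective_module K1)
  (K2_proj : projective_module K2).
Hypothesis d0_surj : forall x, exists y, d0 y = x.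
Hypothesis exact0 : forall y, d0 y = 0 <-> exists z, d1 z = y.
Hypothesis exact1 : forall y, d1 y = 0 <-> exists z, d2 z = y.

(* If M has a resolution of length 2, compare it with K in both directions:
   K -> P -> K is homotopic to the identity, and this splits off ker d2. *)
Lemma proj_dim2_retract : proj_dim_le 2 M ->
  exists phi : {linear K2 -> K2},
    (forall x, d2 (phi x) = 0) /\ (forall x, d2 x = 0 -> phi x = x).
Proof.
case=> P [del [eps [P_proj P_zero eps_surj ex0 exS]]].
have dd0 y : d0 (d1 y) = 0 by apply/exact0; exists y.
have dd1 y : d1 (d2 y) = 0 by apply/exact1; exists y.
have ed0 y : eps (del 0 y) = 0 by apply/ex0; exists y.
have ed1 y : del 0 (del 1 y) = 0 by apply/exS; exists y.
(* [P 3] vanishes, so exactness at [P 2] makes [del 1] injective. *)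
have del1_inj x : del 1 x = 0 -> x = 0.
  by move=> /exS[y <-]; rewrite (P_zero 3 isT y) linear0.
have [f0 f0E] : exists h : {linear K0 -> P 0}, forall x, eps (h x) = d0 x.
  exact: projective_lift.
have [f1 f1E] : exists h : {linear K1 -> P 1}, forall x, del 0 (h x) = (f0 \o d1) x.
  by apply: projective_lift => // x; apply/ex0; rewrite /= f0E dd0.
have [f2 f2E] : exists h : {linear K2 -> P 2}, forall x, del 1 (h x) = (f1 \o d2) x.
  by apply: projective_lift => // x; apply/exS; rewrite /= f1E /= dd1 linear0.
have [g0 g0E] : exists h : {linear P 0 -> K0}, forall x, d0 (h x) = eps x.
  exact: projective_lift.
have [g1 g1E] : exists h : {linear P 1 -> K1}, forall x, d1 (h x) = (g0 \o del 0) x.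
  by apply: projective_lift => // x; apply/exact0; rewrite /= g0E ed0.
have [g2 g2E] : exists h : {linear P 2 -> K2}, forall x, d2 (h x) = (g1 \o del 1) x.
  by apply: projective_lift => // x; apply/exact1; rewrite /= g1E /= ed1 linear0.
pose r0 : {linear K0 -> K0} := idfun \- (g0 \o f0).
have [h0 h0E] : exists h : {linear K0 -> K1}, forall x, d1 (h x) = r0 x.
  apply: projective_lift => // x; apply/exact0.
  by rewrite /r0 /= linearB /= g0E f0E subrr.
pose r1 : {linear K1 -> K1} := idfun \- (g1 \o f1) \- (h0 \o d1).
have [h1 h1E] : exists h : {linear K1 -> K2}, forall x, d2 (h x) = r1 x.
  apply: projective_lift => // x; apply/exact1.
  by rewrite /r1 /= !linearB /= g1E h0E /r0 /= f1E /= subrr.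
pose phi : {linear K2 -> K2} := idfun \- (g2 \o f2) \- (h1 \o d2).
exists phi; split=> x; rewrite /phi /=.
  rewrite !linearB /= g2E h1E /r1 /= f2E /= dd1 linear0 subr0.
  by rewrite subrr.
(* On [ker d2] both corrections vanish: [h1] is applied to 0, and [f2 x] is killed by the injective
   [del 1]. *)
move=> x0; have f2x : f2 x = 0 by apply: del1_inj; rewrite f2E /= x0 linear0.
by rewrite x0 f2x !linear0 !addr0.
Qed.

End Comparison.

Section GlobalDimension.
Variables (k : fieldType) (n m : nat) (G : wgraph n m) (A : algType k).
Variables (pi : {lrmorphism free_alg k 'I_n -> A}) (sec : {linear A -> free_alg k 'I_n}).
Hypothesis secK : cancel sec pi.
Hypothesis pi_ker : forall x, pi x = 0 <-> ideal_gen (edge_comms k G) x.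
Variable cA : seq 'I_n -> A -> k.
Local Notation gen := (gen pi).
Hypothesis cAP : forall w c a b, cA w (c *: a + b) = c * cA w a + cA w b.
Hypothesis cA_eq0 : forall a, (forall w, cA w a = 0) -> a = 0.
Hypothesis cA_fin : forall a, exists L, forall w, cA w a != 0 -> (size w <= L)%N.
Hypothesis cA_mul : forall w a b, cA w (a * b) != 0 ->
  exists s t, [/\ cA s a != 0, cA t b != 0 & teq (adjb G) (s ++ t) w].
Hypothesis cA_gen : forall w v, cA w (gen v) != 0 -> w = [:: v].
Hypothesis cA_top : forall w u a, cA w a != 0 -> cA (rcons w u) (a * gen u) != 0.

Lemma gl_dim_triangle_free : ~ has_triangle G -> gl_dim_le A 2.
Proof.
move=> noT M; have [S [bM]] := hamel_basis (restrict M : lmodType k).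
pose b0 := malg_basis A S.
pose b1 := malg_basis A ('I_n * S)%type.
pose b2 := malg_basis A ('I_m * S)%type.
(* The free module on no generators is the zero module in degrees above 2. *)
pose b3 := malg_basis A void.
pose P i : lmodType A := match i with
  | 0 => ({malg A[S]} : lmodType A)
  | 1 => ({malg A[('I_n * S)%type]} : lmodType A)
  | 2 => ({malg A[('I_m * S)%type]} : lmodType A)
  | _ => ({malg A[void]} : lmodType A)
  end.
have P3_0 (x : {malg A[void]} : lmodType A) : x = 0 by apply: (bcoef_eq0 (b := b3)); case.
pose del i : {linear P i.+1 -> P i} := match i with
  | 0 => d1 pi bM b0 b1
  | 1 => fox_d2 G pi bM b1 b2
  | i'.+2 => blift b3 (fun v : void => match v return P i'.+2 with end)
  end.
exists P, del, (d0 bM b0 : {linear P 0 -> M}); split.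
- case=> [|[|[|i]]]; [exact: basis_projective b0 | exact: basis_projective b1
    | exact: basis_projective b2 | exact: basis_projective b3].
- by case=> [|[|[|i]]] // _ x; apply: P3_0.
- exact: d0_surj.
- exact: (exact0 (sec := sec)).
- case=> [|[|i]] x.
  + exact: (exact1 (sec := sec)).
  + split=> [x0|[y <-]]; last by rewrite (P3_0 y) !linear0.
    by exists 0; rewrite linear0; apply/esym; apply: d2_inj x0.
  + by rewrite (P3_0 x) linear0; split=> // _; exists 0; rewrite linear0.
Qed.

Hypothesis cA_one : cA [::] 1 != 0.

Local Notation sgn p q := ((-1) ^+ (weight G p * weight G q) : k).

Lemma gen_adj p q : adjb G p q -> gen p * gen q = sgn p q *: (gen q * gen p).
Proof.
have edge j : gen (src G j) * gen (tgt G j) =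
    sgn (src G j) (tgt G j) *: (gen (tgt G j) * gen (src G j)).
  have : pi (edge_comm k G j) = 0 by apply/pi_ker/IdealGen; exists j.
  by rewrite /edge_comm rmorph_graded_comm graded_commE => /eqP; rewrite subr_eq0 => /eqP.
case/existsP => j /eqP/(set2_eq (src_neq_tgt G j))[[<- <-]|[<- <-]]; first exact: edge.
by rewrite edge scalerA mulnC -expr2 sqrr_sign scale1r.
Qed.

Section TrivialModule.
Variables (M : lmodType A) (S : choiceType) (bM : basis (restrict M) S) (s0 : S).
Hypothesis triv : forall u (x : M), gen u *: x = 0.
Variables (K1 K2 : lmodType A).
Variables (b1 : basis K1 ('I_n * S)%type) (b2 : basis K2 ('I_m * S)%type).
Local Notation d2 := (fox_d2 G pi bM b1 b2).
Local Notation e q := (bvec b1 (q, s0)).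

(** Each edge is stored in one orientation; for the opposite one the scalar [- sgn p q] turns the
    commutator round. *)
Lemma oriented_edge p q : adjb G p q -> exists j (c : k),
  [/\ [set src G j; tgt G j] = [set p; q], c != 0 &
    d2 (c%:A *: bvec b2 (j, s0)) = gen p *: e q - (sgn p q)%:A *: (gen q *: e p)].
Proof.
have edge j : d2 (bvec b2 (j, s0)) = gen (src G j) *: e (tgt G j)
    - (sgn (src G j) (tgt G j))%:A *: (gen (tgt G j) *: e (src G j)).
  by rewrite d2_vec !triv !linear0 !add0r.
case/existsP => j /eqP ej; exists j.
case: (set2_eq (src_neq_tgt G j) ej) => -[ep eq].
  by exists 1; split; rewrite ?oner_eq0 // !scale1r edge ep eq.
exists (- sgn p q); split=> //; first by rewrite oppr_eq0 signr_eq0.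
have cc c d (x : K1) : c%:A *: (d%:A *: x) = (c * d)%:A *: x.
  by rewrite scalerA -scalerAl mul1r scalerA.
rewrite linearZ /= edge ep eq mulnC scalerBr cc mulNr -expr2 sqrr_sign.
by rewrite !scaleNr !scale1r opprK addrC.
Qed.

(* On a triangle u, v, w the Jacobi relation is a cycle in K2 whose coefficient
   at the edge vw is the generator u. Elements of ker d2 have no constant term,
   so a retraction onto ker d2 would give that coefficient degree at least 2. *)
Lemma no_triangle_of_retract (phi : {linear K2 -> K2}) :
  (forall x, d2 (phi x) = 0) -> (forall x, d2 x = 0 -> phi x = x) -> ~ has_triangle G.
Proof.
move=> d2_phi phi_id [u [v [w [/adjP uv /adjP vw /adjP wu]]]].
have uw : adjb G u w by rewrite adjb_sym.
have [j1 [c1 [ej1 c1_nz E1]]] := oriented_edge vw.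
have [j2 [c2 [ej2 _ E2]]] := oriented_edge uw.
have [j3 [c3 [ej3 _ E3]]] := oriented_edge uv.
have algE c (a : A) (x : K1) : c%:A *: (a *: x) = (c *: a) *: x.
  by rewrite scalerA mulr_algl.
(* The Jacobi relation: the six terms cancel in pairs after reordering by [gen_adj]. *)
have key y1 y2 y3 :
    d2 y1 = gen v *: e w - (sgn v w)%:A *: (gen w *: e v) ->
    d2 y2 = gen u *: e w - (sgn u w)%:A *: (gen w *: e u) ->
    d2 y3 = gen u *: e v - (sgn u v)%:A *: (gen v *: e u) ->
    d2 (gen u *: y1 - (sgn u v)%:A *: (gen v *: y2)
      + (sgn v w * sgn u w)%:A *: (gen w *: y3)) = 0.
  have dZ a x : d2 (a *: x) = a *: d2 x by apply: linearZ.
  move=> e1 e2 e3; rewrite linearD linearB !dZ e1 e2 e3.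
  rewrite !algE !scalerBr !scalerA -!(scalerAl, scalerAr) !scalerA.
  rewrite (gen_adj uv) (gen_adj uw) (gen_adj vw) !scalerA.
  have -> : sgn u v * sgn u w * sgn v w = sgn v w * sgn u w * sgn u v.
    by rewrite mulrC [X in _ * X = _]mulrC mulrA.
  have cancel6 (x y z : K1) : x - y - (x - z) + (y - z) = 0.
    by rewrite opprB (addrC (x - y)) (addrA (z - x)) subrK addrA subrK subrr.
  exact: cancel6.
have := phi_id _ (key _ _ _ E1 E2 E3).
have irr p q : adjb G p q -> p != q by apply: contraTneq => ->; rewrite adjb_irr.
pose coef_u x := cA [:: u] (bcoef b2 (j1, s0) x).
have coef_uE y1 y2 y3 : coef_u (gen u *: y1 - (sgn u v)%:A *: (gen v *: y2)
      + (sgn v w * sgn u w)%:A *: (gen w *: y3)) =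
    cA [:: u] (gen u * bcoef b2 (j1, s0) y1)
    - sgn u v * cA [:: u] (gen v * bcoef b2 (j1, s0) y2)
    + sgn v w * sgn u w * cA [:: u] (gen w * bcoef b2 (j1, s0) y3).
  rewrite /coef_u -scaleN1r !(bcoefD, bcoefZ) mulN1r !mulr_algl.
  by rewrite !(cAD cAP) (cAN cAP) !(cAZ cAP).
(* A one-letter word in this product would need a constant term in a coefficient of [phi x], which
   lies in [ker d2]. *)
have coef_u_ker t x : cA [:: u] (gen t * bcoef b2 (j1, s0) (phi x)) = 0.
  apply: contrapT => /eqP/cA_mul[s [r [/cA_gen -> nz /size_teq]]].
  rewrite /= => -[/size0nil r0]; move: nz; rewrite r0.
  by rewrite (d2_ker_const cAP cA_mul cA_gen cA_top triv (d2_phi x)) eqxx.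
have j1N j : u \in [set src G j; tgt G j] -> (j == j1) = false.
  move=> uj; apply: contraTF uj => /eqP ->.
  by rewrite ej1 !inE negb_or irr //= irr.
have phiE y1 y2 y3 : phi (gen u *: y1 - (sgn u v)%:A *: (gen v *: y2)
      + (sgn v w * sgn u w)%:A *: (gen w *: y3)) =
    gen u *: phi y1 - (sgn u v)%:A *: (gen v *: phi y2)
      + (sgn v w * sgn u w)%:A *: (gen w *: phi y3).
  have pZ a x : phi (a *: x) = a *: phi x by apply: linearZ.
  by rewrite linearD linearB !pZ.
(* The side with [phi] has coefficient 0. On the other side only the edge [vw] contributes, with a
   nonzero multiple of [c1]. *)
move/(congr1 coef_u); rewrite phiE !coef_uE.
rewrite !coef_u_ker !mulr0 subr0 addr0 !bcoefZ !bcoef_vec eqxx.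
rewrite !xpair_eqE (j1N j2) ?ej2 ?set21 // (j1N j3) ?ej3 ?set21 //=.
rewrite !mulr0 !(cA0 cAP) !mulr0 subr0 addr0 mulr1 mulr_algr (cAZ cAP).
move/esym/eqP; rewrite mulf_eq0 (negbTE c1_nz) /=.
by have := cA_top u cA_one; rewrite mul1r /= => /negbTE ->.
Qed.

End TrivialModule.

Lemma gl_dim_no_triangle (M : lmodType A) (x : M) :
  (forall u (y : M), gen u *: y = 0) -> x != 0 -> gl_dim_le A 2 -> ~ has_triangle G.
Proof.
move=> triv x0 gd; have [S [bM]] := hamel_basis (restrict M : lmodType k).
(* A nonzero vector provides a basis index, over which the Jacobi cycle is built. *)
have [s0 _] : exists s, bcoef bM s x <> 0.
  apply/not_existsP => h; move/eqP: x0; apply; apply: (bcoef_eq0 (b := bM)) => s.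
  by apply: contrapT; apply: h.
pose b0 := malg_basis A S.
pose b1 := malg_basis A ('I_n * S)%type.
pose b2 := malg_basis A ('I_m * S)%type.
have [phi [phi0 phi_id]] : exists phi : {linear _ -> _},
    (forall y, fox_d2 G pi bM b1 b2 (phi y) = 0) /\
    (forall y, fox_d2 G pi bM b1 b2 y = 0 -> phi y = y).
  apply: (proj_dim2_retract (d0 := d0 bM b0) (d1 := d1 pi bM b0 b1)) (gd M).
  - exact: basis_projective b0.
  - exact: basis_projective b1.
  - exact: basis_projective b2.
  - exact: d0_surj.
  - exact: (exact0 (sec := sec)).
  - exact: (exact1 (sec := sec)).
exact: (no_triangle_of_retract s0 triv phi0 phi_id).
Qed.

End GlobalDimension.

(** * Trace coefficients and the trivial module *)

Section TraceCoefficients.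
Variables (k : fieldType) (n m : nat) (G : wgraph n m).
Local Notation A := (graph_alg k G).
Local Notation F := (free_alg k 'I_n).
Local Notation gpi := (@gpi k n m G).
Local Notation asec := (@asec k n m G).

(** Reading at [nf G w] makes the coefficient depend on the trace of [w] only. *)
Definition acoef (w : seq 'I_n) (a : A) : k := fcoef (nf G w) (asec a).

Lemma acoefP w c a b : acoef w (c *: a + b) = c * acoef w a + acoef w b.
Proof. by rewrite /acoef (linearP asec) [LHS]fcoefP. Qed.

Lemma asec_coef s a : fcoef s (asec a) != 0 -> nf G s = s.
Proof. by rewrite -nform_asec => /nform_coef[]. Qed.

Lemma acoef_asec s a : fcoef s (asec a) != 0 -> acoef s a != 0.
Proof. by move=> nz; rewrite /acoef (asec_coef nz). Qed.

Lemma acoef_eq0 a : (forall w, acoef w a = 0) -> a = 0.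
Proof.
move=> a0; rewrite -[a]gpi_asec -(raddf0 gpi); congr gpi.
apply: free_algP => s; rewrite fcoef0; apply: contrapT => /eqP/acoef_asec.
by rewrite a0 eqxx.
Qed.

Lemma free_size_bound (x : F) : exists L, forall w, fcoef w x != 0 -> (size w <= L)%N.
Proof.
elim/free_alg_ind: x => [|c s x [L hL]].
  by exists 0 => w; rewrite fcoef0 eqxx.
exists (maxn (size s) L) => w; rewrite fcoefP fcoef_wd leq_max.
have [->|ws] := eqVneq s w; first by rewrite leqnn.
by rewrite mulr0 add0r => /hL ->; rewrite orbT.
Qed.

Lemma acoef_fin a : exists L, forall w, acoef w a != 0 -> (size w <= L)%N.
Proof.
have [L hL] := free_size_bound (asec a); exists L => w /hL.
by rewrite -(size_teq (teq_nf G w)).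
Qed.

Lemma fcoef_mul (x y : F) r : fcoef r (x * y) != 0 ->
  exists s t, [/\ fcoef s x != 0, fcoef t y != 0 & r = s ++ t].
Proof.
rewrite fcoef.unlock mcoeff_neq0 => /msuppM_le[[s] [[t] [sx ty /(congr1 (@fmonom_val _))]]].
rewrite fmM /= => ->; exists s, t; split=> //.
  by rewrite [_ != 0]mcoeff_neq0.
by rewrite [_ != 0]mcoeff_neq0.
Qed.

Lemma acoef_mul w a b : acoef w (a * b) != 0 ->
  exists s t, [/\ acoef s a != 0, acoef t b != 0 & teq (adjb G) (s ++ t) w].
Proof.
have -> : a * b = gpi (asec a * asec b) by rewrite (rmorphM gpi) /= !gpi_asec.
rewrite /acoef asec_gpi => /nform_coef[_ [r [/fcoef_mul[s [t [sa tb ->]]] e]]].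
exists s, t; rewrite (asec_coef sa) (asec_coef tb); split=> //.
exact/nfP.
Qed.

Lemma acoef_gen w v : acoef w (gpi (fvar k v)) != 0 -> w = [:: v].
Proof.
rewrite /acoef asec_gpi -wd_var => /nform_coef[_ [t []]].
rewrite fcoef_wd; case: (_ =P t) => [<- _ /nfP e|_]; last by rewrite eqxx.
by apply: perm_small_eq; rewrite // perm_sym (teq_perm (adjb_irr G) e).
Qed.

Lemma acoef_one : acoef [::] 1 != 0.
Proof.
have nf0 : nf G [::] = [::].
  by apply/eqP; rewrite -size_eq0 -(size_teq (teq_nf G [::])).
have -> : 1 = gpi (wd [::]) :> A by rewrite wd_nil (rmorph1 gpi).
by rewrite /acoef asec_gpi nf0 nform_nf // fcoef_wd eqxx oner_eq0.
Qed.

Lemma mulr_linl (x y z : F) c : (c *: x + y) * z = c *: (x * z) + y * z.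
Proof. by rewrite mulrDl -scalerAl. Qed.

Lemma nform_mul_var u (x : F) :
  nform G (x * fvar k u) = wext (fun s => nform G (wd (rcons s u))) x.
Proof.
elim/free_alg_ind: x => [|c s x IHx]; first by rewrite mul0r !linear0.
have e : wd s * fvar k u = wd (rcons s u) by rewrite -wd_var -wd_cat cats1.
by rewrite mulr_linl e !linearP /= IHx wext_wd.
Qed.

Lemma fcoef_wext_pick (h : seq 'I_n -> F) s t (x : F) :
  (forall r, r != t -> fcoef r x != 0 -> fcoef s (h r) = 0) ->
  fcoef s (wext h x) = fcoef t x * fcoef s (h t).
Proof.
move=> other; pose r := map (@fmonom_val _) (enum_fset (msupp x)).
have r_uniq : uniq r by rewrite map_inj_uniq ?fset_uniq // => -[u] [v] /= ->.
have r_supp w : fcoef w x != 0 -> w \in r.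
  by rewrite fcoef.unlock mcoeff_neq0 => wx; apply/mapP; exists (FMonom w).
rewrite fcoef_wext -(big_map (@fmonom_val _) predT (fun t => fcoef t x * fcoef s (h t))) -/r.
have term w : w != t -> fcoef w x * fcoef s (h w) = 0.
  move=> wt; have [->|nz] := eqVneq (fcoef w x) 0; first by rewrite mul0r.
  by rewrite other ?mulr0.
have [tr|tr] := boolP (t \in r).
  by rewrite (bigD1_seq t) //= big1 ?addr0.
rewrite big_seq big1 => [|w wr]; last by apply: term; apply: contraNneq tr => <-.
have [->|/r_supp] := eqVneq (fcoef t x) 0; first by rewrite mul0r.
by rewrite (negbTE tr).
Qed.

(** By right cancellation distinct traces stay distinct after appending [u], so a single term, up to
    sign, reaches this coefficient and nothing cancels it. *)
Lemma acoef_top w u a : acoef w a != 0 -> acoef (rcons w u) (a * gpi (fvar k u)) != 0.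
Proof.
move=> nz.
have -> : a * gpi (fvar k u) = gpi (asec a * fvar k u) by rewrite (rmorphM gpi) /= gpi_asec.
rewrite /acoef asec_gpi nform_mul_var (@fcoef_wext_pick _ _ (nf G w)) => [|r rw /asec_coef nfr].
  rewrite mulf_neq0 // nform_wd fcoefZ fcoef_wd.
  have /nfP -> : teq (adjb G) (rcons (nf G w) u) (rcons w u) by rewrite teq_rcons teq_sym teq_nf.
  by rewrite eqxx mulr1 mulf_neq0 // /ksign signr_eq0.
rewrite nform_wd fcoefZ fcoef_wd; case: eqP => [/nfP|_]; last by rewrite mulr0.
by rewrite teq_rcons => /nfP; rewrite nfr => e; rewrite e eqxx in rw.
Qed.

End TraceCoefficients.

Section TrivialModule.
Variables (k : fieldType) (n m : nat) (G : wgraph n m).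

Let zero_var (i : 'I_n) : k^o := 0.

Let zero_edge j : graded_comm (weight G (src G j)) (weight G (tgt G j))
  (zero_var (src G j)) (zero_var (tgt G j)) = 0.
Proof. by rewrite /zero_var /graded_comm mul0r mulr0 subrr. Qed.

Definition augmentation : {lrmorphism graph_alg k G -> k^o} :=
  graph_lift_hom zero_edge.

Definition trivial_module : Type := k.
HB.instance Definition _ := GRing.Zmodule.on trivial_module.

Definition trivial_scale (a : graph_alg k G) (x : trivial_module) : trivial_module :=
  (augmentation a : k) * (x : k).

Fact trivial_scaleA a b x :
  trivial_scale a (trivial_scale b x) = trivial_scale (a * b) x.
Proof. by rewrite /trivial_scale (rmorphM augmentation) mulrA. Qed.

Fact trivial_scale1 : left_id 1 trivial_scale.
Proof. by move=> x; rewrite /trivial_scale (rmorph1 augmentation) mul1r. Qed.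

Fact trivial_scaleDr : right_distributive trivial_scale +%R.
Proof. by move=> a x y; rewrite /trivial_scale mulrDr. Qed.

Fact trivial_scaleDl x : {morph trivial_scale^~ x : a b / a + b}.
Proof. by move=> a b; rewrite /trivial_scale (raddfD augmentation) mulrDl. Qed.

HB.instance Definition _ := GRing.Zmodule_isLmodule.Build (graph_alg k G) trivial_module
  trivial_scaleA trivial_scale1 trivial_scaleDr trivial_scaleDl.

Lemma trivial_module_var i (x : trivial_module) :
  (gpi (G := G) (fvar k i) : graph_alg k G) *: x = 0.
Proof. by rewrite [LHS]/(trivial_scale _ _) /trivial_scale graph_lift_hom_var mul0r. Qed.

End TrivialModule.

Lemma gl_dim_triangle (k : fieldType) (n m : nat) (G : wgraph n m) :
  gl_dim_le (graph_alg k G) 2 <-> ~ has_triangle G.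
Proof.
have secK : cancel asec (@gpi k n m G) by move=> a; apply: gpi_asec.
have pi_ker x : @gpi k n m G x = 0 <-> ideal_gen (edge_comms k G) x.
  by rewrite -(raddf0 gpi) gpi_eq subr0.
split=> [gd|noT].
  have one_neq0 : (1 : k) != 0 :> trivial_module k by exact: oner_neq0.
  exact: (gl_dim_no_triangle secK pi_ker (@acoefP k n m G) (@acoef_mul k n m G)
    (@acoef_gen k n m G) (@acoef_top k n m G) (@acoef_one k n m G)
    (@trivial_module_var k n m G) one_neq0 gd).
exact: (gl_dim_triangle_free secK pi_ker (@acoefP k n m G) (@acoef_eq0 k n m G)
  (@acoef_fin k n m G) (@acoef_mul k n m G) (@acoef_gen k n m G) (@acoef_top k n m G)).
Qed.

Theorem corollary1p2 (k : fieldType) (n m : nat) (G : wgraph n m)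
    (char_k : 2%N \notin [pchar k]) :
  [<-> ~ has_triangle G;
       gr_iso (free_gr_weight k G)
              (free_prod_gr (graph_sub_gr k G) (graph_alg_gr k G));
       exists H : nat -> int,
         is_hilbert_series (graph_alg_gr k G) H /\
         ps_is_inv (graph_series G) H;
       gl_dim_le (graph_alg k G) 2].
Proof.
(* Items 2, 3 and 4 are each equivalent to item 1, through which every implication of the cycle
   passes. *)
tfae=> [/free_prod_triangle_free|/free_prod_triangle_free|/hilbert_triangle_free
  |/gl_dim_triangle] //.
- by move=> noT; apply/hilbert_triangle_free.
- by move=> noT; apply/gl_dim_triangle.
Qed.
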